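(* Let $H=\operatorname{SL}_2(\mathbb{C})$, let $V=\bigoplus_{k\in F}m_kR_k$ with $F\subset\mathbb{N}\setminus\{0\}$ finite nonempty (so $V^H=0$), let $v\in V$ be generic, let $G:=\{g\in\operatorname{GL}(V)\mid gHv=Hv\}^0$ and let $N_G(H)$ be the connected normalizer of $H$ in $G$. If $N_G(H)\neq H$, then, after replacing $v$ by $sv$ for some $s\in\prod_{k\in F}\operatorname{GL}_{m_k}=\operatorname{GL}(V)^H$ and choosing a suitable maximal torus and Borel subgroup of $H$, one of the following holds: (1) there is an $H$-module isomorphism $V\cong\bigoplus_{i=1}^{\ell}R_{k_i}\otimes\bar R_{k_i}$ with $k_1<\dots<k_\ell$, where $H$ acts on the first factors and a second copy $\bar H=\operatorname{SL}_2$ acts on the second factors, under which $v=\sum_i v_{k_i}$ with each $v_{k_i}$ a nonzero vector fixed by the diagonal copy of $\operatorname{SL}_2$ in $H\times\bar H$; (2) $1\le m_k\le k+1$ for all $k\in F$ and $m_k\geq2$ for some $k$, and there is an $H$-module isomorphism $V\cong\bigoplus_{k\in F}R_k\otimes S_k$, where $S_k\subset\bar R_k$ is the span of $x^k,x^{k-1}y,\dots,x^{k-m_k+1}y^{m_k-1}$, under which $v=\sum_k v_k$ with $v_k$ a highest weight vector of the copy of $R_{2k+2-2m_k}$ in $R_k\otimes\bar R_k$ for the diagonal $\operatorname{SL}_2$-action (such $v_k$ lies in $R_k\otimes S_k$); (3) the component of $v$ in each copy of each $R_k$ is a weight vector for the maximal torus, and not all these components have weight zero. Moreover, if $v$ is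 as in (1), then $G$ equals the image of $H\times\bar H$ in $\operatorname{GL}(V)$.
   Context: $R_n$ denotes the $\operatorname{SL}_2$-module of binary forms of degree $n$, with basis $x^n,x^{n-1}y,\dots,y^n$, $x^n$ a highest weight vector (for the Borel subgroup of upper triangular matrices). $\bar R_n$ is the same module for a second copy $\bar H$ of $\operatorname{SL}_2$. $v$ is generic means $Hv$ spans $V$ (equivalently, in each isotypic component $m_kR_k$ the $m_k$ components of $v$ are linearly independent in $R_k$). $\{\cdot\}^0$ is identity component. *)

(* Defs.v *)
From HB Require Import structures.
From mathcomp Require Import all_boot all_order all_algebra.
From mathcomp Require Import reals.
From mathcomp.real_closed Require Import complex.
Set Implicit Arguments. Unset Strict Implicit. Unset Printing Implicit Defensive.
Import Order.TTheory GRing.Theory Num.Theory.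
Local Open Scope ring_scope.

Section Defs.
Variable C : fieldType.

(** Coordinates.  For a finite set F of degrees (a uniq seq) and multiplicities
    m, the module V = (+)_{k in F} m_k R_k has basis indexed by triples
    (k, j, a) : k in F, j < m k (which copy), a <= k, the basis vector being
    x^(k-a) y^a in the j-th copy of R_k.  The same index type (k, b, a) is used
    for (+)_k R_k (x) Rbar_k (m k = k+1) and (+)_k R_k (x) S_k (b < m k), where
    a indexes the first (H) factor and b the second (Hbar) factor. *)
Definition tidx (F : seq nat) (m : nat -> nat) : seq (nat * nat * nat) :=
  flatten [seq flatten [seq [seq (k, j, a) | a <- iota 0 k.+1]
                       | j <- iota 0 (m k)] | k <- F].
Definition dimT F m := size (tidx F m).
Definition tix F m (i : 'I_(dimT F m)) : nat * nat * nat :=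
  nth (0%N, 0%N, 0%N) (tidx F m) i.

Definition i0 : 'I_2 := @Ordinal 2 0 isT.
Definition i1 : 'I_2 := @Ordinal 2 1 isT.

Definition SL2 (g : 'M[C]_2) : Prop := \det g = 1.

(** Action of g = [[a,b],[c,d]] on binary forms of degree k:
    (g.f)(x,y) = f(ax+cy, bx+dy) (a left action, for which x^k is a highest
    weight vector for the upper triangular Borel).  Entry (i,j) = coefficient
    of x^(k-i) y^i in g.(x^(k-j) y^j), computed after dehomogenizing x = 1. *)
Definition rhoE (k : nat) (g : 'M[C]_2) (i j : nat) : C :=
  (((g i0 i0)%:P + (g i1 i0) *: 'X) ^+ (k - j)
     * ((g i0 i1)%:P + (g i1 i1) *: 'X) ^+ j)`_i.
Definition rhoK (k : nat) (g : 'M[C]_2) : 'M[C]_k.+1 :=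
  \matrix_(i, j) rhoE k g i j.

Definition rhoT1 F m (g : 'M[C]_2) : 'M[C]_(dimT F m) :=
  \matrix_(p, q) let: (kj, a) := tix p in let: (kj', a') := tix q in
                 if kj == kj' then rhoE kj.1 g a a' else 0.
(** Hbar acting on the second index (the Rbar_k factor), for m k = k+1 *)
Definition rhoT2 F m (g : 'M[C]_2) : 'M[C]_(dimT F m) :=
  \matrix_(p, q) let: (k, b, a) := tix p in let: (k', b', a') := tix q in
                 if (k == k') && (a == a') then rhoE k g b b' else 0.

Definition succn (k : nat) := k.+1.

Section Module.
Variables (F : seq nat) (m : nat -> nat).
Local Notation n := (dimT F m).
Local Notation nW := (dimT F succn).

Definition orbitH (v w : 'cV[C]_n) : Prop :=
  exists g, SL2 g /\ w = rhoT1 F m g *m v.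
Definition HimgV (A : 'M[C]_n) : Prop := exists g, SL2 g /\ A = rhoT1 F m g.

Definition generic (v : 'cV[C]_n) : Prop :=
  exists (r : nat) (W : 'M[C]_(n, r)),
    (forall j, orbitH v (col j W)) /\ \rank W = n.

Definition centH (s : 'M[C]_n) : Prop :=
  s \in unitmx /\ forall g, SL2 g -> s *m rhoT1 F m g = rhoT1 F m g *m s.

Definition stabOrb (v : 'cV[C]_n) (A : 'M[C]_n) : Prop :=
  A \in unitmx /\ forall w, orbitH v w <-> orbitH v (A *m w).
End Module.

Definition mxpolyfun (n : nat) := seq (C * {ffun 'I_n * 'I_n -> nat}).
Definition evalpf n (p : mxpolyfun n) (A : 'M[C]_n) : C :=
  \sum_(t <- p) t.1 * \prod_(ij : 'I_n * 'I_n) A ij.1 ij.2 ^+ t.2 ij.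
Definition zclosedGL n (K : 'M[C]_n -> Prop) : Prop :=
  exists S : mxpolyfun n -> Prop,
    forall A, K A <-> (A \in unitmx /\ forall p, S p -> evalpf p A = 0).
Definition mxsubgroup n (K : 'M[C]_n -> Prop) : Prop :=
  [/\ K 1%:M, (forall A B, K A -> K B -> K (A *m B))
    & (forall A, K A -> K (invmx A))].
Definition finite_index n (K G : 'M[C]_n -> Prop) : Prop :=
  exists s : seq 'M[C]_n, forall g, G g ->
    exists2 t, t \in s & G t /\ K (invmx t *m g).
(** identity component of an algebraic group G <= GL_n : the intersection of
    all Zariski-closed subgroups of finite index of G. *)
Definition idcomp n (G : 'M[C]_n -> Prop) (A : 'M[C]_n) : Prop :=
  G A /\ forall K, zclosedGL K -> mxsubgroup K -> (forall B, K B -> G B) ->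
                   finite_index K G -> K A.

Section Module2.
Variables (F : seq nat) (m : nat -> nat).
Local Notation n := (dimT F m).
Local Notation nW := (dimT F succn).

Definition Ggrp (v : 'cV[C]_n) : 'M[C]_n -> Prop := idcomp (stabOrb v).
Definition normGH (v : 'cV[C]_n) (A : 'M[C]_n) : Prop :=
  Ggrp v A /\ forall B, @HimgV F m B <-> @HimgV F m (A *m B *m invmx A).
Definition connNormGH (v : 'cV[C]_n) : 'M[C]_n -> Prop := idcomp (normGH v).

Definition blk (G : seq nat) (mm : nat -> nat) (k : nat)
  (u : 'cV[C]_(dimT G mm)) : 'cV[C]_(dimT G mm) :=
  \col_p (if (tix p).1.1 == k then u p ord0 else 0).

Definition diag2 (t : C) : 'M[C]_2 :=
  \matrix_(i, j) if i == j then (if i == i0 then t else t^-1) else 0.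
Definition unip2 (c : C) : 'M[C]_2 :=
  \matrix_(i, j) if i == j then 1 else if (i == i0) && (j == i1) then c else 0.

Definition rhoDiag (g : 'M[C]_2) : 'M[C]_nW := rhoT1 F succn g *m rhoT2 F succn g.

Definition case1 (v : 'cV[C]_n) (phi : 'M[C]_(nW, n)) (psi : 'M[C]_(n, nW))
  : Prop :=
  [/\ psi *m phi = 1%:M, phi *m psi = 1%:M,
      (forall g, SL2 g -> phi *m rhoT1 F m g = rhoT1 F succn g *m phi)
    & forall k, k \in F ->
        blk k (phi *m v) != 0 /\
        forall g, SL2 g -> rhoDiag g *m blk k (phi *m v) = blk k (phi *m v)].
Definition imgHHbar (phi : 'M[C]_(nW, n)) (psi : 'M[C]_(n, nW)) (A : 'M[C]_n)
  : Prop :=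
  exists g1 g2, [/\ SL2 g1, SL2 g2 &
     A = psi *m (rhoT1 F succn g1 *m rhoT2 F succn g2) *m phi].

Definition hwvDiag (u : 'cV[C]_nW) (d : nat) : Prop :=
  [/\ u != 0,
      (forall t, t != 0 -> rhoDiag (diag2 t) *m u = t ^+ d *: u)
    & (forall c, rhoDiag (unip2 c) *m u = u)].

(** inclusion (+)_k R_k (x) S_k  ->  (+)_k R_k (x) Rbar_k  (for m k <= k+1) *)
Definition inclS : 'M[C]_(nW, n) :=
  \matrix_(p, q) (tix p == tix q)%:R.

Definition case2 (v : 'cV[C]_n) : Prop :=
  [/\ (forall k, k \in F -> (1 <= m k <= k.+1)%N),
      (exists2 k, k \in F & (2 <= m k)%N)
    & exists phi : 'M[C]_n,
        [/\ phi \in unitmx,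
            (forall g, SL2 g -> phi *m rhoT1 F m g = rhoT1 F m g *m phi)
          & forall k, k \in F ->
              hwvDiag (blk k (inclS *m (phi *m v))) (2 * k + 2 - 2 * m k)%N]].

Definition compV (v : 'cV[C]_n) (k j : nat) : 'cV[C]_k.+1 :=
  \col_(a < k.+1) \sum_(p : 'I_n | tix p == (k, j, nat_of_ord a)) v p ord0.
Definition weightvec k (c : 'cV[C]_k.+1) (lam : int) : Prop :=
  c != 0 /\ forall t, t != 0 -> rhoK k (diag2 t) *m c = (t ^ lam) *: c.

Definition case3 (v : 'cV[C]_n) : Prop :=
  (forall k j, k \in F -> (j < m k)%N -> exists lam, weightvec (compV v k j) lam)
  /\ exists k j lam, [/\ k \in F, (j < m k)%N, lam != 0
                       & weightvec (compV v k j) lam].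
End Module2.
End Defs.

(* Main.v *)
(** An element of the full normalizer of H in G is rho(h) z
    with z commuting with H and z v = rho(g) v for some g in SL_2; these g form
    a group S.  If S is finite, so is the normalizer modulo H, and N_G(H) = H.
    Otherwise S contains, up to sign and conjugation, a nontrivial unipotent
    element or a torus element with distinct weights on every R_k, k in F.  The
    span in R_k of the components of v is stable under S: it is spanned by the
    first m_k, resp. by some m_k, weight vectors.  A change of basis of the
    multiplicity spaces leads to (2), resp. (3).  Case (1) is never needed, being
    the special case m_k = k + 1 of (2).

    In case (1) let g be the Lie algebra of the stabilizer of the orbit of v.  It
    is stable under sl_2 x sl_2, so if it were larger it would contain a highest
    weight vector N orthogonal to sl_2 x sl_2 for the trace form.  Let y be the
    image of v under the Weyl element of H.  Then N y = X y with X in sl_2, and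
    comparing weights forces N to be a multiple of e in one of the two copies of
    sl_2, a contradiction.  Hence the stabilizer normalizes sl_2 x sl_2: it
    preserves or exchanges the two ideals, and the elements preserving them form
    the image of H x H, which is closed of index at most 2 and generated by
    unipotent one-parameter groups. *)
Require Import Defs.
From HB Require Import structures.
From mathcomp Require Import all_boot all_order all_algebra.
From mathcomp Require Import reals.
From mathcomp.real_closed Require Import complex.
From mathcomp Require Import ring zify boolp.
Set Implicit Arguments. Unset Strict Implicit. Unset Printing Implicit Defensive.
Import Order.TTheory GRing.Theory Num.Theory.
Local Open Scope ring_scope.

(** * Binary forms and SL_2 *)

Section Two.
Variable C : numClosedFieldType.
Implicit Types (g h X Y : 'M[C]_2).

(** All passages between groups and Lie algebras are algebraic. The unipotent one-parameter groups
    are polynomial curves $t\mapsto\sum_i t^iN_i$, and a linear condition that holds along such a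
    curve holds for every $N_i$, in particular for the velocity $N_1$.

    An identity component is defined here as an intersection of closed subgroups of finite index, so
    an upper bound for it needs one such subgroup: the images of $H$ and of $H\times H$ must be
    shown to be Zariski closed. Invertible limit points normalize the Lie algebra, this being a
    polynomial condition; after correction by group elements they are scalars on the isotypic
    components. Only the scalars $\varepsilon^k$ with $\varepsilon=\pm1$ may survive. The equation
    that forces this compares the highest weight entry $g_{00}^k$ with the coefficient $g_{00}^2$ of
    $e$ in $geg^{-1}$, multiplied by a determinant to make it polynomial.

    In the torus case all weights may be zero, which (3) forbids. Then every $m_k$ is 1, the
    centralizing factors $z$ are again given by signs, and the normalizer is finite modulo $H$ after
    all. *)

Definition mk2 (a b c d : C) : 'M[C]_2 :=
  \matrix_(i, j) if i == i0 then (if j == i0 then a else b)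
                 else (if j == i0 then c else d).

Lemma ord2P (P : 'I_2 -> Prop) : P i0 -> P i1 -> forall i, P i.
Proof.
move=> P0 P1 [[|[|//]] lti].
  by rewrite (_ : Ordinal lti = i0) //; apply: val_inj.
by rewrite (_ : Ordinal lti = i1) //; apply: val_inj.
Qed.

Lemma mk2E (a b c d : C) : ((mk2 a b c d i0 i0 = a) * (mk2 a b c d i0 i1 = b)
  * (mk2 a b c d i1 i0 = c) * (mk2 a b c d i1 i1 = d))%type.
Proof. by rewrite !mxE. Qed.

Lemma mx2P X Y : X i0 i0 = Y i0 i0 -> X i0 i1 = Y i0 i1 ->
  X i1 i0 = Y i1 i0 -> X i1 i1 = Y i1 i1 -> X = Y.
Proof.
by move=> h1 h2 h3 h4; apply/matrixP; do 2!apply: ord2P; move=> //; apply: ord2P.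
Qed.

Lemma mk2_eta X : X = mk2 (X i0 i0) (X i0 i1) (X i1 i0) (X i1 i1).
Proof. by apply: mx2P; rewrite mk2E. Qed.

Lemma sum2 (V : nmodType) (f : 'I_2 -> V) : \sum_i f i = f i0 + f i1.
Proof.
by rewrite !big_ord_recl big_ord0 addr0; congr (f _ + f _); apply: val_inj.
Qed.

Lemma mul2E X Y i j : (X *m Y) i j = X i i0 * Y i0 j + X i i1 * Y i1 j.
Proof. by rewrite mxE sum2. Qed.

Lemma det2E X : \det X = X i0 i0 * X i1 i1 - X i0 i1 * X i1 i0.
Proof.
rewrite (expand_det_row X i0) sum2 /cofactor !det_mx11 !mxE /= expr0 mul1r.
rewrite expr1 mulN1r mulrN; congr (X _ _ * X _ _ - X _ _ * X _ _); exact: val_inj.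
Qed.

Lemma tr2E X : \tr X = X i0 i0 + X i1 i1.
Proof. by rewrite /mxtrace sum2. Qed.

Lemma one2E : (((1%:M : 'M[C]_2) i0 i0 = 1) * ((1%:M : 'M[C]_2) i0 i1 = 0)
  * ((1%:M : 'M[C]_2) i1 i0 = 0) * ((1%:M : 'M[C]_2) i1 i1 = 1))%type.
Proof. by rewrite !mxE. Qed.

End Two.

Ltac mx2 := apply: mx2P; rewrite ?(mul2E, mk2E, one2E, mxE); rewrite ?(mul2E, mk2E, one2E, mxE).

Section Forms.
Variable C : numClosedFieldType.
Implicit Types (g h X Y : 'M[C]_2) (q : {poly C}) (k i j l : nat).

(** The dehomogenized images of $x$ and $y$ under [g]; the image of a monomial is a product of their
    powers. *)
Definition img0 g : {poly C} := (g i0 i0)%:P + g i1 i0 *: 'X.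
Definition img1 g : {poly C} := (g i0 i1)%:P + g i1 i1 *: 'X.

Lemma rhoEE k g i j : rhoE k g i j = (img0 g ^+ (k - j) * img1 g ^+ j)`_i.
Proof. by []. Qed.

Lemma size_lin (a b : C) : (size (a%:P + b *: 'X : {poly C})%R <= 2)%N.
Proof.
apply: (leq_trans (size_polyD _ _)); rewrite geq_max.
apply/andP; split; first by rewrite (leq_trans (size_polyC_leq1 _)).
by rewrite (leq_trans (size_scale_leq _ _)) ?size_polyX.
Qed.

Lemma size_powlin (a b : C) j : (size ((a%:P + b *: 'X) ^+ j)%R <= j.+1)%N.
Proof.
apply: (leq_trans (size_poly_exp_leq _ _)); rewrite ltnS.
by rewrite -[leqRHS]mul1n leq_mul2r -subn1 leq_subLR size_lin orbT.
Qed.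

Lemma size_img g i j : (size (img0 g ^+ i * img1 g ^+ j)%R <= (i + j).+1)%N.
Proof.
apply: (leq_trans (size_polyMleq _ _)).
have h1 := size_powlin (g i0 i0) (g i1 i0) i.
have h2 := size_powlin (g i0 i1) (g i1 i1) j.
rewrite -subn1 leq_subLR add1n; apply: leq_trans (leq_add h1 h2) _.
by rewrite addSn addnS.
Qed.

(* q is the dehomogenization of a form of degree k. *)
Definition subst_form k g q : {poly C} :=
  \sum_(l < k.+1) q`_l *: (img0 g ^+ (k - l) * img1 g ^+ l).

(** Substitution is multiplicative, but a dehomogenized form does not determine its degree; adding
    one linear factor at a time keeps the bookkeeping to [k] and [k.+1]. *)
Lemma subst_form_lin k g q (a b : C) : (size q <= k.+1)%N ->
  subst_form k.+1 g (q * (a%:P + b *: 'X)) =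
  subst_form k g q * (a *: img0 g + b *: img1 g).
Proof.
move=> sq; rewrite mulrDr mulrC mul_polyC -scalerAr.
rewrite /subst_form (eq_bigr (fun l : 'I_k.+2 =>
   (a * q`_l) *: (img0 g ^+ (k.+1 - l) * img1 g ^+ l)
   + (b * (q * 'X)`_l) *: (img0 g ^+ (k.+1 - l) * img1 g ^+ l))); last first.
  by move=> l _; rewrite coefD !coefZ scalerDl.
rewrite big_split /= mulrDr mulr_suml mulr_suml; congr (_ + _).
  rewrite big_ord_recr /= (nth_default _ sq) mulr0 scale0r addr0.
  apply: eq_bigr => l _; rewrite -scalerAr -!scalerAl scalerA; congr (_ *: _).
  by rewrite subSn -1?ltnS ?ltn_ord // exprS; ring.
rewrite big_ord_recl /= coefMX /= mulr0 scale0r add0r.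
apply: eq_bigr => l _; rewrite -scalerAr -!scalerAl scalerA coefMX /=.
by rewrite /bump /= add1n subSS exprS; congr (_ *: _); ring.
Qed.

(** Substituting [g] into the images of $x$ and $y$ under [h] gives their images under [g *m h].
    This is the source of multiplicativity of the representation. *)
Lemma subst_form_prod g h i j :
  subst_form (i + j) g (img0 h ^+ i * img1 h ^+ j) =
  img0 (g *m h) ^+ i * img1 (g *m h) ^+ j.
Proof.
have E0 : img0 (g *m h) = h i0 i0 *: img0 g + h i1 i0 *: img1 g.
  by rewrite /img0 /img1 !mul2E -!mul_polyC !rmorphD !rmorphM /=; ring.
have E1 : img1 (g *m h) = h i0 i1 *: img0 g + h i1 i1 *: img1 g.
  by rewrite /img0 /img1 !mul2E -!mul_polyC !rmorphD !rmorphM /=; ring.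
elim: j => [|j IHj].
  rewrite addn0 !expr0 !mulr1; elim: i => [|i IHi].
    by rewrite /subst_form big_ord1 coef1 scale1r mulr1.
  rewrite exprSr subst_form_lin ?IHi ?E0 -?exprSr //.
  exact: size_powlin.
rewrite exprSr mulrA addnS subst_form_lin ?size_img // IHj -E1.
by rewrite exprSr mulrA.
Qed.

Lemma rhoKM k g h : rhoK k (g *m h) = rhoK k g *m rhoK k h.
Proof.
apply/matrixP => i j; rewrite !mxE rhoEE -(subst_form_prod g h).
rewrite subnK -1?ltnS ?ltn_ord // /subst_form coef_sum; apply: eq_bigr => l _.
by rewrite coefZ !mxE !rhoEE mulrC.
Qed.

Lemma rhoK1 k : rhoK k (1%:M : 'M[C]_2) = 1%:M.
Proof.
apply/matrixP => i j; rewrite !mxE rhoEE /img0 /img1 !one2E.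
by rewrite scale0r addr0 scale1r add0r expr1n mul1r coefXn.
Qed.

(* The action of gl_2 on forms of degree k, again dehomogenized. *)
Definition dform k X q : {poly C} :=
  img0 X * q *+ k
  + ((X i0 i1)%:P + (X i1 i1 - X i0 i0) *: 'X - X i1 i0 *: 'X^2) * q^`().

Definition drhoE k X i j : C := (dform k X 'X^j)`_i.
Definition drhoK k X : 'M[C]_k.+1 := \matrix_(i, j) drhoE k X i j.

Lemma dform_linear k X : linear (dform k X).
Proof.
move=> a p q; rewrite /dform derivD derivZ.
set b := (_ + _ - _); set c := img0 X; rewrite -!mul_polyC -!(mulr_natr (_ * _)).
by ring.
Qed.
Lemma dformZ k X (a : C) q : dform k X (a *: q) = a *: dform k X q.
Proof. by rewrite /dform derivZ -!mul_polyC -!(mulr_natr (_ * _)); ring. Qed.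
HB.instance Definition _ k X :=
  GRing.isLinear.Build C {poly C} {poly C} *:%R (dform k X) (dform_linear k X).

(** Behind [dform] is the vector field $(X_{00}x+X_{10}y)\partial_x+(X_{01}x+X_{11}y)\partial_y$, in
    which Euler's relation $x\partial_x=k-y\partial_y$ eliminates $\partial_x$ at $x=1$. Hence a
    Leibniz rule in which degrees add. *)
Lemma dformM k l X (p q : {poly C}) :
  dform (k + l) X (p * q) = dform k X p * q + p * dform l X q.
Proof. by rewrite /dform derivM -!(mulr_natr (_ * _)) natrD; ring. Qed.

Lemma dform_lin X (a b : C) : dform 1 X (a%:P + b *: 'X) =
  (X i0 i0 * a + X i0 i1 * b)%:P + (X i1 i0 * a + X i1 i1 * b) *: 'X.
Proof.
rewrite /dform /img0 derivD derivC derivZ derivX add0r.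
rewrite -!mul_polyC !rmorphD !rmorphM !rmorphN /=; ring.
Qed.

Lemma dformX k X j : (j <= k)%N -> dform k X 'X^j =
  ((k - j)%:R * X i0 i0 + j%:R * X i1 i1) *: 'X^j
  + ((k - j)%:R * X i1 i0) *: 'X^(j.+1) + (j%:R * X i0 i1) *: 'X^(j.-1).
Proof.
move=> lejk; rewrite /dform /img0 derivXn natrB //.
case: j lejk => [|j] lejk.
  rewrite expr0 mulr0n -!(mulr_natr (_ * _)) -!mul_polyC.
  by rewrite ?(rmorphD, rmorphB, rmorphM, rmorph_nat) /=; ring.
rewrite /= -!(mulr_natr (_ * _)) -!mul_polyC.
rewrite ?(rmorphD, rmorphB, rmorphM, rmorph_nat) /= !exprS; ring.
Qed.

Lemma drhoEE k X i j : (j <= k)%N -> drhoE k X i j =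
  ((k - j)%:R * X i0 i0 + j%:R * X i1 i1) * (i == j)%:R
  + ((k - j)%:R * X i1 i0) * (i == j.+1)%:R
  + (j%:R * X i0 i1) * (i.+1 == j)%:R.
Proof.
move=> lejk; rewrite /drhoE dformX // !coefD !coefZ !coefXn.
by case: j lejk => [|j] lejk //=; rewrite !mul0r.
Qed.

Lemma sum_coef_poly k q : (size q <= k.+1)%N -> \sum_(l < k.+1) q`_l *: 'X^l = q.
Proof.
move=> sq; rewrite -poly_def; apply/polyP => i; rewrite coef_poly.
by case: ltnP => // leki; rewrite nth_default // (leq_trans sq).
Qed.

(** Differentiated equivariance. By the Leibniz rule it is enough to know [X] on the linear forms
    [img0 g] and [img1 g], where it is given by the columns of [X *m g = g *m Y]. *)
Lemma drhoK_intertwine k g X Y : X *m g = g *m Y ->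
  drhoK k X *m rhoK k g = rhoK k g *m drhoK k Y.
Proof.
move=> XgY; apply/matrixP => i j; rewrite !mxE.
have lejk : (j <= k)%N by rewrite -ltnS.
transitivity ((dform k X (img0 g ^+ (k - j) * img1 g ^+ j))`_i).
  rewrite -[in RHS](@sum_coef_poly k (_ * _)); last first.
    by rewrite (leq_trans (size_img _ _ _)) // subnK.
  rewrite raddf_sum coef_sum; apply: eq_bigr => l _.
  by rewrite !mxE /= dformZ coefZ rhoEE mulrC.
have d0 : dform 1 X (img0 g) = Y i0 i0 *: img0 g + Y i1 i0 *: img1 g.
  have := congr1 (fun M : 'M_2 => M i0 i0) XgY.
  have := congr1 (fun M : 'M_2 => M i1 i0) XgY.
  rewrite !mul2E /img0 /img1 => e1 e2; rewrite dform_lin e1 e2.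
  rewrite -!mul_polyC !rmorphD !rmorphM /=; ring.
have d1 : dform 1 X (img1 g) = Y i0 i1 *: img0 g + Y i1 i1 *: img1 g.
  have := congr1 (fun M : 'M_2 => M i0 i1) XgY.
  have := congr1 (fun M : 'M_2 => M i1 i1) XgY.
  rewrite !mul2E /img0 /img1 => e1 e2; rewrite dform_lin e1 e2.
  rewrite -!mul_polyC !rmorphD !rmorphM /=; ring.
have dX n q : dform n X (q ^+ n) = (dform 1 X q * q ^+ n.-1) *+ n.
  elim: n => [|n IHn]; first by rewrite expr0 mulr0n /dform mulr0n derivC mulr0 addr0.
  rewrite exprS -add1n dformM add1n IHn /= -!(mulr_natr (_ * _)) -[in n.+1]addn1 natrD.
  by case: n {IHn} => [|n] /=; rewrite ?exprS; ring.
have -> : \sum_l rhoK k g i l * drhoK k Y l j = (subst_form k g (dform k Y 'X^j))`_i.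
  by rewrite coef_sum; apply: eq_bigr => l _; rewrite !mxE coefZ mulrC rhoEE.
congr (_`_i); congr polyseq.
have sublin q1 q2 a b : subst_form k g (a *: q1 + b *: q2) =
   a *: subst_form k g q1 + b *: subst_form k g q2.
  rewrite /subst_form !scaler_sumr -big_split; apply: eq_bigr => l _ /=.
  by rewrite coefD !coefZ scalerDl !scalerA.
have subD q1 q2 : subst_form k g (q1 + q2) = subst_form k g q1 + subst_form k g q2.
  by have := sublin q1 q2 1 1; rewrite !scale1r.
have subZ q a : subst_form k g (a *: q) = a *: subst_form k g q.
  by have := sublin q 0 a 0; rewrite !scale0r !addr0.
have subX l : (l <= k)%N -> subst_form k g 'X^l = img0 g ^+ (k - l) * img1 g ^+ l.
  rewrite -ltnS => ltlk; rewrite /subst_form (bigD1 (Ordinal ltlk)) //= big1.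
    by rewrite coefXn eqxx scale1r addr0.
  by move=> p nep; rewrite coefXn (negPf (_ : p != l :> nat)) ?scale0r.
rewrite dformX // !subD !subZ subX //.
(* At [j = k] the monomial exceeds the degree, but its coefficient vanishes. *)
have -> : ((k - j)%:R * Y i1 i0) *: subst_form k g 'X^(j.+1) =
    ((k - j)%:R * Y i1 i0) *: (img0 g ^+ (k - j.+1) * img1 g ^+ j.+1).
  have [ltjk|] := ltnP j k; first by rewrite subX.
  by move=> lekj; rewrite (_ : (k - j)%N = 0%N) ?mul0r ?scale0r //; apply/eqP.
have lej1k : (j.-1 <= k)%N by rewrite (leq_trans (leq_pred _)).
have -> : (j%:R * Y i0 i1) *: subst_form k g 'X^(j.-1) =
    (j%:R * Y i0 i1) *: (img0 g ^+ (k - j).+1 * img1 g ^+ j.-1).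
  rewrite subX //; case: (val j) lejk => [|j'] lejk; first by rewrite !mul0r !scale0r.
  by rewrite /= subnSK.
have := dformM (k - j) j X (img0 g ^+ (k - j)) (img1 g ^+ j).
rewrite subnK // => ->; rewrite (dX (k - j)%N) (dX j) d0 d1.
rewrite -!mul_polyC !rmorphD !rmorphM !rmorph_nat /= subnS -!(mulr_natr (_ * _)).
move: (k - j)%N => a; move: (nat_of_ord j) => b.
case: a => [|a]; case: b => [|b]; rewrite /= ?exprS; ring.
Qed.

Lemma size_dform k X q : (size q <= k.+1)%N -> (size (dform k X q) <= k.+1)%N.
Proof.
move=> sq; rewrite -(sum_coef_poly sq) raddf_sum.
apply: (leq_trans (size_sum _ _ _)); apply/bigmax_leqP => l _.
rewrite /= dformZ (leq_trans (size_scale_leq _ _)) // dformX -1?ltnS ?ltn_ord //.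
have ltl := ltn_ord l.
do 2?[apply: (leq_trans (size_polyD _ _)); rewrite geq_max; apply/andP; split].
- by rewrite (leq_trans (size_scale_leq _ _)) ?size_polyXn.
- have [ltlk|leqk] := ltnP l k.
    by rewrite (leq_trans (size_scale_leq _ _)) ?size_polyXn.
  by rewrite (_ : (k - l)%N = 0%N) ?mul0r ?scale0r ?size_poly0 //; apply/eqP.
- rewrite (leq_trans (size_scale_leq _ _)) // size_polyXn ltnS.
  by rewrite (leq_trans (leq_pred _)) // -ltnS.
Qed.

Lemma drhoK_linear k : linear (@drhoK k).
Proof.
move=> a X Y; apply/matrixP => i j; rewrite !mxE !drhoEE -1?ltnS ?ltn_ord //.
rewrite !mxE; ring.
Qed.
HB.instance Definition _ k := GRing.isLinear.Build C 'M[C]_2 'M[C]_k.+1 *:%R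
   (@drhoK k) (@drhoK_linear k).

Lemma drhoK_mulE k X Y (i j : 'I_k.+1) : (drhoK k X *m drhoK k Y) i j =
  (dform k X (dform k Y 'X^j))`_i.
Proof.
rewrite -(@sum_coef_poly k (dform k Y _)); last first.
  by rewrite size_dform ?size_polyXn.
rewrite raddf_sum coef_sum mxE; apply: eq_bigr => l _.
by rewrite !mxE /= dformZ coefZ mulrC.
Qed.

Lemma drhoK_lie k X Y : drhoK k (X *m Y - Y *m X) =
  drhoK k X *m drhoK k Y - drhoK k Y *m drhoK k X.
Proof.
apply/matrixP => i j.
rewrite [RHS]mxE [X in _ = _ + X]mxE !drhoK_mulE mxE -coefB; congr (_`_i); congr polyseq.
rewrite /dform /img0 !mxE !sum2 !(derivD, derivN, derivM, derivMn, derivC, derivZ, derivX, derivXn) /=.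
rewrite -!(mulr_natr (_ * _)) -!mul_polyC !(rmorphD, rmorphN, rmorphM) /=; ring.
Qed.

End Forms.

(** * Generators and normal forms in $\mathrm{SL}_2$ and $\mathfrak{sl}_2$ *)

Section Sl2.
Variable C : numClosedFieldType.
Implicit Types (g h X Y : 'M[C]_2) (k i j l : nat).

Definition e2 : 'M[C]_2 := mk2 0 1 0 0.
Definition f2 : 'M[C]_2 := mk2 0 0 1 0.
Definition h2 : 'M[C]_2 := mk2 1 0 0 (-1).
Definition low2 (c : C) : 'M[C]_2 := mk2 1 0 c 1.
Definition wey2 : 'M[C]_2 := mk2 0 1 (-1) 0.

Lemma unip2E (c : C) : unip2 c = mk2 1 c 0 1.
Proof. by mx2. Qed.
Lemma diag2E (t : C) : diag2 t = mk2 t 0 0 t^-1.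
Proof. by mx2. Qed.

Lemma SL2_mk2 (a b c d : C) : SL2 (mk2 a b c d) <-> a * d - b * c = 1.
Proof. by rewrite /SL2 det2E !mk2E. Qed.

Lemma SL2_1 : SL2 (1%:M : 'M[C]_2). Proof. exact: det1. Qed.
Lemma SL2_M g h : SL2 g -> SL2 h -> SL2 (g *m h).
Proof. by rewrite /SL2 det_mulmx => -> ->; rewrite mul1r. Qed.
Lemma SL2_unit g : SL2 g -> g \in unitmx.
Proof. by rewrite /SL2 unitmxE => ->; rewrite unitr1. Qed.
Lemma SL2_V g : SL2 g -> SL2 (invmx g).
Proof. by rewrite /SL2 det_inv => ->; rewrite invr1. Qed.
Lemma SL2_unip (c : C) : SL2 (unip2 c).
Proof. by rewrite unip2E SL2_mk2; ring. Qed.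
Lemma SL2_low (c : C) : SL2 (low2 c).
Proof. by rewrite SL2_mk2; ring. Qed.
Lemma SL2_diag (t : C) : t != 0 -> SL2 (diag2 t).
Proof. by move=> t0; rewrite diag2E SL2_mk2 mul0r subr0 divff. Qed.
Lemma SL2_wey : SL2 wey2.
Proof. by rewrite SL2_mk2; ring. Qed.
Lemma SL2_scal (c : C) : c ^+ 2 = 1 -> SL2 (c%:M : 'M[C]_2).
Proof. by rewrite /SL2 det_scalar. Qed.

Lemma unip2D (a b : C) : unip2 (a + b) = unip2 a *m unip2 b.
Proof. by rewrite !unip2E; mx2; ring. Qed.
Lemma low2D (a b : C) : low2 (a + b) = low2 a *m low2 b.
Proof. by rewrite /low2; mx2; ring. Qed.
Lemma unip2_0 : unip2 (0 : C) = 1%:M.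
Proof. by rewrite unip2E; mx2. Qed.
Lemma low2_0 : low2 0 = 1%:M.
Proof. by rewrite /low2; mx2. Qed.

(** With nonzero lower left entry, [g] is a product upper, lower, upper. Otherwise multiplication by
    [low2 1] makes that entry equal to [g i1 i1], which is nonzero. *)
Lemma SL2_gen (P : 'M[C]_2 -> Prop) : (forall c, P (unip2 c)) ->
  (forall c, P (low2 c)) -> (forall g h, P g -> P h -> P (g *m h)) ->
  forall g, SL2 g -> P g.
Proof.
move=> Pu Pl PM.
have Pc g : g i1 i0 != 0 -> SL2 g -> P g.
  rewrite /SL2 det2E (mk2_eta g) !mk2E; move: (g i0 i0) (g i0 i1) (g i1 i0) (g i1 i1).
  move=> a b c d c0 dt; have bE : b = (a * d - 1) / c by rewrite -dt; field.
  suff -> : mk2 a b c d = unip2 ((a - 1) / c) *m low2 c *m unip2 ((d - 1) / c).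
    by apply: (PM _ _ _ (Pu _)); apply: (PM _ _ (Pu _) (Pl _)).
  by rewrite !unip2E bE /low2; mx2; field.
move=> g Sg; have [c0|] := eqVneq (g i1 i0) 0; last by move/Pc; apply.
have d0 : g i1 i1 != 0.
  apply: contra_eq_neq Sg => d0; rewrite det2E c0 d0 !mulr0 subrr eq_sym.
  exact: oner_neq0.
have -> : g = g *m low2 1 *m low2 (-1).
  by rewrite -mulmxA -low2D subrr low2_0 mulmx1.
apply: PM => //; apply: Pc; last exact: SL2_M (SL2_low _).
by rewrite mul2E !mk2E c0 mul0r add0r mulr1.
Qed.

Lemma rhoE_unip k (c : C) i j : rhoE k (unip2 c) i j = c ^+ (j - i) *+ 'C(j, i).
Proof.
rewrite rhoEE /img0 /img1 unip2E !mk2E scale0r addr0 scale1r expr1n mul1r.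
rewrite exprDn coef_sum.
have [lt|le] := ltnP i j.+1.
  rewrite (bigD1 (Ordinal lt)) //= big1 ?addr0 => [|l nel].
    by rewrite coefMn -polyC_exp mul_polyC coefZ coefXn eqxx mulr1.
  rewrite coefMn -polyC_exp mul_polyC coefZ coefXn eq_sym.
  by rewrite (negPf (_ : l != i :> nat)) // mulr0 mul0rn.
rewrite bin_small // mulr0n big1 // => l _.
rewrite coefMn -polyC_exp mul_polyC coefZ coefXn.
by rewrite gtn_eqF ?mulr0 ?mul0rn // (leq_ltn_trans _ le) // -ltnS.
Qed.

Lemma rhoE_low k (c : C) i j :
  rhoE k (low2 c) i j = if (j <= i)%N then c ^+ (i - j) *+ 'C(k - j, i - j) else 0.
Proof.
rewrite rhoEE /img0 /img1 !mk2E scale1r add0r coefMXn.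
case: (leqP j i) => //= _; rewrite exprDn coef_sum.
have [lt|le] := ltnP (i - j) (k - j).+1.
  rewrite (bigD1 (Ordinal lt)) //= big1 ?addr0 => [|l nel].
    by rewrite coefMn expr1n mul1r exprZn coefZ coefXn eqxx mulr1.
  rewrite coefMn expr1n mul1r exprZn coefZ coefXn eq_sym.
  by rewrite (negPf (_ : l != (i - j)%N :> nat)) // mulr0 mul0rn.
rewrite bin_small // mulr0n big1 // => l _.
rewrite coefMn expr1n mul1r exprZn coefZ coefXn.
by rewrite gtn_eqF ?mulr0 ?mul0rn // (leq_ltn_trans _ le) // -ltnS.
Qed.

Lemma rhoE_diag k (t : C) i j :
  rhoE k (diag2 t) i j = (t ^+ (k - j) * t^-1 ^+ j) * (i == j)%:R.
Proof.
rewrite rhoEE /img0 /img1 diag2E !mk2E scale0r addr0 add0r exprZn.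
by rewrite -polyC_exp mul_polyC scalerA coefZ coefXn.
Qed.

Lemma rhoE_wey k i j : rhoE k wey2 i j = (-1) ^+ (k - j) * (i == (k - j)%N)%:R.
Proof.
rewrite rhoEE /img0 /img1 !mk2E scale0r addr0 add0r exprZn expr1n mulr1.
by rewrite coefZ coefXn.
Qed.

Lemma rhoE_scal k (c : C) i j : (j <= k)%N ->
  rhoE k (c%:M) i j = c ^+ k * (i == j)%:R.
Proof.
move=> lejk; rewrite rhoEE /img0 /img1 !mxE /= scale0r addr0 add0r exprZn.
rewrite -polyC_exp mul_polyC scalerA coefZ coefXn mulr1n.
by rewrite -exprD subnK.
Qed.

Lemma rhoE_00 k g : rhoE k g 0%N 0%N = g i0 i0 ^+ k.
Proof.
rewrite rhoEE subn0 expr0 mulr1 -horner_coef0 horner_exp.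
by rewrite /img0 hornerD hornerZ hornerC hornerX mulr0 addr0.
Qed.

Lemma drhoE_e k i j : (j <= k)%N -> drhoE k e2 i j = j%:R * (i.+1 == j)%:R.
Proof. by move=> ?; rewrite drhoEE // !mk2E; ring. Qed.
Lemma drhoE_f k i j : (j <= k)%N -> drhoE k f2 i j = (k - j)%:R * (i == j.+1)%:R.
Proof. by move=> ?; rewrite drhoEE // !mk2E; ring. Qed.
Lemma drhoE_h k i j : (j <= k)%N ->
  drhoE k h2 i j = (k%:R - (j%:R *+ 2)) * (i == j)%:R.
Proof. by move=> ?; rewrite drhoEE // !mk2E natrB //; ring. Qed.

Lemma lie_ef : e2 *m f2 - f2 *m e2 = h2.
Proof. by rewrite /e2 /f2 /h2; mx2; ring. Qed.

Definition lie n (A B : 'M[C]_n) := A *m B - B *m A.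

(** [X] and [Y] are nilpotent and satisfy $XYX=X$, $YXY=Y$, so in a suitable basis they become [e2]
    and [f2]. *)
Lemma sl2_pair X Y : \tr X = 0 -> \tr Y = 0 -> X != 0 ->
  lie (lie X Y) X = 2 *: X -> lie (lie X Y) Y = (-2) *: Y ->
  exists2 h, SL2 h & X *m h = h *m e2 /\ Y *m h = h *m f2.
Proof.
move=> trX trY X0 eX eY.
have n2 : (2 : C) != 0 by rewrite pnatr_eq0.
(* From $[W,Z]=cZ$ follows $c\operatorname{tr}(Z^2)=0$; a 2 by 2 matrix with
   $\operatorname{tr}Z=\operatorname{tr}Z^2=0$ has square 0. *)
have sq0 (Z W : 'M[C]_2) (c : C) : c != 0 -> \tr Z = 0 -> lie W Z = c *: Z -> Z *m Z = 0.
  move=> c0 trZ eZ; have tZ2 : \tr (Z *m Z) = 0.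
    apply: (mulfI c0); rewrite mulr0 -mxtraceZ scalemxAl -eZ mulmxBl linearB /=.
    by rewrite -!mulmxA [X in _ - X]mxtrace_mulC -mulmxA subrr.
  move: trZ tZ2; rewrite !tr2E !mul2E => trZ tZ2.
  have dE : Z i1 i1 = - Z i0 i0 by apply/eqP; rewrite -addr_eq0 addrC trZ.
  have d0 : Z i0 i0 * Z i0 i0 + Z i0 i1 * Z i1 i0 = 0.
    by apply: (mulfI n2); rewrite mulr0 -[RHS]tZ2 dE; ring.
  by apply: mx2P; rewrite !mul2E mxE ?dE; [rewrite -[RHS]d0| | |rewrite -[RHS]d0]; ring.
have X2 : X *m X = 0 by apply: sq0 eX; rewrite ?n2.
have Y2 : Y *m Y = 0 by apply: sq0 eY; rewrite ?oppr_eq0.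
have XYX : X *m Y *m X = X.
  apply: (scalerI n2); rewrite -eX /lie !mulmxBl !mulmxBr -!mulmxA X2 !mulmx0 subr0.
  by rewrite !mulmxA X2 !mul0mx sub0r opprK scaler_nat.
have YXY : Y *m X *m Y = Y.
  apply: (scalerI n2); apply: oppr_inj; rewrite -!scaleNr -eY.
  rewrite /lie !mulmxBl !mulmxBr -!mulmxA Y2 !mulmx0 sub0r.
  by rewrite !mulmxA Y2 !mul0mx subr0 -opprD scaleNr scaler_nat.
have [u u0] : exists u : 'cV_2, X *m u != 0.
  case: (boolP (X *m delta_mx i0 (ord0 : 'I_1) == 0)) => [/eqP z0|]; last by exists (delta_mx i0 ord0).
  case: (boolP (X *m delta_mx i1 (ord0 : 'I_1) == 0)) => [/eqP z1|]; last by exists (delta_mx i1 ord0).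
  case/eqP: X0; apply/matrixP => i j; rewrite mxE.
  move: z0 z1 => /matrixP/(_ i ord0) + /matrixP/(_ i ord0).
  rewrite !mxE !sum2 !mxE /= !mulr1 !mulr0 ?addr0 ?add0r => z0 z1.
  by move: j; apply: ord2P.
(* The new basis is a nonzero vector [x] in the image of [X] together with [Y *m x]. *)
set x := X *m u in u0; set q := Y *m x.
have Xq : X *m q = x by rewrite /q /x !mulmxA XYX.
have Xx : X *m x = 0 by rewrite /x mulmxA X2 mul0mx.
have Yq : Y *m q = 0 by rewrite /q mulmxA Y2 mul0mx.
have Yx : Y *m x = q by []; clearbody q; clearbody x.
pose d := x i0 ord0 * q i1 ord0 - x i1 ord0 * q i0 ord0.
have d0 : d != 0.
  apply: contraNneq u0 => d0.
  have d' : x i0 ord0 * q i1 ord0 = x i1 ord0 * q i0 ord0.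
    by apply/eqP; rewrite -subr_eq0; apply/eqP.
  have xq (i : 'I_2) : x i ord0 *: q = q i ord0 *: x.
    apply/colP => l; rewrite !mxE; move: l; move: i.
    apply: ord2P; apply: ord2P; rewrite 1?mulrC //.
      by rewrite mulrC d' mulrC.
    by rewrite mulrC -d' mulrC.
  have x0 (i : 'I_2) : x i ord0 = 0.
    have := congr1 (mulmx X) (xq i); rewrite -!scalemxAr Xq Xx scaler0.
    by move/colP/(_ i)/eqP; rewrite !mxE mulf_eq0 orbb => /eqP.
  by apply/eqP/colP => i; rewrite x0 mxE.
have s0 : sqrtC d != 0 by rewrite sqrtC_eq0.
have sE : sqrtC d * sqrtC d = d by rewrite -expr2 sqrtCK.
(* Dividing both basis vectors by a square root of their determinant [d] gives determinant 1 and
   leaves the relations unchanged. *)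
exists ((sqrtC d)^-1 *: mk2 (x i0 ord0) (q i0 ord0) (x i1 ord0) (q i1 ord0)).
  rewrite /SL2 detZ det2E !mk2E expr2 -invfM sE [X in _ - X]mulrC.
  by rewrite -/d mulVf.
have ent (Z : 'M[C]_2) (a b : 'cV[C]_2) (i : 'I_2) : Z *m a = b ->
    Z i i0 * a i0 ord0 + Z i i1 * a i1 ord0 = b i ord0.
  by move=> <-; rewrite mxE sum2.
rewrite -!scalemxAr -!scalemxAl; split; congr (_ *: _);
  by apply: mx2P; rewrite !(mul2E, mk2E) ?(ent _ _ _ _ Xq) ?(ent _ _ _ _ Xx)
   ?(ent _ _ _ _ Yq) ?(ent _ _ _ _ Yx) ?mxE ?(mulr0, mulr1, addr0, add0r).
Qed.

Lemma comm_ef0 X : \tr X = 0 -> X *m e2 = e2 *m X -> X *m f2 = f2 *m X -> X = 0.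
Proof.
rewrite tr2E => trX.
move=> /matrixP eX /matrixP fX.
have := eX i0 i0; have := eX i0 i1; have := fX i0 i0.
rewrite !mul2E !mk2E !(mulr0, mulr1, mul0r, mul1r, addr0, add0r) => b ad c.
have a0 : X i0 i0 = 0.
  by apply/eqP; move/eqP: trX; rewrite -ad -mulr2n mulrn_eq0.
by apply: mx2P; rewrite mxE // -?ad.
Qed.

(** Jordan form with a base change of determinant 1. An eigenvector completed to a basis makes [g]
    upper triangular; a unipotent base change removes the corner when $t\ne t^{-1}$, and a diagonal
    one normalizes it otherwise. *)
Lemma SL2_normal_form g : SL2 g -> exists2 h, SL2 h &
  [\/ exists t, [/\ t != 0, t ^+ 2 != 1 & g *m h = h *m diag2 t],
      exists2 t, t ^+ 2 = 1 & g = t%:M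
    | exists2 t, t ^+ 2 = 1 & g *m h = h *m (t *: unip2 1)].
Proof.
move=> Sg; pose tau := \tr g; pose t := (tau + sqrtC (tau ^+ 2 - 4)) / 2.
have n2 : (2 : C) != 0 by rewrite pnatr_eq0.
have tE : t ^+ 2 - tau * t + 1 = 0.
  have dE : sqrtC (tau ^+ 2 - 4) ^+ 2 = tau ^+ 2 - 4 by rewrite sqrtCK.
  rewrite /t; move: (sqrtC _) dE => s dE.
  transitivity ((s ^+ 2 - (tau ^+ 2 - 4)) / 4); first by field.
  by rewrite dE subrr mul0r.
have t0 : t != 0.
  by apply: contra_eq_neq tE => ->; rewrite expr0n mulr0 subr0 add0r oner_neq0.
have [h1 Sh1 [b gh1]] : exists2 h, SL2 h & exists b, g *m h = h *m mk2 t b 0 t^-1.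
  have [u [w [ne eu ew]]] : exists u w, [/\ (u != 0) || (w != 0),
     g i0 i0 * u + g i0 i1 * w = t * u & g i1 i0 * u + g i1 i1 * w = t * w].
    move: Sg tE; rewrite /SL2 det2E /tau tr2E.
    move: (g i0 i0) (g i0 i1) (g i1 i0) (g i1 i1) => a b c d dg tE.
    have [b0|bn0] := eqVneq b 0; last first.
      (* The first row of the eigenvector equation gives $(b,t-a)$; the second row is then the
         characteristic equation. *)
      exists b, (t - a); rewrite bn0; split => //; first by ring.
      apply/eqP; rewrite -subr_eq0 -oppr_eq0 -[X in _ == X]tE -dg; apply/eqP; ring.
    have [td|tnd] := eqVneq (t - d) 0.
      exists 0, 1; rewrite oner_neq0 orbT b0; split => //; first by ring.
      by move/eqP: td; rewrite subr_eq0 => /eqP ->; ring.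
    exists (t - d), c; rewrite tnd; split => //; last by ring.
    apply/eqP; rewrite -subr_eq0 -oppr_eq0 -[X in _ == X]tE -dg; apply/eqP; ring.
  have fin h : SL2 h -> h i0 i0 = u -> h i1 i0 = w ->
      exists b, g *m h = h *m mk2 t b 0 t^-1.
    move=> Sh hu hw.
    have Sk : SL2 (invmx h *m g *m h) by do !apply: SL2_M => //; apply: SL2_V.
    set k := invmx h *m g *m h in Sk *.
    have hk : h *m k = g *m h by rewrite /k -mulmxA mulKVmx ?SL2_unit.
    clearbody k; have col : h *m (k *m delta_mx i0 (ord0 : 'I_1)) = h *m (t *: delta_mx i0 ord0).
      rewrite mulmxA hk -scalemxAr -mulmxA; apply/colP.
      by apply: ord2P; rewrite !mxE !sum2 !mxE !sum2 !mxE /= !mulr0 !mulr1 !addr0 hu hw.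
    have {col} := congr1 (mulmx (invmx h)) col.
    rewrite !mulKmx ?SL2_unit // => /colP col.
    have := col i1; have := col i0.
    rewrite !mxE !sum2 !mxE /= !mulr0 !mulr1 !addr0 => k00 k10.
    move: Sk; rewrite /SL2 det2E k00 k10 mulr0 subr0 => k11.
    exists (k i0 i1); rewrite -hk; congr (_ *m _).
    by apply: mx2P; rewrite !mk2E //; apply: (mulfI t0); rewrite k11 divff.
  have [w0|u0] := eqVneq u 0.
    rewrite w0 eqxx /= in ne.
    exists (mk2 u (- w^-1) w 0); last by apply: fin; rewrite ?mk2E // SL2_mk2 w0; field.
    by rewrite SL2_mk2 w0; field.
  exists (mk2 u 0 w u^-1); last by apply: fin; rewrite ?mk2E // SL2_mk2; field.
  by rewrite SL2_mk2; field.
have [t21|t2n] := eqVneq (t ^+ 2) 1; last first.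
  have dn : t^-1 - t != 0.
    apply: contraNneq t2n => tt; apply/eqP; move/eqP: tt; rewrite subr_eq0 => /eqP tt.
    by rewrite expr2 -{1}tt mulVf.
  exists (h1 *m unip2 (b / (t^-1 - t))); first exact/SL2_M/SL2_unip.
  constructor 1; exists t; split=> //.
  rewrite mulmxA gh1 -!mulmxA; congr (_ *m _); rewrite unip2E diag2E.
  have t21 : 1 - t ^+ 2 != 0 by rewrite subr_eq0 eq_sym.
  by mx2; field; rewrite ?t0 // mulNr -expr2 t21.
have tV : t^-1 = t by rewrite -[RHS]mulr1 -(mulfV t0) mulrA -expr2 t21 mul1r.
have [b0|bn0] := eqVneq b 0.
  exists h1 => //; constructor 2; exists t => //.
  have E : g *m h1 = t%:M *m h1.
    rewrite gh1 b0 tV (_ : mk2 t 0 0 t = t%:M) ?scalar_mxC //.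
    by apply: mx2P; rewrite !mxE.
  by rewrite -[LHS](mulmxK (SL2_unit Sh1)) E mulmxK ?SL2_unit.
(* Conjugation by [diag2 r] divides the corner [b] by $r^2=bt$, which leaves $t^{-1}=t$. *)
pose r := sqrtC (b * t).
have r0 : r != 0 by rewrite sqrtC_eq0 mulf_neq0.
have rE : r * r = b * t by rewrite -expr2 sqrtCK.
have bE : b = r * r * t by rewrite rE -mulrA -expr2 t21 mulr1.
exists (h1 *m diag2 r); first exact/SL2_M/SL2_diag.
constructor 3; exists t => //.
rewrite mulmxA gh1 -!mulmxA; congr (_ *m _).
by rewrite unip2E diag2E bE tV; mx2; field.
Qed.

End Sl2.
Arguments e2 {C}.
Arguments f2 {C}.
Arguments h2 {C}.
Arguments wey2 {C}.

(** * The coordinates (k, j, a) *)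

Section Index.
Variables (F : seq nat) (m : nat -> nat).
Hypothesis uF : uniq F.
Local Notation n := (dimT F m).
Implicit Types (k j a c : nat).

Lemma mem_tidx k j a :
  ((k, j, a) \in tidx F m) = [&& k \in F, (j < m k)%N & (a <= k)%N].
Proof.
apply/flattenP/idP => [[s /mapP [k' Fk' ->]]|].
  move=> /flattenP [s' /mapP[j' ij' ->]] /mapP[a' ia' [-> -> ->]].
  by move: ij' ia'; rewrite !mem_iota /= !add0n ltnS Fk' => -> ->.
case/and3P => Fk ltj lea; exists (flatten [seq [seq (k, j, a) | a <- iota 0 k.+1]
                       | j <- iota 0 (m k)]); first exact: (map_f _ Fk).
apply/flattenP; exists [seq (k, j, a) | a <- iota 0 k.+1].
  by apply: (map_f (fun j => [seq (k, j, a) | a <- iota 0 k.+1])); rewrite mem_iota.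
by apply: map_f; rewrite mem_iota.
Qed.

Lemma sum_tidx (V : nmodType) (G : nat * nat * nat -> V) :
  \sum_(u <- tidx F m) G u =
  \sum_(k <- F) \sum_(0 <= j < m k) \sum_(0 <= a < k.+1) G (k, j, a).
Proof.
rewrite big_flatten big_map; apply: eq_bigr => k _.
rewrite big_flatten big_map /index_iota subn0; apply: eq_bigr => j _.
by rewrite big_map.
Qed.

Lemma collapse1 (V : nmodType) (H : nat -> V) k j : k \in F -> (j < m k)%N ->
  \sum_(u <- tidx F m) (if u.1 == (k, j) then H u.2 else 0) = \sum_(a < k.+1) H a.
Proof.
move=> Fk ltj; rewrite sum_tidx (bigD1_seq k) //= [X in _ + X]big1 ?addr0 => [|k' ne].
  rewrite (bigD1_seq j) ?iota_uniq ?mem_index_iota //= [X in _ + X]big1 ?addr0.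
    by rewrite big_mkord; apply: eq_bigr => a _; rewrite eqxx.
  by move=> j' ne; apply: big1 => a _; rewrite xpair_eqE (negPf ne) andbF.
by apply: big1 => j' _; apply: big1 => a _; rewrite xpair_eqE (negPf ne).
Qed.

Lemma collapse2 (V : nmodType) (H : nat -> V) k a : k \in F -> (a <= k)%N ->
  \sum_(u <- tidx F m) (if (u.1.1 == k) && (u.2 == a) then H u.1.2 else 0) =
  \sum_(j < m k) H j.
Proof.
move=> Fk lea; rewrite sum_tidx (bigD1_seq k) //= [X in _ + X]big1 ?addr0 => [|k' ne].
  rewrite big_mkord; apply: eq_bigr => j _.
  rewrite (bigD1_seq a) ?iota_uniq ?mem_index_iota //= big1 ?addr0 ?eqxx //.
  by move=> a' ne; rewrite (negPf ne) andbF.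
by apply: big1 => j' _; apply: big1 => a' _; rewrite (negPf ne).
Qed.

Lemma uniq_flatten_proj (I T : eqType) (r : seq I) (G : I -> seq T) (pr : T -> I) :
  uniq r -> (forall i : I, uniq (G i)) -> (forall (i : I) x, x \in G i -> pr x = i) ->
  uniq (flatten [seq G x | x <- r]).
Proof.
move=> ur uG prG; elim: r ur => //= i r IHr /andP[ir ur].
rewrite cat_uniq uG IHr //= andbT; apply/hasPn => x /flattenP[s /mapP[i' i'r ->]] xG.
by apply: contra ir => /prG <-; rewrite (prG _ _ xG).
Qed.

Lemma tidx_uniq : uniq (tidx F m).
Proof.
apply: (uniq_flatten_proj (pr := fun u => u.1.1)) => // [k|k x].
  apply: (uniq_flatten_proj (pr := fun u => u.1.2)) => [|j|j x].
  - exact: iota_uniq.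
  - by rewrite map_inj_uniq ?iota_uniq // => a b [].
  - by case/mapP => a _ ->.
by case/flattenP => s /mapP[j _ ->] /mapP[a _ ->].
Qed.

Lemma tix_mem (p : 'I_n) : tix p \in tidx F m.
Proof. exact: mem_nth. Qed.

Lemma tixP (p : 'I_n) : [/\ (tix p).1.1 \in F, ((tix p).1.2 < m (tix p).1.1)%N
   & ((tix p).2 <= (tix p).1.1)%N].
Proof. by move: (tix_mem p); case: (tix p) => [[k j] a]; rewrite mem_tidx => /and3P. Qed.

Lemma tix_inj : injective (@tix F m).
Proof.
move=> p q /eqP; rewrite /tix nth_uniq //; first by move/eqP/val_inj.
exact: tidx_uniq.
Qed.

Lemma tix_surj s : s \in tidx F m -> exists p : 'I_n, tix p = s.
Proof.
move=> ss; have lt := ss; rewrite -index_mem in lt.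
by exists (Ordinal lt); rewrite /tix /= nth_index.
Qed.

Lemma sum_tix (V : nmodType) (G : nat * nat * nat -> V) :
  \sum_(p : 'I_n) G (tix p) = \sum_(u <- tidx F m) G u.
Proof. by rewrite (big_nth (0%N, 0%N, 0%N)) big_mkord. Qed.

Section Coef.
Variable V : nmodType.
Implicit Types (v w : 'cV[V]_n) (A B : 'M[V]_n).

(** Coefficients addressed by triples instead of ordinals. As [tix] is injective the sum has at most
    one term; it is 0 on triples outside the index set, so raising and lowering an index may run out
    of range. *)
Definition cf v (s : nat * nat * nat) : V := \sum_(p | tix p == s) v p ord0.
Definition cm A (s t : nat * nat * nat) : V := \sum_(p | tix p == s) \sum_(q | tix q == t) A p q.

Lemma cf_tix v p : cf v (tix p) = v p ord0.
Proof.
rewrite /cf (bigD1 p) //= big1 ?addr0 // => q /andP[/eqP /tix_inj ->].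
by rewrite eqxx.
Qed.
Lemma cm_tix A p q : cm A (tix p) (tix q) = A p q.
Proof.
rewrite /cm (bigD1 p) //= [X in _ + X]big1 ?addr0.
  rewrite (bigD1 q) //= big1 ?addr0 // => r /andP[/eqP /tix_inj ->].
  by rewrite eqxx.
by move=> r /andP[/eqP /tix_inj ->]; rewrite eqxx.
Qed.
Lemma cf_out v s : s \notin tidx F m -> cf v s = 0.
Proof.
by move=> ns; rewrite /cf big1 // => p /eqP ps; rewrite -ps tix_mem in ns.
Qed.
Lemma cm_outl A s t : s \notin tidx F m -> cm A s t = 0.
Proof.
by move=> ns; rewrite /cm big1 // => p /eqP ps; rewrite -ps tix_mem in ns.
Qed.
Lemma cm_mx G s t : s \in tidx F m -> t \in tidx F m ->
  cm (\matrix_(p, q) G (tix p) (tix q)) s t = G s t.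
Proof. by case/tix_surj => p <- /tix_surj [q <-]; rewrite cm_tix mxE. Qed.
Lemma cfP v w : (forall s, s \in tidx F m -> cf v s = cf w s) -> v = w.
Proof. by move=> e; apply/colP => p; rewrite -!cf_tix e ?tix_mem. Qed.
Lemma cmP A B : (forall s t, s \in tidx F m -> t \in tidx F m -> cm A s t = cm B s t)
  -> A = B.
Proof. by move=> e; apply/matrixP => p q; rewrite -!cm_tix e ?tix_mem. Qed.
End Coef.

Section CoefZ.
Variable V : zmodType.
Lemma cfD (v w : 'cV[V]_n) s : cf (v + w) s = cf v s + cf w s.
Proof. by rewrite /cf -big_split; apply: eq_bigr => p _; rewrite mxE. Qed.
Lemma cfN (v : 'cV[V]_n) s : cf (- v) s = - cf v s.
Proof. by rewrite /cf -sumrN; apply: eq_bigr => p _; rewrite mxE. Qed.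
Lemma cf0 s : cf (0 : 'cV[V]_n) s = 0.
Proof. by rewrite /cf big1 // => p _; rewrite mxE. Qed.
Lemma cmD (A B : 'M[V]_n) s t : cm (A + B) s t = cm A s t + cm B s t.
Proof.
rewrite /cm -big_split; apply: eq_bigr => p _; rewrite -big_split.
by apply: eq_bigr => q _; rewrite mxE.
Qed.
Lemma cmN (A : 'M[V]_n) s t : cm (- A) s t = - cm A s t.
Proof.
rewrite /cm -sumrN; apply: eq_bigr => p _; rewrite -sumrN.
by apply: eq_bigr => q _; rewrite mxE.
Qed.
Lemma cm0 s t : cm (0 : 'M[V]_n) s t = 0.
Proof. by rewrite /cm big1 // => p _; rewrite big1 // => q _; rewrite mxE. Qed.
End CoefZ.

Section CoefR.
Variable T : comNzRingType.
Implicit Types (v : 'cV[T]_n) (A M : 'M[T]_n).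

Lemma cfZ (c : T) v s : cf (c *: v) s = c * cf v s.
Proof. by rewrite /cf mulr_sumr; apply: eq_bigr => p _; rewrite mxE. Qed.
Lemma cmZ (c : T) A s t : cm (c *: A) s t = c * cm A s t.
Proof.
rewrite /cm mulr_sumr; apply: eq_bigr => p _; rewrite mulr_sumr.
by apply: eq_bigr => q _; rewrite mxE.
Qed.
Lemma cm1 s t : s \in tidx F m -> t \in tidx F m ->
  cm (1%:M : 'M[T]_n) s t = (s == t)%:R.
Proof.
by case/tix_surj => p <- /tix_surj [q <-]; rewrite cm_tix mxE (inj_eq tix_inj).
Qed.

Lemma cf_mul A v s : s \in tidx F m ->
  cf (A *m v) s = \sum_(u <- tidx F m) cm A s u * cf v u.
Proof.
case/tix_surj => p <-; rewrite cf_tix mxE -sum_tix.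
by apply: eq_bigr => q _; rewrite cm_tix cf_tix.
Qed.
Lemma cm_mul A M s t : s \in tidx F m -> t \in tidx F m ->
  cm (A *m M) s t = \sum_(u <- tidx F m) cm A s u * cm M u t.
Proof.
case/tix_surj => p <- /tix_surj [q <-]; rewrite cm_tix mxE -sum_tix.
by apply: eq_bigr => r _; rewrite !cm_tix.
Qed.

Implicit Types B : nat -> nat -> nat -> T.

(* lift1 acts on the form index a (the first factor), lift2 on the copy index j
   (the multiplicity space, or the second factor when m k = k + 1). *)
Definition lift1 B : 'M[T]_n := \matrix_(p, q)
  if (tix p).1 == (tix q).1 then B (tix p).1.1 (tix p).2 (tix q).2 else 0.
Definition lift2 B : 'M[T]_n := \matrix_(p, q)
  if ((tix p).1.1 == (tix q).1.1) && ((tix p).2 == (tix q).2)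
  then B (tix p).1.1 (tix p).1.2 (tix q).1.2 else 0.

Lemma cm_lift1 B k j a k' j' a' :
  (k, j, a) \in tidx F m -> (k', j', a') \in tidx F m ->
  cm (lift1 B) (k, j, a) (k', j', a') =
    if (k == k') && (j == j') then B k a a' else 0.
Proof.
move=> s t; rewrite /lift1 (cm_mx (fun p q => if p.1 == q.1 then B p.1.1 p.2 q.2 else 0)) //.
Qed.
Lemma cm_lift2 B k j a k' j' a' :
  (k, j, a) \in tidx F m -> (k', j', a') \in tidx F m ->
  cm (lift2 B) (k, j, a) (k', j', a') =
    if (k == k') && (a == a') then B k j j' else 0.
Proof.
move=> s t; rewrite /lift2 (cm_mx (fun p q => if (p.1.1 == q.1.1) && (p.2 == q.2)
  then B p.1.1 p.1.2 q.1.2 else 0)) //.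
Qed.

Lemma cf_lift1 B v k j a : (k, j, a) \in tidx F m ->
  cf (lift1 B *m v) (k, j, a) = \sum_(c < k.+1) B k a c * cf v (k, j, c : nat).
Proof.
move=> s; rewrite cf_mul //; have := s; rewrite mem_tidx => /and3P[Fk ltj _].
rewrite -(collapse1 (fun c => B k a c * cf v (k, j, c : nat)) Fk ltj).
apply: eq_big_seq => -[[k' j'] a'] t; rewrite cm_lift1 //= xpair_eqE.
rewrite (eq_sym k') (eq_sym j').
by case: eqP => [<-|_] /=; rewrite ?mul0r //; case: eqP => [<-|_] /=; rewrite ?mul0r.
Qed.
Lemma cf_lift2 B v k j a : (k, j, a) \in tidx F m ->
  cf (lift2 B *m v) (k, j, a) = \sum_(i < m k) B k j i * cf v (k, i : nat, a).
Proof.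
move=> s; rewrite cf_mul //; have := s; rewrite mem_tidx => /and3P[Fk _ lea].
rewrite -(collapse2 (fun i => B k j i * cf v (k, i : nat, a)) Fk lea).
apply: eq_big_seq => -[[k' j'] a'] t; rewrite cm_lift2 //=.
rewrite (eq_sym k') (eq_sym a').
by case: eqP => [<-|_] /=; rewrite ?mul0r //; case: eqP => [<-|_] /=; rewrite ?mul0r.
Qed.
Lemma cm_lift1l B A k j a t : (k, j, a) \in tidx F m -> t \in tidx F m ->
  cm (lift1 B *m A) (k, j, a) t = \sum_(c < k.+1) B k a c * cm A (k, j, c : nat) t.
Proof.
move=> s tt; rewrite cm_mul //; have := s; rewrite mem_tidx => /and3P[Fk ltj _].
rewrite -(collapse1 (fun c => B k a c * cm A (k, j, c : nat) t) Fk ltj).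
apply: eq_big_seq => -[[k' j'] a'] u; rewrite cm_lift1 //= xpair_eqE.
rewrite (eq_sym k') (eq_sym j').
by case: eqP => [<-|_] /=; rewrite ?mul0r //; case: eqP => [<-|_] /=; rewrite ?mul0r.
Qed.
Lemma cm_lift1r B A k j a s : s \in tidx F m -> (k, j, a) \in tidx F m ->
  cm (A *m lift1 B) s (k, j, a) = \sum_(c < k.+1) cm A s (k, j, c : nat) * B k c a.
Proof.
move=> ss t; rewrite cm_mul //; have := t; rewrite mem_tidx => /and3P[Fk ltj _].
rewrite -(collapse1 (fun c => cm A s (k, j, c : nat) * B k c a) Fk ltj).
apply: eq_big_seq => -[[k' j'] a'] u; rewrite cm_lift1 //= xpair_eqE.
by case: eqP => [->|_] /=; rewrite ?mulr0 //; case: eqP => [->|_] /=; rewrite ?mulr0.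
Qed.
Lemma cm_lift2l B A k j a t : (k, j, a) \in tidx F m -> t \in tidx F m ->
  cm (lift2 B *m A) (k, j, a) t = \sum_(i < m k) B k j i * cm A (k, i : nat, a) t.
Proof.
move=> s tt; rewrite cm_mul //; have := s; rewrite mem_tidx => /and3P[Fk _ lea].
rewrite -(collapse2 (fun i => B k j i * cm A (k, i : nat, a) t) Fk lea).
apply: eq_big_seq => -[[k' j'] a'] u; rewrite cm_lift2 //=.
rewrite (eq_sym k') (eq_sym a').
by case: eqP => [<-|_] /=; rewrite ?mul0r //; case: eqP => [<-|_] /=; rewrite ?mul0r.
Qed.
Lemma lift1M B B' :
  lift1 B *m lift1 B' = lift1 (fun k a c => \sum_(d < k.+1) B k a d * B' k d c).
Proof.
apply: cmP => -[[k j] a] [[k' j'] a'] s t; rewrite cm_lift1l // cm_lift1 //.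
rewrite mem_tidx in s; case/and3P: s => Fk ltj _.
have u c : (c < k.+1)%N -> (k, j, c) \in tidx F m by rewrite mem_tidx Fk ltj.
case: ifP => [e|ne].
  by apply: eq_bigr => c _; rewrite cm_lift1 ?u // e.
by apply: big1 => c _; rewrite cm_lift1 ?u // ne mulr0.
Qed.
Lemma lift2M B B' :
  lift2 B *m lift2 B' = lift2 (fun k i j => \sum_(l < m k) B k i l * B' k l j).
Proof.
apply: cmP => -[[k j] a] [[k' j'] a'] s t; rewrite cm_lift2l // cm_lift2 //.
rewrite mem_tidx in s; case/and3P: s => Fk _ lea.
have u c : (c < m k)%N -> (k, c, a) \in tidx F m by rewrite mem_tidx Fk lea => ->.
case: ifP => [e|ne].
  by apply: eq_bigr => c _; rewrite cm_lift2 ?u // e.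
by apply: big1 => c _; rewrite cm_lift2 ?u // ne mulr0.
Qed.
Lemma lift12C B B' : lift1 B *m lift2 B' = lift2 B' *m lift1 B.
Proof.
apply: cmP => -[[k j] a] [[k' j'] a'] s t; rewrite cm_lift1l // cm_lift2l //.
have := s; have := t; rewrite !mem_tidx => /and3P[Fk' ltj' lea'] /and3P[Fk ltj lea].
have u c : (c < k.+1)%N -> (k, j, c) \in tidx F m by rewrite mem_tidx Fk ltj.
have w c : (c < m k)%N -> (k, c, a) \in tidx F m by rewrite mem_tidx Fk lea => ->.
have [ek|ne] := eqVneq k k'; last first.
  rewrite !big1 // => i _; first by rewrite cm_lift1 ?w // (negPf ne) mulr0.
  by rewrite cm_lift2 ?u // (negPf ne) mulr0.
subst k'; rewrite (bigD1 (Ordinal (lea' : a' < k.+1)%N)) //= big1 ?addr0.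
  rewrite (bigD1 (Ordinal ltj')) //= big1 ?addr0.
    by rewrite cm_lift1 ?w // cm_lift2 ?u // !eqxx mulrC.
  move=> i ne; rewrite cm_lift1 ?w // eqxx /= ifN ?mulr0 //.
move=> i ne; rewrite cm_lift2 ?u // eqxx /= ifN ?mulr0 //.
Qed.
Lemma eq_lift1 B B' : (forall k a c, k \in F -> (a <= k)%N -> (c <= k)%N ->
  B k a c = B' k a c) -> lift1 B = lift1 B'.
Proof.
move=> e; apply/matrixP => p q; rewrite !mxE.
case: eqP => // epq; have [? _ ?] := tixP p; have [_ _] := tixP q.
by rewrite -epq => ?; rewrite e.
Qed.
Lemma eq_lift2 B B' : (forall k i j, k \in F -> (i < m k)%N -> (j < m k)%N ->
  B k i j = B' k i j) -> lift2 B = lift2 B'.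
Proof.
move=> e; apply/matrixP => p q; rewrite !mxE.
case: eqP => //= epq; have [? ? _] := tixP p; have [_ + _] := tixP q.
by rewrite -epq => ?; rewrite e.
Qed.
Lemma lift1_1 : lift1 (fun k a c => (a == c)%:R) = 1%:M.
Proof.
apply/matrixP => p q; rewrite !mxE -(inj_eq tix_inj).
by case: (tix p) (tix q) => [x a] [x' a'] /=; rewrite [in RHS]xpair_eqE; case: eqP.
Qed.
Lemma lift2_1 : lift2 (fun k i j => (i == j)%:R) = 1%:M.
Proof.
apply/matrixP => p q; rewrite !mxE -(inj_eq tix_inj).
case: (tix p) (tix q) => [[k j] a] [[k' j'] a'] /=; rewrite !xpair_eqE.
by case: eqP => //= _; rewrite andbC; case: eqP.
Qed.
Lemma lift1_lin (c : T) B B' :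
  lift1 (fun k i j => c * B k i j + B' k i j) = c *: lift1 B + lift1 B'.
Proof. by apply/matrixP => p q; rewrite !mxE; case: ifP; rewrite // mulr0 addr0. Qed.
End CoefR.
End Index.

(** * The representation on $V$ in coordinates and Schur's lemma *)

Section Rep.
Variable C : numClosedFieldType.
Variables (F : seq nat) (m : nat -> nat).
Hypothesis uF : uniq F.
Local Notation n := (dimT F m).
Implicit Types (k j a : nat) (g h : 'M[C]_2) (X Y : 'M[C]_2) (z A : 'M[C]_n).
Implicit Types (v : 'cV[C]_n).

(* The derivative of rhoT1 at the identity. *)
Definition L1 X : 'M[C]_n := lift1 F m (fun k => drhoE k X).

Lemma rhoT1E g : rhoT1 F m g = lift1 F m (fun k => rhoE k g).
Proof.
by apply/matrixP => p q; rewrite !mxE; case: (tix p) (tix q) => [x a] [x' a'].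
Qed.
Lemma rhoT2E g : rhoT2 F m g = lift2 F m (fun k => rhoE k g).
Proof.
by apply/matrixP => p q; rewrite !mxE; case: (tix p) (tix q) => [[k j] a] [[k' j'] a'].
Qed.

Lemma rhoEM k g h i j : (i <= k)%N -> (j <= k)%N ->
  \sum_(l < k.+1) rhoE k g i l * rhoE k h l j = rhoE k (g *m h) i j.
Proof.
rewrite -!(ltnS _ k) => lti ltj.
have /matrixP/(_ (Ordinal lti) (Ordinal ltj)) := rhoKM k g h.
by rewrite !mxE /= => ->; apply: eq_bigr => l _; rewrite !mxE.
Qed.
Lemma rhoE1 k i j : (i <= k)%N -> (j <= k)%N -> rhoE k (1%:M : 'M[C]_2) i j = (i == j)%:R.
Proof.
rewrite -!(ltnS _ k) => lti ltj.
by have /matrixP/(_ (Ordinal lti) (Ordinal ltj)) := rhoK1 C k; rewrite !mxE.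
Qed.
Lemma rho_drhoE k g X Y i j : X *m g = g *m Y -> (i <= k)%N -> (j <= k)%N ->
  \sum_(l < k.+1) drhoE k X i l * rhoE k g l j =
  \sum_(l < k.+1) rhoE k g i l * drhoE k Y l j.
Proof.
move=> XgY; rewrite -!(ltnS _ k) => lti ltj.
transitivity ((drhoK k X *m rhoK k g) (Ordinal lti) (Ordinal ltj)).
  by rewrite mxE; apply: eq_bigr => l _; rewrite !mxE.
by rewrite (drhoK_intertwine k XgY) mxE; apply: eq_bigr => l _; rewrite !mxE.
Qed.
Lemma drhoE_lin k (c : C) X Y i j : (j <= k)%N ->
  drhoE k (c *: X + Y) i j = c * drhoE k X i j + drhoE k Y i j.
Proof. by move=> le; rewrite !drhoEE // !mxE; ring. Qed.
Lemma drhoE_lie k X Y i j : (i <= k)%N -> (j <= k)%N ->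
  \sum_(l < k.+1) drhoE k X i l * drhoE k Y l j
  - \sum_(l < k.+1) drhoE k Y i l * drhoE k X l j = drhoE k (lie X Y) i j.
Proof.
rewrite -!(ltnS _ k) => lti ltj.
have /matrixP/(_ (Ordinal lti) (Ordinal ltj)) := drhoK_lie k X Y.
by rewrite !mxE => ->; congr (_ - _); apply: eq_bigr => l _; rewrite !mxE.
Qed.

Lemma rhoT1M g h : rhoT1 F m (g *m h) = rhoT1 F m g *m rhoT1 F m h.
Proof.
rewrite !rhoT1E lift1M //; apply: eq_lift1 => k a c _ *; by rewrite rhoEM.
Qed.
Lemma rhoT1_1 : rhoT1 F m 1%:M = 1%:M :> 'M[C]_n.
Proof. by rewrite rhoT1E -lift1_1 //; apply: eq_lift1 => k a c _ *; rewrite rhoE1. Qed.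
Lemma rhoT1V g : SL2 g -> rhoT1 F m g *m rhoT1 F m (invmx g) = 1%:M.
Proof. by move=> Sg; rewrite -rhoT1M mulmxV ?rhoT1_1 // SL2_unit. Qed.
Lemma rhoT1K g : SL2 g -> rhoT1 F m (invmx g) *m rhoT1 F m g = 1%:M.
Proof. by move=> Sg; rewrite -rhoT1M mulVmx ?rhoT1_1 // SL2_unit. Qed.
Lemma rhoT1_unit g : SL2 g -> rhoT1 F m g \in unitmx.
Proof. by move=> Sg; case: (mulmx1_unit (rhoT1V Sg)). Qed.
Lemma rhoT1_inv g : SL2 g -> invmx (rhoT1 F m g) = rhoT1 F m (invmx g).
Proof.
by move=> Sg; rewrite -[RHS](mulmxK (rhoT1_unit Sg)) rhoT1K // mul1mx.
Qed.
Lemma rhoT1_L1 g X Y : X *m g = g *m Y -> L1 X *m rhoT1 F m g = rhoT1 F m g *m L1 Y.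
Proof.
move=> e; rewrite rhoT1E /L1 !lift1M //; apply: eq_lift1 => k a c _ *.
exact: rho_drhoE.
Qed.
Lemma L1_lin (c : C) X Y : L1 (c *: X + Y) = c *: L1 X + L1 Y.
Proof. by rewrite /L1 -lift1_lin //; apply: eq_lift1 => k a b *; rewrite drhoE_lin. Qed.
Lemma L1D X Y : L1 (X + Y) = L1 X + L1 Y.
Proof. by have := L1_lin 1 X Y; rewrite !scale1r. Qed.
Lemma L10 : L1 0 = 0.
Proof. by apply: (addrI (L1 0)); rewrite -L1D !addr0. Qed.
Lemma L1Z (c : C) X : L1 (c *: X) = c *: L1 X.
Proof. by have := L1_lin c X 0; rewrite L10 !addr0. Qed.
Lemma L1N X : L1 (- X) = - L1 X.
Proof. by rewrite -!scaleN1r L1Z. Qed.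
Lemma L1B X Y : L1 (X - Y) = L1 X - L1 Y.
Proof. by rewrite L1D L1N. Qed.
Lemma L1_lie X Y : L1 (lie X Y) = lie (L1 X) (L1 Y).
Proof.
rewrite /lie /L1 !lift1M //.
rewrite [RHS]addrC -[X in _ = X + _]scaleN1r -lift1_lin; apply: eq_lift1 => k a c *.
by rewrite -drhoE_lie // mulN1r addrC.
Qed.

Lemma sum_ord_nat k (V : nmodType) (G : nat -> V) b : (b <= k)%N ->
  (forall c, c != b -> G c = 0) -> \sum_(c < k.+1) G c = G b.
Proof.
move=> le G0; rewrite (bigD1 (Ordinal (le : b < k.+1)%N)) //= big1 ?addr0 //.
by move=> c ne; apply: G0.
Qed.
Lemma sum_ord_nat0 k (V : nmodType) (G : nat -> V) :
  (forall c, (c <= k)%N -> G c = 0) -> \sum_(c < k.+1) G c = 0.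
Proof. by move=> G0; rewrite big1 // => c _; rewrite G0 // -ltnS. Qed.

Lemma drho_e_sum k (G : nat -> C) a : (a <= k)%N ->
  ((k < a.+1)%N -> G a.+1 = 0) ->
  \sum_(c < k.+1) drhoE k e2 a c * G c = a.+1%:R * G a.+1.
Proof.
move=> le G0; transitivity (\sum_(c < k.+1) (c%:R * (a.+1 == c)%:R) * G c).
  by apply: eq_bigr => c _; rewrite drhoE_e // -ltnS.
have [lt|] := ltnP a k.
  by rewrite (@sum_ord_nat k _ (fun c => (c%:R * (a.+1 == c)%:R) * G c) a.+1) ?eqxx ?mulr1 //
    => c /negPf; rewrite eq_sym => ->; rewrite mulr0 mul0r.
move=> ge; rewrite G0 // mulr0; apply: (@sum_ord_nat0 k _ (fun c => (c%:R * (a.+1 == c)%:R) * G c)).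
by move=> c lec; rewrite gtn_eqF ?mulr0 ?mul0r // ltnS (leq_trans lec).
Qed.
Lemma drho_e_sumr k (G : nat -> C) a : (a <= k)%N ->
  \sum_(c < k.+1) G c * drhoE k e2 c a = a%:R * G a.-1.
Proof.
move=> le; transitivity (\sum_(c < k.+1) G c * (a%:R * (c.+1 == a)%:R)).
  by apply: eq_bigr => c _; rewrite drhoE_e.
case: a le => [|a] le.
  by rewrite mul0r (@sum_ord_nat0 k _ (fun c => G c * (0%:R * (c.+1 == 0)%N%:R))) // => c _;
    rewrite mul0r mulr0.
rewrite (@sum_ord_nat k _ (fun c => G c * (a.+1%:R * (c.+1 == a.+1)%:R)) a) ?eqxx ?mulr1 1?mulrC //.
  exact: ltnW.
by move=> c /negPf ne; rewrite eqSS ne !mulr0.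
Qed.
Lemma drho_f_sum k (G : nat -> C) a : (a <= k)%N ->
  \sum_(c < k.+1) drhoE k f2 a c * G c = if a is b.+1 then (k - b)%:R * G b else 0.
Proof.
move=> le; transitivity (\sum_(c < k.+1) ((k - c)%:R * (a == c.+1)%:R) * G c).
  by apply: eq_bigr => c _; rewrite drhoE_f // -ltnS.
case: a le => [|a] le.
  by apply: (@sum_ord_nat0 k _ (fun c => (k - c)%:R * (0%N == c.+1)%:R * G c)) => c _;
    rewrite mulr0 mul0r.
rewrite (@sum_ord_nat k _ (fun c => (k - c)%:R * (a.+1 == c.+1)%:R * G c) a) ?eqxx ?mulr1 //.
  exact: ltnW.
by move=> c /negPf ne; rewrite eqSS eq_sym ne mulr0 mul0r.
Qed.
Lemma drho_f_sumr k (G : nat -> C) a : (a <= k)%N ->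
  \sum_(c < k.+1) G c * drhoE k f2 c a = (k - a)%:R * G a.+1.
Proof.
move=> le; transitivity (\sum_(c < k.+1) G c * ((k - a)%:R * (c == a.+1 :> nat)%:R)).
  by apply: eq_bigr => c _; rewrite drhoE_f.
have [lt|ge] := ltnP a k.
  rewrite (@sum_ord_nat k _ (fun c => G c * ((k - a)%:R * (c == a.+1)%:R)) a.+1) ?eqxx ?mulr1 1?mulrC //.
  by move=> c /negPf ->; rewrite !mulr0.
rewrite (_ : (k - a)%N = 0%N) ?mul0r; last by apply/eqP.
by apply: big1 => c _; rewrite mul0r mulr0.
Qed.
(** The weight of $x^{k-a}y^a$. *)
Definition wt k a : C := k%:R - a%:R *+ 2.
Lemma drho_h_sum k (G : nat -> C) a : (a <= k)%N ->
  \sum_(c < k.+1) drhoE k h2 a c * G c = wt k a * G a.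
Proof.
move=> le; transitivity (\sum_(c < k.+1) (wt k c * (a == c)%:R) * G c).
  by apply: eq_bigr => c _; rewrite drhoE_h // -ltnS.
rewrite (@sum_ord_nat k _ (fun c => (wt k c * (a == c)%:R) * G c) a) ?eqxx ?mulr1 //.
by move=> c /negPf; rewrite eq_sym => ->; rewrite mulr0 mul0r.
Qed.
Lemma drho_h_sumr k (G : nat -> C) a : (a <= k)%N ->
  \sum_(c < k.+1) G c * drhoE k h2 c a = wt k a * G a.
Proof.
move=> le; transitivity (\sum_(c < k.+1) G c * (wt k a * (c == a :> nat)%:R)).
  by apply: eq_bigr => c _; rewrite drhoE_h.
rewrite (@sum_ord_nat k _ (fun c => G c * (wt k a * (c == a)%:R)) a) ?eqxx ?mulr1 1?mulrC //.
by move=> c /negPf ->; rewrite !mulr0.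
Qed.

Lemma cf_L1e v k j a : (k, j, a) \in tidx F m ->
  cf (L1 e2 *m v) (k, j, a) = a.+1%:R * cf v (k, j, a.+1).
Proof.
move=> s; rewrite cf_lift1 //; have := s; rewrite mem_tidx => /and3P[_ _ le].
rewrite (@drho_e_sum k (fun c => cf v (k, j, c))) // => lt; apply: cf_out.
by rewrite mem_tidx [X in [&& _, _ & X]]leqNgt lt !andbF.
Qed.
Lemma cf_L1h v k j a : (k, j, a) \in tidx F m ->
  cf (L1 h2 *m v) (k, j, a) = wt k a * cf v (k, j, a).
Proof.
move=> s; rewrite cf_lift1 //; have := s; rewrite mem_tidx => /and3P[_ _ le].
by rewrite (drho_h_sum (fun c => cf v (k, j, c))).
Qed.
Lemma cm_L1el A k j a t : (k, j, a) \in tidx F m -> t \in tidx F m ->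
  cm (L1 e2 *m A) (k, j, a) t = a.+1%:R * cm A (k, j, a.+1) t.
Proof.
move=> s tt; rewrite cm_lift1l //; have := s; rewrite mem_tidx => /and3P[_ _ le].
rewrite (@drho_e_sum k (fun c => cm A (k, j, c) t)) // => lt; apply: cm_outl.
by rewrite mem_tidx [X in [&& _, _ & X]]leqNgt lt !andbF.
Qed.
Lemma cm_L1fl A k j a t : (k, j, a) \in tidx F m -> t \in tidx F m ->
  cm (L1 f2 *m A) (k, j, a) t = if a is b.+1 then (k - b)%:R * cm A (k, j, b) t else 0.
Proof.
move=> s tt; rewrite cm_lift1l //; have := s; rewrite mem_tidx => /and3P[_ _ le].
by rewrite (drho_f_sum (fun c => cm A (k, j, c) t)).
Qed.
Lemma cm_L1hl A k j a t : (k, j, a) \in tidx F m -> t \in tidx F m ->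
  cm (L1 h2 *m A) (k, j, a) t = wt k a * cm A (k, j, a) t.
Proof.
move=> s tt; rewrite cm_lift1l //; have := s; rewrite mem_tidx => /and3P[_ _ le].
by rewrite (drho_h_sum (fun c => cm A (k, j, c) t)).
Qed.
Lemma cm_L1er A k j a s : s \in tidx F m -> (k, j, a) \in tidx F m ->
  cm (A *m L1 e2) s (k, j, a) = a%:R * cm A s (k, j, a.-1).
Proof.
move=> ss t; rewrite cm_lift1r //; have := t; rewrite mem_tidx => /and3P[_ _ le].
by rewrite (drho_e_sumr (fun c => cm A s (k, j, c))).
Qed.
Lemma cm_L1fr A k j a s : s \in tidx F m -> (k, j, a) \in tidx F m ->
  cm (A *m L1 f2) s (k, j, a) = (k - a)%:R * cm A s (k, j, a.+1).
Proof.
move=> ss t; rewrite cm_lift1r //; have := t; rewrite mem_tidx => /and3P[_ _ le].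
by rewrite (drho_f_sumr (fun c => cm A s (k, j, c))).
Qed.
Lemma cm_L1hr A k j a s : s \in tidx F m -> (k, j, a) \in tidx F m ->
  cm (A *m L1 h2) s (k, j, a) = wt k a * cm A s (k, j, a).
Proof.
move=> ss t; rewrite cm_lift1r //; have := t; rewrite mem_tidx => /and3P[_ _ le].
by rewrite (drho_h_sumr (fun c => cm A s (k, j, c))).
Qed.

(** Commuting with [e2] and [f2] gives recurrences for the entries of [z]. They make entries with
    equal form index constant along a copy, and reduce those with different form indices to a
    boundary row or column, where they vanish. Between different degrees the shorter string ends
    first, which makes the constant 0. *)
Lemma L1_schur z : z *m L1 e2 = L1 e2 *m z -> z *m L1 f2 = L1 f2 *m z ->
  z = lift2 F m (fun k i j => cm z (k, i, 0%N) (k, j, 0%N)).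
Proof.
move=> ze zf.
have n0 a : (a.+1%:R : C) != 0 by rewrite pnatr_eq0.
have E k j a k' j' a' : (k, j, a) \in tidx F m -> (k', j', a') \in tidx F m ->
    a.+1%:R * cm z (k, j, a.+1) (k', j', a') = a'%:R * cm z (k, j, a) (k', j', a'.-1).
  by move=> s t; rewrite -cm_L1el // -ze cm_L1er.
have Ff k j a k' j' a' : (k, j, a) \in tidx F m -> (k', j', a') \in tidx F m ->
    (k' - a')%:R * cm z (k, j, a) (k', j', a'.+1) =
    if a is b.+1 then (k - b)%:R * cm z (k, j, b) (k', j', a') else 0.
  by move=> s t; rewrite -cm_L1fl // -zf cm_L1fr.
have dg k j k' j' a : (k, j, a) \in tidx F m -> (k', j', a) \in tidx F m ->
    cm z (k, j, a) (k', j', a) = cm z (k, j, 0%N) (k', j', 0%N).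
  elim: a => [//|a IHa] s t; rewrite !mem_tidx in s t.
  case/and3P: s => Fk ltj le; case/and3P: t => Fk' ltj' le'.
  rewrite -IHa ?mem_tidx ?Fk ?ltj ?Fk' ?ltj' ?(ltnW le) ?(ltnW le') //; apply: (mulfI (n0 a)).
  by rewrite E ?mem_tidx ?Fk ?ltj ?Fk' ?ltj' ?(ltnW le) ?(ltnW le').
have z00 k j k' j' : (k, j, 0%N) \in tidx F m -> (k', j', 0%N) \in tidx F m ->
    k != k' -> cm z (k, j, 0%N) (k', j', 0%N) = 0.
  rewrite !mem_tidx => /and3P[Fk ltj _] /and3P[Fk' ltj' _]; rewrite neq_ltn.
  case/orP => lt.
    rewrite -(dg _ _ _ _ k) ?mem_tidx ?Fk ?Fk' ?ltj ?ltj' ?(ltnW lt) ?leqnn //.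
    apply: (mulfI (n0 k)); rewrite mulr0.
    have := E k j k k' j' k.+1; rewrite /= => <-;
      rewrite ?mem_tidx ?Fk ?Fk' ?ltj ?ltj' ?(ltnW lt) ?leqnn //.
    by rewrite cm_outl ?mulr0 // mem_tidx ltnn !andbF.
  rewrite -(dg _ _ _ _ k') ?mem_tidx ?Fk ?Fk' ?ltj ?ltj' ?(ltnW lt) ?leqnn //.
  have kk0 : ((k - k')%:R : C) != 0 by rewrite pnatr_eq0 -lt0n subn_gt0.
  apply: (mulfI kk0); rewrite mulr0.
  rewrite -(Ff k j k'.+1 k' j' k') ?subnn ?mul0r //;
    by rewrite ?mem_tidx ?Fk ?Fk' ?ltj ?ltj' ?(ltnW lt) ?leqnn.
apply: cmP => // -[[k j] a] [[k' j'] a'] s t; rewrite cm_lift2 //.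
have sv b : (b <= a)%N -> (k, j, b) \in tidx F m.
  by move: s; rewrite !mem_tidx => /and3P[-> -> le] lb; rewrite (leq_trans lb).
have tv b : (b <= a')%N -> (k', j', b) \in tidx F m.
  by move: t; rewrite !mem_tidx => /and3P[-> -> le] lb; rewrite (leq_trans lb).
have [ek|ne] := eqVneq a a'; last first.
  rewrite andbF; elim: a a' {s t} ne sv tv => [|a IHa] [|a'] // ne sv tv.
  - have := Ff _ _ _ _ _ _ (sv 0%N isT) (tv a' (leqnSn _)) => /eqP.
    rewrite mulf_eq0 pnatr_eq0 subn_eq0 leqNgt.
    by have := tv a'.+1 (leqnn _); rewrite mem_tidx => /and3P[_ _ ->] /= /eqP.
  - apply: (mulfI (n0 a)); rewrite E ?sv ?tv // mul0r mulr0 //.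
  - apply: (mulfI (n0 a)); rewrite E ?sv ?tv //= IHa ?mulr0 // => b lb.
      by rewrite sv // leqW.
    by rewrite tv // leqW.
rewrite -{}ek in t tv *; rewrite andbT dg //.
by case: eqP => [<-//|/eqP ne]; rewrite z00 ?sv ?tv.
Qed.

Lemma lift2_comm_rho mu g : lift2 F m mu *m rhoT1 F m g = rhoT1 F m g *m lift2 F m mu.
Proof. by rewrite rhoT1E lift12C. Qed.
End Rep.

(* A left inverse of the Lie algebra action, reading off a 2x2 matrix from the
   entries of the operator at the two top basis vectors of a copy of R_k. *)
Definition readX (C : numClosedFieldType) F m (k : nat) (s0 s1 : nat * nat * nat)
    (A : 'M[C]_(dimT F m)) : 'M[C]_2 :=
  mk2 (k%:R^-1 * cm A s0 s0) (cm A s0 s1) (k%:R^-1 * cm A s1 s0)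
      (cm A s1 s1 - (k%:R - 1) / k%:R * cm A s0 s0).

Section Read.
Variable C : numClosedFieldType.
Variables (F : seq nat) (m : nat -> nat).
Hypothesis uF : uniq F.
Local Notation n := (dimT F m).

Lemma readX_lin k s0 s1 (c : C) (A B : 'M[C]_n) :
  readX k s0 s1 (c *: A + B) = c *: readX k s0 s1 A + readX k s0 s1 B.
Proof. by rewrite /readX; mx2; rewrite !cmD !cmZ; ring. Qed.

Lemma readX_L1 k j (X : 'M[C]_2) : k \in F -> (0 < k)%N -> (j < m k)%N ->
  readX k (k, j, 0%N) (k, j, 1%N) (L1 F m X) = X.
Proof.
move=> Fk k0 ltj.
have kn0 : k%:R != 0 :> C by rewrite pnatr_eq0 -lt0n.
have v0 : (k, j, 0%N) \in tidx F m by rewrite mem_tidx Fk ltj.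
have v1 : (k, j, 1%N) \in tidx F m by rewrite mem_tidx Fk ltj.
apply: mx2P; rewrite /readX mk2E !cm_lift1 // !eqxx /= !drhoEE //= ?subn0 ?natrB //.
- by field.
- by ring.
- by field.
- by field.
Qed.
End Read.

(** * Zariski closures and identity components *)

Section PolyFun.
Variable C : numClosedFieldType.

Section OneSize.
Variable n : nat.
Implicit Types (f g : 'M[C]_n -> C).

Definition polyfun f := exists p : mxpolyfun C n, forall A, f A = evalpf p A.

Lemma polyfun_ext f g : f =1 g -> polyfun f -> polyfun g.
Proof. by move=> e [p fp]; exists p => A; rewrite -e. Qed.

Lemma polyfun_const (c : C) : polyfun (fun=> c).
Proof.
exists [:: (c, [ffun=> 0%N])] => A; rewrite /evalpf big_seq1 /= big1 ?mulr1 //.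
by move=> ij _; rewrite ffunE.
Qed.

Lemma polyfun_entry i j : polyfun (fun A => A i j).
Proof.
exists [:: (1, [ffun ij => (ij == (i, j)) : nat])] => A.
rewrite /evalpf big_seq1 /= mul1r (bigD1 (i, j)) //= ffunE eqxx expr1 big1 ?mulr1 //.
by move=> ij /negPf ne; rewrite ffunE ne.
Qed.

Lemma polyfunD f g : polyfun f -> polyfun g -> polyfun (fun A => f A + g A).
Proof. by case=> p fp [q gq]; exists (p ++ q) => A; rewrite fp gq /evalpf big_cat. Qed.

Lemma polyfunM f g : polyfun f -> polyfun g -> polyfun (fun A => f A * g A).
Proof.
case=> p fp [q gq].
pose mul (s t : C * {ffun 'I_n * 'I_n -> nat}) :=
  (s.1 * t.1, [ffun ij => (s.2 ij + t.2 ij)%N]).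
exists [seq mul s t | s <- p, t <- q] => A.
rewrite fp gq /evalpf big_allpairs_dep /= mulr_suml; apply: eq_bigr => s _.
rewrite mulr_sumr; apply: eq_bigr => t _ /=.
rewrite mulrACA; congr (_ * _); rewrite -big_split; apply: eq_bigr => ij _ /=.
by rewrite ffunE exprD.
Qed.

Lemma polyfun_sum I (r : seq I) (P : pred I) (G : I -> 'M[C]_n -> C) :
  (forall i, polyfun (G i)) -> polyfun (fun A => \sum_(i <- r | P i) G i A).
Proof.
move=> pG; elim: r => [|i r IHr].
  by apply: polyfun_ext (polyfun_const 0) => A; rewrite big_nil.
case Pi: (P i); last by apply: polyfun_ext IHr => A; rewrite big_cons Pi.
by apply: polyfun_ext (polyfunD (pG i) IHr) => A; rewrite big_cons Pi.
Qed.

Lemma polyfun_prod I (r : seq I) (P : pred I) (G : I -> 'M[C]_n -> C) :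
  (forall i, polyfun (G i)) -> polyfun (fun A => \prod_(i <- r | P i) G i A).
Proof.
move=> pG; elim: r => [|i r IHr].
  by apply: polyfun_ext (polyfun_const 1) => A; rewrite big_nil.
case Pi: (P i); last by apply: polyfun_ext IHr => A; rewrite big_cons Pi.
by apply: polyfun_ext (polyfunM (pG i) IHr) => A; rewrite big_cons Pi.
Qed.

Lemma polyfunX f k : polyfun f -> polyfun (fun A => f A ^+ k).
Proof.
move=> pf; elim: k => [|k IHk]; first exact: polyfun_const.
by apply: polyfun_ext (polyfunM pf IHk) => A; rewrite exprS.
Qed.

Lemma polyfunN f : polyfun f -> polyfun (fun A => - f A).
Proof.
by move=> pf; apply: polyfun_ext (polyfunM (polyfun_const (-1)) pf) => A; rewrite mulN1r.
Qed.
Lemma polyfunB f g : polyfun f -> polyfun g -> polyfun (fun A => f A - g A).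
Proof. by move=> pf pg; apply/polyfunD/polyfunN. Qed.

Definition polymx r s (M : 'M[C]_n -> 'M[C]_(r, s)) :=
  forall i j, polyfun (fun A => M A i j).

Lemma polymx_id : polymx id. Proof. by move=> i j; apply: polyfun_entry. Qed.
Lemma polymx_const r s (B : 'M[C]_(r, s)) : polymx (fun=> B).
Proof. by move=> i j; apply: polyfun_const. Qed.
Lemma polymxM r s t (M : 'M[C]_n -> 'M[C]_(r, s)) (N : 'M[C]_n -> 'M[C]_(s, t)) :
  polymx M -> polymx N -> polymx (fun A => M A *m N A).
Proof.
move=> pM pN i j; have := @polyfun_sum _ (index_enum 'I_s) predT
  (fun l A => M A i l * N A l j) (fun l => polyfunM (pM i l) (pN l j)).
by apply: polyfun_ext => A; rewrite mxE.
Qed.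
Lemma polyfun_det r (M : 'M[C]_n -> 'M[C]_r) : polymx M -> polyfun (fun A => \det (M A)).
Proof.
move=> pM; apply: polyfun_sum => s; apply: polyfunM; first exact: polyfun_const.
by apply: polyfun_prod => i; apply: pM.
Qed.
Lemma polymx_adj : polymx (fun A => \adj A).
Proof.
move=> i j; apply: (@polyfun_ext (fun A => (-1) ^+ (j + i) * \det (row' j (col' i A)))).
  by move=> A; rewrite mxE.
apply: polyfunM; first exact: polyfun_const.
apply: polyfun_det => a b; apply: (@polyfun_ext (fun A => A (lift j a) (lift i b))).
  by move=> A; rewrite !mxE.
exact: polyfun_entry.
Qed.
End OneSize.

Lemma polyfun_comp n n' (M : 'M[C]_n -> 'M[C]_n') (f : 'M[C]_n' -> C) :
  polymx M -> polyfun f -> polyfun (fun A => f (M A)).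
Proof.
move=> pM [p fp]; apply: (@polyfun_ext _ (fun A => evalpf p (M A))) => //.
apply: polyfun_sum => t; apply: polyfunM; first exact: polyfun_const.
by apply: polyfun_prod => ij; apply: polyfunX; apply: pM.
Qed.

Definition inclosure n (K : 'M[C]_n -> Prop) (A : 'M[C]_n) :=
  forall f, polyfun f -> (forall B, K B -> f B = 0) -> f A = 0.

(** All polynomials vanishing on [K] serve as equations, so closedness means that the closure gains
    no invertible point. *)
Lemma zclosed_closure n (K : 'M[C]_n -> Prop) : (forall A, K A -> A \in unitmx) ->
  (forall A, A \in unitmx -> inclosure K A -> K A) -> zclosedGL K.
Proof.
move=> Ku Kc; exists (fun p => forall B, K B -> evalpf p B = 0) => A; split.
  by move=> KA; split=> [|p]; [apply: Ku | apply].
case=> uA pA; apply: Kc => // f [p fp] fK; rewrite fp; apply: pA => B KB.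
by rewrite -fp fK.
Qed.

Lemma inclosure_mull n (K : 'M[C]_n -> Prop) (B A : 'M[C]_n) :
  (forall A', K A' -> K (B *m A')) -> inclosure K A -> inclosure K (B *m A).
Proof.
move=> KB KA f pf f0; apply: (KA (fun A => f (B *m A))); last by move=> A' /KB /f0.
apply: polyfun_comp pf; apply: polymxM; [exact: polymx_const | exact: polymx_id].
Qed.

Lemma inclosure_mx n r s (K : 'M[C]_n -> Prop) (M : 'M[C]_n -> 'M[C]_(r, s)) A :
  polymx M -> (forall B, K B -> M B = 0) -> inclosure K A -> M A = 0.
Proof.
move=> pM M0 KA; apply/matrixP => i j; rewrite [RHS]mxE.
by apply: (KA (fun A => M A i j)) => // B KB; rewrite M0 // mxE.
Qed.
End PolyFun.

Section IdComp.
Variable C : numClosedFieldType.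
Variable n : nat.
Implicit Types (G K : 'M[C]_n -> Prop).

Lemma idcomp_group G : mxsubgroup G -> mxsubgroup (idcomp G).
Proof.
case=> G1 GM GV; split.
- by split=> // K _ [].
- move=> A B [GA KA] [GB KB]; split; first exact: GM.
  by move=> K cK gK sK fK; case: (gK) => _ KM _; apply: KM; [apply: KA|apply: KB].
- move=> A [GA KA]; split; first exact: GV.
  by move=> K cK gK sK fK; case: (gK) => _ _; apply; apply: KA.
Qed.

Lemma zclosed_unit K A : zclosedGL K -> K A -> A \in unitmx.
Proof. by case=> S h /h []. Qed.

(** Labels replace cosets: one representative is kept for each label that occurs in [G], its
    occurrence being decided classically. *)
Lemma finite_index_inv (I : eqType) (L : seq I) (Q : 'M[C]_n -> I -> Prop) K G :
  (forall A, G A -> exists2 i, i \in L & Q A i) ->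
  (forall A B i, G A -> G B -> Q A i -> Q B i -> K (invmx A *m B)) ->
  finite_index K G.
Proof.
move=> GL QK.
suff [s sP] : exists s : seq 'M[C]_n, forall A i, G A -> i \in L -> Q A i ->
    exists2 t, t \in s & G t /\ K (invmx t *m A).
  by exists s => A GA; have [i iL QA] := GL A GA; apply: (sP A i).
elim: L {GL} => [|i L [s sP]]; first by exists [::].
have [[B [GB QB]]|nB] := pselect (exists B, G B /\ Q B i).
  exists (B :: s) => A i' GA; rewrite inE => /orP[/eqP-> QA|i'L QA].
    by exists B; [rewrite inE eqxx | split=> //; apply: QK QB QA].
  by have [t ts tP] := sP A i' GA i'L QA; exists t; rewrite // inE ts orbT.
exists s => A i' GA; rewrite inE => /orP[/eqP-> QA|]; last exact: sP.
by case: nB; exists A.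
Qed.

(* C is divisible, so a one-parameter group has no proper subgroup of finite
   index. *)
Lemma idcomp_oneparam G (phi : C -> 'M[C]_n) :
  phi 0 = 1%:M -> (forall a b, phi (a + b) = phi a *m phi b) ->
  (forall a, G (phi a)) -> forall a, idcomp G (phi a).
Proof.
move=> phi0 phiD Gphi a; split=> // K cK [K1 KM KV] KG [s sP].
have phiu b : phi b \in unitmx.
  by case: (@mulmx1_unit _ _ (phi b) (phi (- b))) => //; rewrite -phiD subrr.
have phiV b : invmx (phi b) = phi (- b).
  by rewrite -[RHS](mulmxK (phiu b)) -phiD addNr phi0 mul1mx.
(* Two of the $N+1$ multiples $0,x,\dots,Nx$ fall into one coset. Their distance $j-i\le N$ divides
   $N!$, so $a=N!\,x$ is an integral multiple of $(j-i)x$, a parameter in the subgroup. *)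
pose N := size s; pose x := a / N`!%:R.
have rP0 (i : 'I_N.+1) : exists u : 'I_N, K (invmx (s`_u) *m phi (i%:R * x)).
  have [t ts [_ Kt]] := sP _ (Gphi (i%:R * x)).
  have lt : (index t s < N)%N by rewrite index_mem.
  by exists (Ordinal lt); rewrite nth_index.
have [r rP] := choice rP0.
have [i [j [ltij eij]]] : exists i j : 'I_N.+1, (i < j)%N /\ r i = r j.
  have /injectivePn [i [j ne e]] : ~~ injectiveb r.
    by apply/injectiveP => /leq_card; rewrite !card_ord ltnn.
  have := ne; rewrite -val_eqE neq_ltn => /orP[]; first by exists i, j.
  by exists j, i.
have Kij : K (phi ((j - i)%:R * x)).
  have := KM _ _ (KV _ (rP i)) (rP j); rewrite eij.
  set t := s`_(r j); set A := invmx t *m phi (i%:R * x).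
  have uA : A \in unitmx by apply: (zclosed_unit cK); rewrite /A /t -eij; apply: rP.
  have ut : invmx t \in unitmx by move: uA; rewrite unitmx_mul => /andP[].
  have tu : t \in unitmx by rewrite -unitmx_inv.
  suff -> : invmx A = phi (- (i%:R * x)) *m t.
    rewrite mulmxA -[in X in K (X *m _)]mulmxA mulmxV // mulmx1.
    by rewrite -phiD natrB ?(ltnW ltij) // mulrBl addrC.
  have BA : phi (- (i%:R * x)) *m t *m A = 1%:M.
    by rewrite /A mulmxA -(mulmxA _ t) mulmxV // mulmx1 -phiD addNr phi0.
  by rewrite -[RHS](mulmxK uA) BA mul1mx.
have Kn k : K (phi (k%:R * ((j - i)%:R * x))).
  elim: k => [|k IHk]; first by rewrite mul0r phi0.
  by rewrite -addn1 natrD mulrDl mul1r phiD; apply: KM.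
have ji0 : (0 < j - i)%N by rewrite subn_gt0.
have leji : (j - i <= N)%N by rewrite (leq_trans (leq_subr _ _)) // -ltnS.
have /dvdnP [d dE] : (j - i %| N`!)%N by apply: dvdn_fact; rewrite ji0.
have := Kn d; rewrite mulrA -natrM -dE /x mulrC divfK //.
by rewrite pnatr_eq0 -lt0n fact_gt0.
Qed.
End IdComp.

(** * Polynomial curves of matrices and their coefficients *)

Section Curves.
Variable C : numClosedFieldType.

(** [P] stands for a linear subspace. For a curve $f$ of degree $d$, the combination $f(2t)-2^df(t)$
    loses the top coefficient and multiplies the others by $2^i-2^d\ne0$, which allows induction on
    the length. *)
Lemma curve_coef (V : lmodType C) (P : V -> Prop) (N : nat -> V) d :
  P 0 -> (forall (c : C) u w, P u -> P w -> P (c *: u + w)) ->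
  (forall t : C, P (\sum_(i < d) t ^+ i *: N i)) ->
  forall i, (i < d)%N -> P (N i).
Proof.
move=> P0 PL; have PZ c u : P u -> P (c *: u).
  by move=> Pu; rewrite -[_ *: _]addr0; apply: PL.
elim: d N => // d IHd N PN i; rewrite ltnS leq_eqVlt.
have Plt j : (j < d)%N -> P (N j).
  move=> ltj; pose e := (2%:R ^+ j - 2%:R ^+ d : C).
  have e0 : e != 0.
    by rewrite subr_eq0 -!natrX eqr_nat eqn_exp2l // ltn_eqF.
  rewrite -[N j](scalerK e0); apply: PZ.
  apply: (IHd (fun i => (2%:R ^+ i - 2%:R ^+ d) *: N i)) ltj => t.
  suff -> : \sum_(i < d) t ^+ i *: ((2%:R ^+ i - 2%:R ^+ d) *: N i) =
      (- 2%:R ^+ d) *: (\sum_(i < d.+1) t ^+ i *: N i)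
      + \sum_(i < d.+1) (2%:R * t) ^+ i *: N i by apply: PL.
  rewrite !big_ord_recr /= scalerDr addrACA scalerA -scalerDl exprMn.
  rewrite mulNr addNr scale0r addr0 scaler_sumr -big_split.
  by apply: eq_bigr => l _ /=; rewrite !scalerA -scalerDl exprMn; congr (_ *: _); ring.
case/orP => [/eqP ->|]; last exact: Plt.
have := PN 1; rewrite big_ord_recr /= expr1n scale1r => Ps.
have Pl : P (\sum_(i < d) 1 ^+ i *: N i).
  apply: (big_ind P) => // [u w Pu Pw|j _]; last by apply: PZ; apply: Plt.
  by rewrite -[u]scale1r; apply: PL.
have := PL (-1) _ _ Pl Ps; rewrite scaleN1r addrA addNr add0r; exact.
Qed.

Lemma poly_all0 (p : {poly C}) : (forall t, p.[t] = 0) -> p = 0.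
Proof.
move=> p0; apply/eqP; apply: contraT => pn0.
have := @max_poly_roots _ p [seq i%:R | i <- iota 0 (size p)] pn0.
rewrite size_map size_iota ltnn => -> //.
  by apply/allP => x _; apply/rootP.
by rewrite map_inj_uniq ?iota_uniq // => i j /eqP; rewrite eqr_nat => /eqP.
Qed.

Lemma coef1M (p q : {poly C}) : (p * q)`_1 = p`_0 * q`_1 + p`_1 * q`_0.
Proof. by rewrite coefM big_ord_recl big_ord1. Qed.
Lemma coef0X (p : {poly C}) k : (p ^+ k)`_0 = p`_0 ^+ k.
Proof. by elim: k => [|k IHk]; rewrite ?expr0 ?coef1 // !exprS coef0M IHk. Qed.
Lemma coef1X (p : {poly C}) k : p`_0 = 1 -> (p ^+ k)`_1 = k%:R * p`_1.
Proof.
move=> p0; elim: k => [|k IHk]; first by rewrite expr0 coef1 mul0r.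
by rewrite exprS coef1M IHk coef0X p0 expr1n mul1r mulr1 -natr1 mulrDl mul1r addrC.
Qed.

Section PolyMx.
Variables r s t : nat.
Definition cfm i (P : 'M[{poly C}]_(r, s)) : 'M[C]_(r, s) := map_mx (coefp i) P.
End PolyMx.
Lemma cfm0M r s t (P : 'M[{poly C}]_(r, s)) (Q : 'M_(s, t)) :
  cfm 0 (P *m Q) = cfm 0 P *m cfm 0 Q.
Proof.
apply/matrixP => i j; rewrite !mxE /= coef_sum; apply: eq_bigr => l _.
by rewrite coef0M !mxE.
Qed.
Lemma cfm1M r s t (P : 'M[{poly C}]_(r, s)) (Q : 'M_(s, t)) :
  cfm 1 (P *m Q) = cfm 0 P *m cfm 1 Q + cfm 1 P *m cfm 0 Q.
Proof.
apply/matrixP => i j; rewrite !mxE /= coef_sum -big_split; apply: eq_bigr => l _ /=.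
by rewrite coef1M !mxE.
Qed.

Definition evm r s (P : 'M[{poly C}]_(r, s)) t : 'M[C]_(r, s) := map_mx (horner_eval t) P.

Lemma evm_sum r s (P : 'M[{poly C}]_(r, s)) : exists2 d, (1 < d)%N &
  forall t, evm P t = \sum_(i < d) t ^+ i *: cfm i P.
Proof.
exists (\max_(ij : 'I_r * 'I_s) size (P ij.1 ij.2)).+2 => // t.
apply/matrixP => i j; rewrite !mxE summxE /horner_eval /=.
rewrite (@horner_coef_wide _ (\max_(ij : 'I_r * 'I_s) size (P ij.1 ij.2)).+2).
  by apply: eq_bigr => l _; rewrite !mxE mulrC.
apply: leq_trans (leq_trans (leqnSn _) (leqnSn _)).
exact: (@leq_bigmax _ (fun ij : 'I_r * 'I_s => size (P ij.1 ij.2)) (i, j)).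
Qed.

Lemma cfm0_evm r s (P : 'M[{poly C}]_(r, s)) : cfm 0 P = evm P 0.
Proof. by apply/matrixP => i j; rewrite !mxE /= /horner_eval horner_coef0. Qed.

Lemma evmM r s t (P : 'M[{poly C}]_(r, s)) (Q : 'M_(s, t)) x :
  evm (P *m Q) x = evm P x *m evm Q x.
Proof. exact: map_mxM. Qed.
Lemma evm_adj n (P : 'M[{poly C}]_n) x : evm (\adj P) x = \adj (evm P x).
Proof. exact: map_mx_adj. Qed.
Lemma evm_det n (P : 'M[{poly C}]_n) x : (\det P).[x] = \det (evm P x).
Proof. by rewrite /evm det_map_mx. Qed.
Definition cmx r s (A : 'M[C]_(r, s)) : 'M[{poly C}]_(r, s) := map_mx polyC A.
Lemma evm_cmx r s (A : 'M[C]_(r, s)) x : evm (cmx A) x = A.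
Proof. by apply/matrixP => i j; rewrite !mxE /horner_eval hornerC. Qed.
Lemma cfm0_cmx r s (A : 'M[C]_(r, s)) : cfm 0 (cmx A) = A.
Proof. by apply/matrixP => i j; rewrite !mxE /= coefC. Qed.
Lemma cfm1_cmx r s (A : 'M[C]_(r, s)) : cfm 1 (cmx A) = 0.
Proof. by apply/matrixP => i j; rewrite !mxE /= coefC. Qed.
Definition polycurve r s d (N : nat -> 'M[C]_(r, s)) : 'M[{poly C}]_(r, s) :=
  \matrix_(p, q) \poly_(i < d) N i p q.
Lemma cfm_polycurve r s d (N : nat -> 'M[C]_(r, s)) i : (i < d)%N ->
  cfm i (polycurve d N) = N i.
Proof. by move=> lt; apply/matrixP => p q; rewrite !mxE /= coef_poly lt. Qed.
Lemma evm_polycurve r s d (N : nat -> 'M[C]_(r, s)) t :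
  evm (polycurve d N) t = \sum_(i < d) t ^+ i *: N i.
Proof.
apply/matrixP => p q; rewrite !mxE summxE /horner_eval horner_poly.
by apply: eq_bigr => i _; rewrite !mxE mulrC.
Qed.
End Curves.

Section Sl2Der.
Variable C : numClosedFieldType.
(** Derivations of $\mathfrak{sl}_2$ are inner: [P] and [Q] are the values at $e$ and $f$, and the
    hypotheses are the linearized relations $[[e,f],e]=2e$ and $[[e,f],f]=-2f$. *)
Lemma sl2_der (P Q : 'M[C]_2) : \tr P = 0 -> \tr Q = 0 ->
  lie (lie P f2 + lie e2 Q) e2 + lie h2 P = 2 *: P ->
  lie (lie P f2 + lie e2 Q) f2 + lie h2 Q = (-2) *: Q ->
  exists2 X, \tr X = 0 & lie X e2 = P /\ lie X f2 = Q.
Proof.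
rewrite !tr2E => trP trQ eP eQ.
have n2 : (2 : C) != 0 by rewrite pnatr_eq0.
have n4 : (4 : C) != 0 by rewrite pnatr_eq0.
have := congr1 (fun M : 'M_2 => M i1 i0) eP; have := congr1 (fun M : 'M_2 => M i0 i1) eP.
have := congr1 (fun M : 'M_2 => M i0 i1) eQ.
rewrite /lie !(mxE, sum2) /= !(mulr0, mulr1, mul0r, mul1r, addr0, add0r, subr0, sub0r).
move=> q01 p01 p10.
have P11 : P i1 i1 = - P i0 i0 by apply/eqP; rewrite -addr_eq0 addrC trP.
have Q11 : Q i1 i1 = - Q i0 i0 by apply/eqP; rewrite -addr_eq0 addrC trQ.
have P10 : P i1 i0 = 0.
  apply: (mulfI n4); rewrite mulr0; transitivity (2 * P i1 i0 + 2 * P i1 i0); first by ring.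
  by rewrite -{1}p10; ring.
have Q01 : Q i0 i1 = 0.
  apply: (mulfI n4); rewrite mulr0; transitivity (2 * Q i0 i1 - (- 2) * Q i0 i1); first by ring.
  by rewrite -q01; ring.
have Q10 : Q i1 i0 = - P i0 i1.
  apply: (mulfI n2); transitivity (2 * P i0 i1 + 2 * Q i1 i0 - 2 * P i0 i1); first by ring.
  by rewrite -{2}p01; ring.
exists (mk2 (P i0 i1 / 2) (Q i0 i0) (- P i0 i0) (- (P i0 i1 / 2))).
  by rewrite tr2E !mk2E subrr.
by split; mx2; rewrite ?P11 ?Q11 ?P10 ?Q01 ?Q10; field.
Qed.
End Sl2Der.

(** * The image of H *)

Section Image.
Variable C : numClosedFieldType.
Variables (F : seq nat) (m : nat -> nat).
Hypothesis uF : uniq F.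
Hypothesis F0 : F != [::].
Hypothesis Fpos : forall k, k \in F -> (0 < k)%N.
Hypothesis mpos : forall k, k \in F -> (0 < m k)%N.
Local Notation n := (dimT F m).
Local Notation L1 := (@L1 C F m).
Local Notation rho1 := (@rhoT1 C F m).
Implicit Types (k j a : nat) (g h X Y : 'M[C]_2) (A B z : 'M[C]_n).

Let k0 := head 0%N F.
Let s0 := (k0, 0%N, 0%N).
Let s1 := (k0, 0%N, 1%N).
Local Notation rd := (@readX C F m k0 s0 s1).

Lemma k0F : k0 \in F.
Proof. by rewrite /k0; case: F F0 => //= k r _; rewrite inE eqxx. Qed.

Lemma readL1 X : rd (L1 X) = X.
Proof. by apply: readX_L1 => //; [exact: k0F|exact/Fpos/k0F|exact/mpos/k0F]. Qed.

Lemma L1_inj X Y : L1 X = L1 Y -> X = Y.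
Proof. by move/(congr1 rd); rewrite !readL1. Qed.

Lemma L1_eq0 X : (L1 X == 0) = (X == 0).
Proof.
apply/eqP/eqP => [|->]; last exact: L10.
by rewrite -(L10 C F m); apply: L1_inj.
Qed.

Lemma e2_neq0 : (e2 : 'M[C]_2) != 0.
Proof.
apply/eqP => /matrixP/(_ i0 i1)/eqP; rewrite mk2E mxE.
exact/negP/oner_neq0.
Qed.
Lemma tr_e2 : \tr (e2 : 'M[C]_2) = 0. Proof. by rewrite tr2E !mk2E addr0. Qed.
Lemma tr_f2 : \tr (f2 : 'M[C]_2) = 0. Proof. by rewrite tr2E !mk2E addr0. Qed.
Lemma lie_efe : lie (lie e2 f2) e2 = 2 *: (e2 : 'M[C]_2).
Proof. by rewrite /lie lie_ef /e2 /h2; mx2; ring. Qed.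
Lemma lie_eff : lie (lie e2 f2) f2 = (-2) *: (f2 : 'M[C]_2).
Proof. by rewrite /lie lie_ef /f2 /h2; mx2; ring. Qed.

Lemma conj_tr g X : SL2 g -> \tr (g *m X *m invmx g) = \tr X.
Proof. by move=> Sg; rewrite mxtrace_mulC mulmxA mulVmx ?mul1mx // SL2_unit. Qed.

Lemma rho_conj g X : SL2 g -> rho1 g *m L1 X = L1 (g *m X *m invmx g) *m rho1 g.
Proof.
move=> Sg; apply/esym/rhoT1_L1 => //.
by rewrite -!mulmxA mulVmx ?mulmx1 // SL2_unit.
Qed.

(** Conjugation multiplied by $\det B$: the adjugate replaces the inverse so that the result is
    polynomial in [B]. *)
Definition cadj X B := B *m L1 X *m \adj B.

Lemma cadjE B X Y : B *m L1 X = L1 Y *m B -> cadj X B = L1 (\det B *: Y).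
Proof.
move=> e; rewrite /cadj e -mulmxA mul_mx_adj L1Z //.
by rewrite -scalemx1 -scalemxAr mulmx1.
Qed.

Lemma cadj_rho g X : SL2 g ->
  cadj X (rho1 g) = L1 (\det (rho1 g) *: (g *m X *m invmx g)).
Proof. by move=> Sg; apply/cadjE/rho_conj. Qed.

Lemma polymx_cadj X : polymx (cadj X).
Proof.
apply: polymxM; last exact: polymx_adj.
by apply: polymxM; [exact: polymx_id|exact: polymx_const].
Qed.

Lemma polyfun_cm (M : 'M[C]_n -> 'M[C]_n) s t : polymx M -> polyfun (fun B => cm (M B) s t).
Proof. by move=> pM; apply: polyfun_sum => p; apply: polyfun_sum => q; apply: pM. Qed.

Lemma polymx_mk2 (f1 f2 f3 f4 : 'M[C]_n -> C) :
  polyfun f1 -> polyfun f2 -> polyfun f3 -> polyfun f4 ->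
  polymx (fun B => mk2 (f1 B) (f2 B) (f3 B) (f4 B)).
Proof.
move=> p1 p2 p3 p4 i j.
apply: (@polyfun_ext _ _ (if i == i0 then if j == i0 then f1 else f2
                          else if j == i0 then f3 else f4)).
  by move=> B; rewrite mxE; do 2!case: ifP.
by do 2!case: ifP.
Qed.

Lemma polymx_rd k u v (M : 'M[C]_n -> 'M[C]_n) : polymx M ->
  polymx (fun B => @readX C F m k u v (M B)).
Proof.
move=> pM; apply: polymx_mk2.
- by apply: polyfunM; [exact: polyfun_const|exact: polyfun_cm].
- exact: polyfun_cm.
- by apply: polyfunM; [exact: polyfun_const|exact: polyfun_cm].
- apply: polyfunB; first exact: polyfun_cm.
  by apply: polyfunM; [exact: polyfun_const|exact: polyfun_cm].
Qed.

Lemma polymxD r s (M N : 'M[C]_n -> 'M[C]_(r, s)) :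
  polymx M -> polymx N -> polymx (fun B => M B + N B).
Proof.
move=> pM pN i j; apply: polyfun_ext (polyfunD (pM i j) (pN i j)) => B.
by rewrite mxE.
Qed.
Lemma polymxZ r s (f : 'M[C]_n -> C) (M : 'M[C]_n -> 'M[C]_(r, s)) :
  polyfun f -> polymx M -> polymx (fun B => f B *: M B).
Proof.
by move=> pf pM i j; apply: polyfun_ext (polyfunM pf (pM i j)) => B; rewrite mxE.
Qed.
Lemma polymx_ext r s (M N : 'M[C]_n -> 'M[C]_(r, s)) : M =1 N -> polymx M -> polymx N.
Proof. by move=> e pM i j; apply: polyfun_ext (pM i j) => B; rewrite e. Qed.

Lemma polymx_L1 (M : 'M[C]_n -> 'M[C]_2) : polymx M -> polymx (fun B => L1 (M B)).
Proof.
move=> pM.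
apply: (@polymx_ext _ _ (fun B => M B i0 i0 *: L1 (mk2 1 0 0 0)
  + M B i0 i1 *: L1 (mk2 0 1 0 0) + M B i1 i0 *: L1 (mk2 0 0 1 0)
  + M B i1 i1 *: L1 (mk2 0 0 0 1))) => [B|].
  rewrite -!L1Z // -!L1D //; congr L1.
  by rewrite [RHS]mk2_eta [LHS]mk2_eta; congr mk2; rewrite !mxE /=; ring.
by do 3?apply: polymxD; (apply: polymxZ; [exact: pM|exact: polymx_const]).
Qed.

Lemma HimgM g A : SL2 g -> HimgV A -> HimgV (rho1 g *m A).
Proof.
by move=> Sg [h [Sh ->]]; exists (g *m h); rewrite rhoT1M //; split=> //; apply: SL2_M.
Qed.

Lemma intertwineV r (D U V : 'M[C]_r) : D \in unitmx -> U *m D = D *m V ->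
  V *m invmx D = invmx D *m U.
Proof. by move=> uD e; rewrite -[LHS](mulKmx uD) (mulmxA D) -e -mulmxA mulmxV // mulmx1. Qed.

Lemma tr0E X : \tr X = 0 -> X = X i0 i1 *: e2 + X i1 i0 *: f2 + X i0 i0 *: h2.
Proof.
rewrite tr2E => trX; have d : X i1 i1 = - X i0 i0.
  by apply/eqP; rewrite -addr_eq0 addrC trX.
by rewrite [LHS]mk2_eta [RHS]mk2_eta d; congr mk2; rewrite !mxE /=; ring.
Qed.

(** The conjugates of [e2] and [f2] by [A] again form an $\mathfrak{sl}_2$-pair, so some [h] in
    $\mathrm{SL}_2$ has the same effect on them; what remains of [A] commutes with
    $\mathfrak{sl}_2$. *)
Lemma L1_tr0_split A : A \in unitmx ->
  (exists2 X, \tr X = 0 & A *m L1 e2 = L1 X *m A) ->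
  (exists2 Y, \tr Y = 0 & A *m L1 f2 = L1 Y *m A) ->
  exists2 h, SL2 h & forall X, \tr X = 0 ->
     rho1 (invmx h) *m A *m L1 X = L1 X *m (rho1 (invmx h) *m A).
Proof.
move=> uA [X trX AX] [Y trY AY].
have lieA U V U' V' : A *m L1 U = L1 U' *m A -> A *m L1 V = L1 V' *m A ->
    A *m L1 (lie U V) = L1 (lie U' V') *m A.
  move=> eU eV; rewrite !L1_lie // /lie mulmxBr mulmxBl !mulmxA eU eV.
  by rewrite -!mulmxA eU eV.
have inj U V W : A *m L1 U = L1 V *m A -> A *m L1 U = L1 W *m A -> V = W.
  by move=> -> e; apply: L1_inj; rewrite -[LHS](mulmxK uA) e mulmxK.
have eA : A *m L1 (lie e2 f2) = L1 (lie X Y) *m A by apply: lieA.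
have eX : lie (lie X Y) X = 2 *: X.
  apply: (inj _ _ _ (lieA _ _ _ _ eA AX)).
  by rewrite lie_efe !L1Z // -scalemxAr AX scalemxAl.
have eY : lie (lie X Y) Y = (-2) *: Y.
  apply: (inj _ _ _ (lieA _ _ _ _ eA AY)).
  by rewrite lie_eff !L1Z // -scalemxAr AY scalemxAl.
have X0 : X != 0.
  apply/eqP => X0; move: AX; rewrite X0 L10 mul0mx => /(congr1 (mulmx (invmx A))).
  by rewrite mulKmx // mulmx0; move/eqP; rewrite L1_eq0 (negPf e2_neq0).
have [h Sh [Xh Yh]] := sl2_pair trX trY X0 eX eY; exists h => //.
have cj U V : U *m h = h *m V -> rho1 (invmx h) *m L1 U = L1 V *m rho1 (invmx h).
  by move=> /(intertwineV (SL2_unit Sh)) e; apply/esym/rhoT1_L1.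
have ze : rho1 (invmx h) *m A *m L1 e2 = L1 e2 *m (rho1 (invmx h) *m A).
  by rewrite -mulmxA AX mulmxA (cj _ _ Xh) mulmxA.
have zf : rho1 (invmx h) *m A *m L1 f2 = L1 f2 *m (rho1 (invmx h) *m A).
  by rewrite -mulmxA AY mulmxA (cj _ _ Yh) mulmxA.
move=> Z trZ; rewrite (tr0E trZ) !(L1D, L1Z) // -lie_ef L1_lie // /lie.
rewrite !(mulmxDr, mulmxDl, mulmxN, mulNmx) -!scalemxAr -!scalemxAl ze zf.
congr (_ + _ *: _); rewrite mulmxBr mulmxBl !mulmxA ze zf.
by rewrite -!(mulmxA (L1 _)) ze zf.
Qed.

(** The element $\varepsilon=\pm1$ of the centre of $\mathrm{SL}_2$ acts on $R_k$ as
    $\varepsilon^k$. *)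
Lemma lift2_scal_rho (eps : C) mu : eps ^+ 2 = 1 ->
  (forall k i j, k \in F -> (i < m k)%N -> (j < m k)%N ->
     mu k i j = eps ^+ k * (i == j)%:R) ->
  lift2 F m mu = rho1 (eps%:M).
Proof.
move=> e2 muE; rewrite (eq_lift2 (B' := fun k i j => eps ^+ k * (i == j)%:R)) //.
rewrite rhoT1E; apply: cmP => // -[[k j] a] [[k' j'] a'] s t.
rewrite cm_lift1 // cm_lift2 //.
move: s t; rewrite !mem_tidx => // /and3P[Fk ltj le] /and3P[Fk' ltj' le'].
have [ek|ne] //= := eqVneq k k'; subst k'; rewrite rhoE_scal //.
by case: (j == j'); case: (a == a'); rewrite ?mulr0.
Qed.

(** That [cadj X B] lies in the image of [L1] is a polynomial equation: reading it with [rd] and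
    rebuilding it changes nothing. It therefore passes to the closure, and invertibility of [A]
    removes the determinant. *)
Lemma inclosure_L1 (K : 'M[C]_n -> Prop) A X :
  (forall B, K B -> exists2 Y, \tr Y = 0 & B *m L1 X = L1 Y *m B) ->
  A \in unitmx -> inclosure K A -> exists2 Y, \tr Y = 0 & A *m L1 X = L1 Y *m A.
Proof.
move=> KL uA KA; have dA : \det A != 0 by rewrite -unitfE -unitmxE.
have e1 : cadj X A - L1 (rd (cadj X A)) = 0.
  apply: (@inclosure_mx _ _ _ _ K (fun B => cadj X B - L1 (rd (cadj X B)))) KA.
    apply: (@polymx_ext _ _ (fun B => cadj X B + (-1) *: L1 (rd (cadj X B)))).
      by move=> B; rewrite scaleN1r.
    apply: polymxD; first exact: polymx_cadj.
    by apply: polymxZ; [exact: polyfun_const|exact/polymx_L1/polymx_rd/polymx_cadj].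
  by move=> B /KL [Y _ e]; rewrite (cadjE e) readL1 subrr.
have e2 : \tr (rd (cadj X A)) = 0.
  apply: (KA (fun B => \tr (rd (cadj X B)))).
    by apply: polyfun_sum => i; apply/polymx_rd/polymx_cadj.
  by move=> B /KL [Y tY e]; rewrite (cadjE e) readL1 mxtraceZ tY mulr0.
exists ((\det A)^-1 *: rd (cadj X A)); first by rewrite mxtraceZ e2 mulr0.
move/eqP: e1; rewrite subr_eq0 => /eqP; rewrite {1}/cadj => /(congr1 (fun B => B *m A)).
rewrite -mulmxA mul_adj_mx -scalemx1 -scalemxAr mulmx1 => e1.
by rewrite L1Z // -scalemxAl -e1 scalerA mulVf // scale1r.
Qed.

(** On [rho1 g] this is $g_{00}^k$. The value 1 at [k = 0] adjoins a trivial degree, so that pairs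
    of degrees with even sum also cover a single even degree. *)
Definition top_entry k B := if k == 0%N then 1 else cm B (k, 0%N, 0%N) (k, 0%N, 0%N).

Lemma cm_rho00 g k j : k \in F -> (j < m k)%N ->
  cm (rho1 g) (k, j, 0%N) (k, j, 0%N) = g i0 i0 ^+ k.
Proof.
by move=> Fk ltj; rewrite rhoT1E cm_lift1 ?mem_tidx ?Fk ?ltj // !eqxx /= rhoE_00.
Qed.

Lemma top_entry_rho g k : k \in 0%N :: F -> top_entry k (rho1 g) = g i0 i0 ^+ k.
Proof.
rewrite inE /top_entry; case: eqP => [->//|_ /= Fk].
by rewrite cm_rho00 ?mpos.
Qed.

Lemma conj_e2_01 g : SL2 g -> (g *m e2 *m invmx g) i0 i1 = g i0 i0 ^+ 2.
Proof.
move=> Sg; have -> : invmx g = mk2 (g i1 i1) (- g i0 i1) (- g i1 i0) (g i0 i0).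
  rewrite -[LHS]mul1mx; apply: (canLR (mulmxK (SL2_unit Sg))).
  move: Sg; rewrite /SL2 det2E => Sg; mx2; rewrite -?Sg; ring.
by rewrite !mul2E !mk2E; ring.
Qed.

(** [eps] is the value of [c] at an odd degree, or 1 if there is none; pairing with 0 gives $c_k=1$
    for even $k$. *)
Lemma sign_powers (c : nat -> C) : c 0%N = 1 ->
  (forall k l, k \in 0%N :: F -> l \in 0%N :: F -> ~~ odd (k + l) -> c k * c l = 1) ->
  exists2 eps, eps ^+ 2 = 1 & forall k, k \in F -> c k = eps ^+ k.
Proof.
move=> c0 cM; have F' k : k \in F -> k \in 0%N :: F by rewrite inE => ->; rewrite orbT.
have ev2 (e : C) k : e ^+ 2 = 1 -> ~~ odd k -> e ^+ k = 1.
  by move=> e2 ev; rewrite -[k]odd_double_half (negPf ev) add0n -mul2n exprM e2 expr1n.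
have ceven k : k \in F -> ~~ odd k -> c k = 1.
  by move=> Fk ev; have := cM k 0%N; rewrite c0 mulr1 addn0; apply; rewrite ?mem_head ?F'.
have [/hasP [k1 Fk1 odd1]|/hasPn alleven] := boolP (has odd F); last first.
  by exists 1 => [|k Fk]; rewrite expr1n // ceven // alleven.
have t2 : c k1 ^+ 2 = 1 by rewrite expr2 cM ?F' // oddD addbb.
exists (c k1) => // k Fk.
have [ok|ek] := boolP (odd k); last by rewrite ceven // ev2.
have tk : c k * c k1 = 1 by apply: cM; rewrite ?F' // oddD ok odd1.
have -> : c k = c k1 by rewrite -[LHS]mulr1 -t2 expr2 mulrA tk mul1r.
by rewrite -[k]odd_double_half ok -mul2n add1n exprS exprM t2 expr1n mulr1.
Qed.

(** A limit point becomes, after multiplication by some [rho1 h], an operator [z] commuting with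
    $H$. Entries that vanish or agree on the image do so at [z], hence [z] is a scalar on each
    isotypic component; a last polynomial identity reduces the scalars to powers of a sign. *)
Lemma Himg_closed : zclosedGL (@HimgV C F m).
Proof.
apply: zclosed_closure => [_ [g [Sg ->]]|A uA KA]; first exact: rhoT1_unit.
have KL X : \tr X = 0 -> forall B, HimgV B ->
    exists2 Y, \tr Y = 0 & B *m L1 X = L1 Y *m B.
  move=> tX _ [g [Sg ->]]; exists (g *m X *m invmx g); first by rewrite conj_tr.
  exact: rho_conj.
have [h Sh zL] := L1_tr0_split uA (inclosure_L1 (KL _ tr_e2) uA KA)
  (inclosure_L1 (KL _ tr_f2) uA KA).
set z := rho1 (invmx h) *m A in zL.
have uz : z \in unitmx by rewrite unitmx_mul uA andbT; apply/rhoT1_unit/SL2_V.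
have Kz : inclosure (@HimgV C F m) z.
  by apply: inclosure_mull KA => B; apply/HimgM/SL2_V.
suff [eps eps2 zE] : exists2 eps, eps ^+ 2 = 1 & z = rho1 (eps%:M).
  rewrite (_ : A = rho1 h *m z); last by rewrite mulmxA rhoT1V // mul1mx.
  by rewrite zE; apply: HimgM => //; exists (eps%:M); split=> //; apply: SL2_scal.
have zS := L1_schur uF (zL _ tr_e2) (zL _ tr_f2).
have dz : \det z != 0 by rewrite -unitfE -unitmxE.
have vd k j : k \in F -> (j < m k)%N -> (k, j, 0%N) \in tidx F m.
  by move=> Fk ltj; rewrite mem_tidx // Fk ltj.
have off k i j : k \in F -> (i < m k)%N -> (j < m k)%N -> i != j ->
    cm z (k, i, 0%N) (k, j, 0%N) = 0.
  move=> Fk lti ltj ne; apply: (Kz (fun B => cm B (k, i, 0%N) (k, j, 0%N))).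
    exact: (polyfun_cm _ _ (@polymx_id _ _)).
  by move=> _ [g [_ ->]]; rewrite rhoT1E cm_lift1 ?vd // (negPf ne) andbF.
have dia k j : k \in F -> (j < m k)%N ->
    cm z (k, j, 0%N) (k, j, 0%N) = top_entry k z.
  move=> Fk ltj; apply/eqP; rewrite -subr_eq0; apply/eqP.
  apply: (Kz (fun B => cm B (k, j, 0%N) (k, j, 0%N) - top_entry k B)).
    apply: polyfunB; first exact: (polyfun_cm _ _ (@polymx_id _ _)).
    rewrite /top_entry; case: (_ == 0%N); first exact: polyfun_const.
    exact: (polyfun_cm _ _ (@polymx_id _ _)).
  by move=> _ [g [_ ->]]; rewrite top_entry_rho ?inE ?Fk ?orbT // cm_rho00 // subrr.
have top k l : k \in 0%N :: F -> l \in 0%N :: F -> ~~ odd (k + l) ->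
    top_entry k z * top_entry l z = 1.
  move=> Fk Fl ev; set d := (k + l)./2; have dE : (k + l = d * 2)%N.
    by rewrite muln2 -[LHS]odd_double_half (negPf ev).
  (* This vanishes on the image, where $k+l=2d$ and the corner of [rd (cadj e2 B)] is $\det B\cdot
     g_{00}^2$. At [z], which commutes with $e$, that corner is just $\det z$. *)
  have := Kz (fun B => top_entry k B * top_entry l B * \det B ^+ d
                       - rd (cadj e2 B) i0 i1 ^+ d).
  have ptop k' : polyfun (fun B => top_entry k' B).
    rewrite /top_entry; case: (_ == 0%N); first exact: polyfun_const.
    exact: (polyfun_cm _ _ (@polymx_id _ _)).
  have ce : cadj e2 z = L1 (\det z *: e2).
    by rewrite /cadj zL ?tr_e2 // -mulmxA mul_mx_adj -scalemx1 -scalemxAr mulmx1 L1Z.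
  rewrite ce readL1 mxE mk2E mulr1 => e.
  have {e}/eqP : (top_entry k z * top_entry l z) * \det z ^+ d - \det z ^+ d = 0.
    apply: e.
      apply: polyfunB; last by apply: polyfunX; apply: polymx_rd; apply: polymx_cadj.
      by apply: polyfunM; [exact: polyfunM|by apply: polyfunX; apply: polyfun_det; apply: polymx_id].
    move=> _ [g [Sg ->]]; rewrite cadj_rho // readL1 !top_entry_rho // mxE conj_e2_01 //.
    by rewrite exprMn -exprM mulnC -dE exprD mulrC subrr.
  rewrite -{2}[_ ^+ d]mul1r -mulrBl mulf_eq0 expf_eq0 (negPf dz) andbF orbF.
  by rewrite subr_eq0 => /eqP.
have [|eps eps2 topE] := @sign_powers (fun k => top_entry k z) _ top; first by rewrite /top_entry eqxx.
exists eps => //; rewrite zS; apply: lift2_scal_rho => // k i j Fk lti ltj.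
by have [<-|/off ->] := eqVneq i j; rewrite ?mulr0 // dia // topE // mulr1.
Qed.

(** Bracketing with [D] induces a derivation of $\mathfrak{sl}_2$, which is inner; subtracting the
    corresponding [L1 X] leaves an operator commuting with $\mathfrak{sl}_2$. *)
Lemma L1_der (D : 'M[C]_n) P Q : \tr P = 0 -> \tr Q = 0 ->
  lie D (L1 e2) = L1 P -> lie D (L1 f2) = L1 Q ->
  exists2 X, \tr X = 0 & [/\ lie X e2 = P, lie (D - L1 X) (L1 e2) = 0
    & lie (D - L1 X) (L1 f2) = 0].
Proof.
move=> trP trQ eP eQ.
have dlie (U V : 'M[C]_n) : lie D (lie U V) = lie (lie D U) V + lie U (lie D V).
  rewrite /lie !(mulmxBr, mulmxBl, mulmxA).
  move: (D *m U *m V) (D *m V *m U) (U *m V *m D) (V *m U *m D) (U *m D *m V)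
    (V *m D *m U) => c1 c2 c3 c4 c5 c6.
  by apply/matrixP => p q; rewrite !mxE; ring.
have eh : lie D (L1 h2) = L1 (lie P f2 + lie e2 Q).
  by rewrite -lie_ef L1_lie // dlie eP eQ L1D // !L1_lie.
have h2e : lie h2 e2 = 2 *: (e2 : 'M[C]_2) by rewrite -lie_efe /lie lie_ef.
have h2f : lie h2 f2 = (-2) *: (f2 : 'M[C]_2) by rewrite -lie_eff /lie lie_ef.
have lieZ (c : C) (U : 'M[C]_n) : lie D (c *: U) = c *: lie D U.
  by rewrite /lie -scalemxAr -scalemxAl scalerBr.
have [||X trX [Xe Xf]] := sl2_der trP trQ.
- apply: L1_inj; rewrite L1D // !(L1_lie m uF (_ + _)) -eh (L1_lie m uF h2) -eP -dlie.
  by rewrite -(L1_lie m uF) h2e !L1Z // lieZ eP.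
- apply: L1_inj; rewrite L1D // !(L1_lie m uF (_ + _)) -eh (L1_lie m uF h2) -eQ -dlie.
  by rewrite -L1_lie // h2f !L1Z // lieZ eQ.
have lieB (U V : 'M[C]_n) : lie (D - U) V = lie D V - lie U V.
  rewrite /lie mulmxBl mulmxBr.
  move: (D *m V) (U *m V) (V *m D) (V *m U) => c1 c2 c3 c4.
  by apply/matrixP => p q; rewrite !mxE; ring.
by exists X => //; rewrite !lieB -!L1_lie // Xe Xf eP eQ !subrr.
Qed.

Lemma cm_coef (P : 'M[{poly C}]_n) s t i : (cm P s t)`_i = cm (cfm i P) s t.
Proof.
rewrite /cm coef_sum; apply: eq_bigr => p _; rewrite coef_sum.
by apply: eq_bigr => q _; rewrite mxE.
Qed.
Lemma cm_horner (P : 'M[{poly C}]_n) s t x : (cm P s t).[x] = cm (evm P x) s t.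
Proof.
rewrite /cm horner_sum; apply: eq_bigr => p _; rewrite horner_sum.
by apply: eq_bigr => q _; rewrite mxE.
Qed.

(** The velocity normalizes the Lie algebra because conjugation along the curve does. After
    subtraction of an inner part it acts on the multiplicity spaces only, and the linear terms of
    identities valid on the image show that nothing is left. *)
Lemma Himg_curve (N : nat -> 'M[C]_n) d : (1 < d)%N -> N 0%N = 1%:M ->
  (forall t, HimgV (\sum_(i < d) t ^+ i *: N i)) ->
  exists2 X, \tr X = 0 & N 1%N = L1 X.
Proof.
move=> d1 N0 NH; pose P := polycurve d N.
have P0 : cfm 0 P = 1%:M by rewrite cfm_polycurve // ltnW.
have P1 : cfm 1 P = N 1%N by rewrite cfm_polycurve.
have PH t : HimgV (evm P t) by rewrite evm_polycurve.
pose D := N 1%N; pose dl := (\det P)`_1.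
have adj0 : cfm 0 (\adj P) = 1%:M.
  by rewrite cfm0_evm evm_adj -cfm0_evm P0 adj1.
have det0 : (\det P)`_0 = 1 by rewrite -horner_coef0 evm_det -cfm0_evm P0 det1.
(* The linear term of $P\operatorname{adj}(P)=\det P$, where $P(0)=1$. *)
have adj1 : cfm 1 (\adj P) = dl%:M - D.
  have := congr1 (@cfm C n n 1) (mul_mx_adj P); rewrite cfm1M P0 mul1mx adj0 mulmx1 P1 => e.
  apply/eqP; rewrite eq_sym subr_eq e; apply/eqP/matrixP => p q.
  by rewrite !mxE /= coefMn.
have ad X : \tr X = 0 -> exists2 Y, \tr Y = 0 & lie D (L1 X) = L1 Y /\
    cfm 1 (P *m cmx (L1 X) *m \adj P) = L1 Y + dl *: L1 X.
  move=> trX; pose Q := P *m cmx (L1 X) *m \adj P.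
  have Q1 : cfm 1 Q = lie D (L1 X) + dl *: L1 X.
    rewrite !cfm1M cfm0M P0 mul1mx cfm0_cmx cfm1_cmx mulmx0 add0r adj0 adj1 P1 mulmx1.
    rewrite mulmxBr -scalemx1 -scalemxAr mulmx1 /lie.
    by rewrite [LHS]addrC [LHS]addrCA [LHS]addrC.
  have [e d1'] := evm_sum Q; move=> QE.
  have QH t : evm Q t = L1 (rd (evm Q t)) /\ \tr (rd (evm Q t)) = 0.
    have -> : evm Q t = cadj X (evm P t) by rewrite !evmM evm_cmx evm_adj.
    case: (PH t) => g [Sg ->]; rewrite cadj_rho // readL1; split=> //.
    by rewrite mxtraceZ conj_tr // trX mulr0.
  have [q1 q2] : cfm 1 Q = L1 (rd (cfm 1 Q)) /\ \tr (rd (cfm 1 Q)) = 0.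
    apply: (@curve_coef _ _ (fun A => A = L1 (rd A) /\ \tr (rd A) = 0) (fun i => cfm i Q) e) => //.
    - rewrite -[in X in _ = L1 X](L10 C F m) readL1 L10; split=> //.
      by rewrite -(L10 C F m) readL1 mxtrace0.
    - move=> c u w [eu tu] [ew tw]; rewrite readX_lin // mxtraceD mxtraceZ tu tw mulr0 addr0.
      by rewrite L1_lin // -eu -ew.
    - by move=> t; rewrite -QE.
  exists (rd (cfm 1 Q) - dl *: X); first by rewrite linearB /= mxtraceZ trX q2 mulr0 subr0.
  rewrite -/Q L1B // L1Z // -q1 Q1 addrK; split=> //.
have [Pe trPe [ePe ePe']] := ad _ tr_e2; have [Pf trPf [ePf _]] := ad _ tr_f2.
have [X trX [Xe De Df]] := L1_der trPe trPf ePe ePf; exists X => //.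
have De' : (D - L1 X) *m L1 e2 = L1 e2 *m (D - L1 X) by apply/eqP; rewrite -subr_eq0; apply/eqP.
have Df' : (D - L1 X) *m L1 f2 = L1 f2 *m (D - L1 X) by apply/eqP; rewrite -subr_eq0; apply/eqP.
apply/eqP; rewrite -subr_eq0 -/D; apply/eqP; rewrite (L1_schur uF De' Df').
set mu := fun k i j => _.
suff mu0 k i j : k \in F -> (i < m k)%N -> (j < m k)%N -> mu k i j = 0.
  rewrite (eq_lift2 (B' := fun _ _ _ => 0)) //.
  by apply/matrixP => p q; rewrite !mxE; case: ifP.
move=> Fk lti ltj; rewrite /mu cmD cmN.
have vd j' : (j' < m k)%N -> (k, j', 0%N) \in tidx F m.
  by move=> lt; rewrite mem_tidx // Fk lt.
have [<-|ne] := eqVneq i j; last first.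
  rewrite cm_lift1 ?vd // (negPf ne) andbF subr0.
  apply: (@curve_coef _ _ (fun A => cm A (k, i, 0%N) (k, j, 0%N) = 0) N d) => //.
  - by rewrite cm0.
  - by move=> c u w eu ew; rewrite cmD cmZ eu ew mulr0 addr0.
  - by move=> t; case: (NH t) => g [_ ->]; rewrite rhoT1E cm_lift1 ?vd // (negPf ne) andbF.
pose b := cm P (k, i, 0%N) (k, i, 0%N).
pose Q := P *m cmx (L1 e2) *m \adj P; pose ep := cm Q s0 s1.
have b0 : b`_0 = 1 by rewrite cm_coef P0 cm1 ?vd // eqxx.
have b1 : b`_1 = cm (N 1%N) (k, i, 0%N) (k, i, 0%N) by rewrite cm_coef P1.
have rd01 A : cm A s0 s1 = rd A i0 i1 by rewrite mk2E.
have ep0 : ep`_0 = 1.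
  by rewrite cm_coef !cfm0M P0 adj0 mul1mx mulmx1 cfm0_cmx rd01 readL1 mk2E.
have ep1 : ep`_1 = Pe i0 i1 + dl.
  by rewrite cm_coef ePe' rd01 -L1Z // -L1D // readL1 !mxE /= mulr1.
(* On the image [b] is $g_{00}^k$ and [ep] is $\det P\cdot g_{00}^2$. Comparing linear terms
   expresses the diagonal entry of the velocity by the corner of $[X,e]$. *)
have : b ^+ 2 * \det P ^+ k = ep ^+ k.
  apply/eqP; rewrite -subr_eq0; apply/eqP/poly_all0 => t.
  rewrite hornerD hornerN hornerM !horner_exp !cm_horner evm_det !evmM evm_cmx evm_adj.
  case: (PH t) => g [Sg ->]; rewrite -/(cadj _ _) cadj_rho // rd01 readL1 mxE conj_e2_01 //.
  by rewrite cm_rho00 // -exprM mulnC exprM -exprMn mulrC subrr.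
move/(congr1 (fun p : {poly C} => p`_1)).
rewrite coef1M !coef1X // !coef0X b0 det0 !expr1n mul1r mulr1 ep1 -/dl b1 mulrDr.
move=> e1; have {e1} e := addrI _ (etrans e1 (addrC _ _)); apply/eqP; rewrite subr_eq0; apply/eqP.
have n2 : (2 : C) != 0 by rewrite pnatr_eq0.
have X11 : X i1 i1 = - X i0 i0 by apply/eqP; rewrite -addr_eq0 addrC -tr2E trX.
apply: (mulfI n2); rewrite e -Xe cm_lift1 ?vd // !eqxx /= drhoEE //= subn0.
by rewrite /lie !mxE !sum2 !mk2E X11; ring.
Qed.

Lemma leq_maxF k : k \in F -> (k <= \max_(l <- F) l)%N.
Proof. by move=> Fk; rewrite (big_rem k) //= leq_maxl. Qed.

(** [N i] carries binomial coefficients on the diagonal [i] places above the main one. The length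
    [(\max_(l <- F) l).+2] covers all degrees in [F] and exceeds 1. *)
Lemma unip_curve : exists (N : nat -> 'M[C]_n) d,
  [/\ (1 < d)%N, N 0%N = 1%:M, N 1%N = L1 e2 &
      forall t, rho1 (unip2 t) = \sum_(i < d) t ^+ i *: N i].
Proof.
exists (fun i => lift1 F m (fun k a c => 'C(c, a)%:R * (a + i == c)%N%:R)).
exists (\max_(l <- F) l).+2; split => // [||t].
- rewrite -lift1_1 //; apply: eq_lift1 => k a c _ _ _; rewrite addn0.
  by case: eqP => [->|]; rewrite ?binn ?mulr1 ?mulr0.
- apply: eq_lift1 => k a c _ _ lec; rewrite drhoE_e // addn1.
  by case: eqP => [<-|]; rewrite ?mulr0 // binSn.
apply/matrixP => p q; rewrite rhoT1E summxE mxE.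
have [Fk _ lea] := tixP p; have [_ _ lec] := tixP q.
have [e|ne] := eqVneq (tix p).1 (tix q).1; last first.
  by rewrite big1 // => i _; rewrite !mxE (negPf ne) mulr0.
rewrite -e in lec; move: Fk lea lec; set k := (tix p).1.1 => Fk lea lec.
have entE (i : 'I_(\max_(l <- F) l).+2) :
    (t ^+ i *: lift1 F m (fun k a c => 'C(c, a)%:R * (a + i == c)%N%:R)) p q =
    t ^+ i * ('C((tix q).2, (tix p).2)%:R * ((tix p).2 + i == (tix q).2)%N%:R).
  by rewrite !mxE e eqxx.
rewrite (eq_bigr _ (fun i _ => entE i)) rhoE_unip.
have [le|lt] := leqP (tix p).2 (tix q).2; last first.
  by rewrite bin_small // mulr0n big1 // => i _; rewrite mul0r mulr0.
have ltd : ((tix q).2 - (tix p).2 < (\max_(l <- F) l).+2)%N.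
  by rewrite ltnS (leq_trans (leq_subr _ _)) // (leq_trans lec) // leqW ?leq_maxF.
rewrite (bigD1 (Ordinal ltd)) //= big1 ?addr0 => [|i ne].
  by rewrite subnKC // eqxx mulr1 mulr_natr.
rewrite (_ : _ == _ = false) ?mulr0 //; apply/negbTE; apply: contra ne => /eqP ei.
by apply/eqP/val_inj; rewrite /= -ei addKn.
Qed.

Lemma low_curve : exists (N : nat -> 'M[C]_n) d,
  [/\ (1 < d)%N, N 0%N = 1%:M, N 1%N = L1 f2 &
      forall t, rho1 (low2 t) = \sum_(i < d) t ^+ i *: N i].
Proof.
exists (fun i => lift1 F m (fun k a c => 'C(k - c, i)%:R * (a == c + i)%N%:R)).
exists (\max_(l <- F) l).+2; split => // [||t].
- rewrite -lift1_1 //; apply: eq_lift1 => k a c _ _ _; rewrite addn0 bin0 mul1r.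
  by [].
- by apply: eq_lift1 => k a c _ _ lec; rewrite drhoE_f // addn1 bin1.
apply/matrixP => p q; rewrite rhoT1E summxE mxE.
have [Fk _ lea] := tixP p; have [_ _ lec] := tixP q.
have [e|ne] := eqVneq (tix p).1 (tix q).1; last first.
  by rewrite big1 // => i _; rewrite !mxE (negPf ne) mulr0.
rewrite -e in lec; move: Fk lea lec; set k := (tix p).1.1 => Fk lea lec.
have entE (i : 'I_(\max_(l <- F) l).+2) :
    (t ^+ i *: lift1 F m (fun k a c => 'C(k - c, i)%:R * (a == c + i)%N%:R)) p q =
    t ^+ i * ('C(k - (tix q).2, i)%:R * ((tix p).2 == (tix q).2 + i)%N%:R).
  by rewrite !mxE e eqxx -e.
rewrite (eq_bigr _ (fun i _ => entE i)) rhoE_low.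
have [le|lt] := leqP (tix q).2 (tix p).2; last first.
  rewrite big1 // => i _; rewrite ltn_eqF ?mulr0 //.
  by rewrite (leq_trans lt) // leq_addr.
have ltd : ((tix p).2 - (tix q).2 < (\max_(l <- F) l).+2)%N.
  by rewrite ltnS (leq_trans (leq_subr _ _)) // (leq_trans lea) // leqW ?leq_maxF.
rewrite (bigD1 (Ordinal ltd)) //= big1 ?addr0 => [|i ne].
  by rewrite subnKC // eqxx mulr1 mulr_natr.
rewrite (_ : _ == _ = false) ?mulr0 //; apply/negbTE; apply: contra ne => /eqP ei.
by apply/eqP/val_inj; rewrite /= ei addKn.
Qed.

Lemma SL2_idcomp r (rho : 'M[C]_2 -> 'M[C]_r) (G : 'M[C]_r -> Prop) :
  rho 1%:M = 1%:M -> (forall g h, rho (g *m h) = rho g *m rho h) ->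
  (forall g, SL2 g -> G (rho g)) -> forall g, SL2 g -> idcomp G (rho g).
Proof.
move=> r1 rM HG g Sg; split; first exact: HG.
have Iu c : idcomp G (rho (unip2 c)).
  apply: (@idcomp_oneparam _ _ G (fun c => rho (unip2 c))) => [|a b|a].
  - by rewrite unip2_0.
  - by rewrite unip2D.
  - exact/HG/SL2_unip.
have Il c : idcomp G (rho (low2 c)).
  apply: (@idcomp_oneparam _ _ G (fun c => rho (low2 c))) => [|a b|a].
  - by rewrite low2_0.
  - by rewrite low2D.
  - exact/HG/SL2_low.
move=> K cK gK KG fK; apply: (SL2_gen (P := fun g => K (rho g))) Sg.
- by move=> c; case: (Iu c) => _; apply.
- by move=> c; case: (Il c) => _; apply.
- by move=> g1 g2 Kg1 Kg2; rewrite rM //; case: gK => _ KM _; apply: KM.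
Qed.

Lemma Himg_idcomp (G : 'M[C]_n -> Prop) : (forall g, SL2 g -> G (rho1 g)) ->
  forall g, SL2 g -> idcomp G (rho1 g).
Proof. by apply: SL2_idcomp; [exact: rhoT1_1|move=> *; apply: rhoT1M]. Qed.

(** Conjugation by [A] turns the two unipotent curves into curves in the image of $H$ through 1,
    whose velocities are the conjugates of [L1 e2] and [L1 f2]. *)
Lemma Himg_norm_split A : A \in unitmx ->
  (forall g, SL2 g -> HimgV (A *m rho1 g *m invmx A)) ->
  exists2 h, SL2 h & forall X, \tr X = 0 ->
     rho1 (invmx h) *m A *m L1 X = L1 X *m (rho1 (invmx h) *m A).
Proof.
move=> uA nA; apply: L1_tr0_split => //.
  have [N [d [d1 N0 N1 NE]]] := unip_curve.
  have [|t|X trX] := @Himg_curve (fun i => A *m N i *m invmx A) d d1.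
  - by rewrite N0 mulmx1 mulmxV.
  - have := nA _ (SL2_unip t); rewrite NE mulmx_sumr mulmx_suml.
    by under eq_bigr => i _ do rewrite -scalemxAr -scalemxAl.
  by rewrite N1 => e; exists X; rewrite // -e mulmxKV.
have [N [d [d1 N0 N1 NE]]] := low_curve.
have [|t|X trX] := @Himg_curve (fun i => A *m N i *m invmx A) d d1.
- by rewrite N0 mulmx1 mulmxV.
- have := nA _ (SL2_low t); rewrite NE mulmx_sumr mulmx_suml.
  by under eq_bigr => i _ do rewrite -scalemxAr -scalemxAl.
by rewrite N1 => e; exists X; rewrite // -e mulmxKV.
Qed.

Lemma Himg_subgroup : mxsubgroup (@HimgV C F m).
Proof.
split.
- by exists 1%:M; rewrite rhoT1_1 //; split=> //; apply: SL2_1.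
- by move=> A B [g [Sg ->]] HB; apply: HimgM.
- move=> _ [g [Sg ->]]; exists (invmx g); split; first exact: SL2_V.
  by rewrite rhoT1_inv.
Qed.

End Image.

(** * Subgroups of SL_2 *)

Lemma finite_cover (T I : eqType) (L : seq I) (P : T -> Prop) (Q : T -> I -> Prop) :
  (forall x, P x -> exists2 i, i \in L & Q x i) ->
  (forall x y i, P x -> P y -> Q x i -> Q y i -> x = y) ->
  exists s : seq T, forall x, P x -> x \in s.
Proof.
move=> PL QI.
suff [s sP] : exists s : seq T, forall x i, P x -> i \in L -> Q x i -> x \in s.
  by exists s => x Px; have [i iL Qi] := PL x Px; apply: (sP x i).
elim: L {PL} => [|i L [s sP]]; first by exists [::].
have [[y [Py Qy]]|ny] := pselect (exists y, P y /\ Q y i).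
  exists (y :: s) => x i' Px; rewrite !inE => /orP[/eqP-> Qx|iL Qx].
    by rewrite (QI x y i) ?eqxx.
  by rewrite (sP x i') ?orbT.
exists s => x i' Px; rewrite inE => /orP[/eqP-> Qx|]; last exact: sP.
by case: ny; exists x.
Qed.

Fixpoint all_seqs (T : eqType) (L : seq T) r : seq (seq T) :=
  if r is r'.+1 then [seq x :: s | x <- L, s <- all_seqs L r'] else [:: [::]].

Lemma mem_all_seqs (T : eqType) (L : seq T) s : {subset s <= L} -> s \in all_seqs L (size s).
Proof.
elim: s => [|x s IHs] sL //=; apply/allpairsP; exists (x, s) => /=; split=> //.
  by apply: sL; rewrite mem_head.
by apply: IHs => y ys; apply: sL; rewrite inE ys orbT.
Qed.

Section FiniteSL2.
Variable C : numClosedFieldType.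
Variable S : 'M[C]_2 -> Prop.
Hypothesis SS : forall g, S g -> SL2 g.
Hypothesis SM : forall g h, S g -> S h -> S (g *m h).
Hypothesis SV : forall g, S g -> S (invmx g).

Lemma span_list : exists2 L : seq 'M[C]_2, (forall g, g \in L -> S g) &
  forall g, S g -> g \in <<L>>%VS.
Proof.
suff H d (L : seq 'M[C]_2) : (forall g, g \in L -> S g) ->
    (\dim {:'M[C]_2} - \dim <<L>> <= d)%N ->
    exists2 L : seq 'M[C]_2, (forall g, g \in L -> S g) &
      forall g, S g -> g \in <<L>>%VS.
  exact: (H _ [::] _ (leqnn _)).
elim: d L => [|d IHd] L LS dimL.
  exists L => // g _; have /eqP <- : fullv == <<L>>%VS; last exact: memvf.
  by rewrite eq_sym eqEdim subvf /= -subn_eq0 -leqn0.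
have [[g [Sg gL]]|nex] := pselect (exists g, S g /\ g \notin <<L>>%VS).
  apply: (IHd (g :: L)) => [h|]; first by rewrite inE => /orP[/eqP->|/LS].
  have lt : (\dim <<L>> < \dim <<g :: L>>)%N.
    rewrite ltn_neqAle dimvS ?andbT; last by rewrite span_cons addvSr.
    apply: contra gL => /eqP e; have : (<<L>> == <<g :: L>>)%VS.
      by rewrite eqEdim -e leqnn andbT span_cons addvSr.
    by move/eqP->; rewrite memv_span ?mem_head.
  by rewrite -ltnS (leq_trans _ dimL) // ltn_sub2l // (leq_trans lt) // dimvS ?subvf.
exists L => // g Sg; apply: contraT => gL; case: nex; by exists g.
Qed.

(** The traces against a family spanning [S] take finitely many values. If those of [g] and [h]
    agree, then $\operatorname{tr}(hg^{-1})=\operatorname{tr}(1)=2$, because $g^{-1}$ lies in the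
    span. *)
Lemma bounded_trace_finite (Th : seq C) : (forall g, S g -> \tr g \in Th) ->
  (forall g, S g -> \tr g = 2 -> g = 1%:M) ->
  exists s : seq 'M[C]_2, forall g, S g -> g \in s.
Proof.
move=> trTh tr2; have [L LS Lspan] := span_list.
apply: (@finite_cover _ _ (all_seqs Th (size L)) S
   (fun g ts => ts = [seq \tr (g *m s) | s <- L])) => [g Sg|g h ts Sg Sh ->].
  exists [seq \tr (g *m s) | s <- L] => //.
  rewrite -(size_map (fun s => \tr (g *m s)) L); apply: mem_all_seqs.
  by move=> _ /mapP[s sL ->]; apply: trTh; apply: SM => //; apply: LS.
move=> eqtr.
have trE x : x \in <<L>>%VS -> \tr (g *m x) = \tr (h *m x).
  move=> xL; rewrite (coord_span (X := in_tuple L) xL) !mulmx_sumr !raddf_sum /=.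
  apply: eq_bigr => i _; rewrite -!scalemxAr !mxtraceZ; congr (_ * _).
  have := congr1 (fun s => nth 0 s i) eqtr.
  by rewrite !(nth_map 0) // ltn_ord.
have := trE _ (Lspan _ (SV Sg)); rewrite mulmxV ?SL2_unit //; last exact: SS.
rewrite mxtrace1 => /esym/tr2 => e.
by rewrite -[LHS]mul1mx -e ?mulmxKV ?SL2_unit //; [exact: SS|exact/SM/SV].
Qed.

Lemma unity_roots_list j : (0 < j)%N ->
  exists s : seq C, forall t, t ^+ j = 1 -> t \in s.
Proof.
move=> j0; have [s sE] := closed_field_poly_normal ('X^j - 1 : {poly C}).
exists s => t tj; have : root ('X^j - 1) t by rewrite /root !hornerE tj subrr.
rewrite sE rootZ ?root_prod_XsubC // lead_coef_eq0 -size_poly_eq0 size_XnsubC //.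
Qed.

(* Without the first two alternatives the traces of the elements of S take
   finitely many values and only 1 has trace 2; then g is determined by the traces
   of the g s_i, for a family s_i of elements of S with the same span as S. *)
Lemma SL2_group_trichotomy K : (0 < K)%N ->
  [\/ exists g h t, [/\ S g, SL2 h, g *m h = h *m diag2 t, t != 0 &
        forall j, (0 < j <= K)%N -> t ^+ (2 * j) != 1],
      exists g h t, [/\ S g, SL2 h, t ^+ 2 = 1 & g *m h = h *m (t *: unip2 1)]
    | exists s : seq 'M[C]_2, forall g, S g -> g \in s].
Proof.
move=> K0.
have [?|nT] := pselect (exists g h t, [/\ S g, SL2 h, g *m h = h *m diag2 t, t != 0 &
        forall j, (0 < j <= K)%N -> t ^+ (2 * j) != 1]); first by constructor 1.
have [?|nU] := pselect (exists g h t,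
  [/\ S g, SL2 h, t ^+ 2 = 1 & g *m h = h *m (t *: unip2 1)]); first by constructor 2.
constructor 3.
have rP0 j : exists s : seq C, (0 < j)%N -> forall t, t ^+ j = 1 -> t \in s.
  by case: (posnP j) => [->|/unity_roots_list [s sP]]; [exists [::]|exists s].
have [r rP] := choice rP0.
(* Failing the first alternative, every diagonalizable element of [S] has an eigenvalue [t] with
   $t^{2j}=1$ for some $0<j\le K$, and trace $t+t^{-1}$. *)
pose Th := [seq t + t^-1 | t <- flatten [seq r (2 * j)%N | j <- iota 1 K]].
have memTh t j : (0 < j <= K)%N -> t ^+ (2 * j) = 1 -> t + t^-1 \in Th.
  move=> /andP[j0 jK] tj; apply: (map_f (fun t => t + t^-1)).
  apply/flattenP; exists (r (2 * j)%N).
    by apply: (map_f (fun j => r (2 * j)%N)); rewrite mem_iota j0 add1n ltnS.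
  by apply: rP => //; rewrite muln_gt0.
have trdiag (g h : 'M[C]_2) (t : C) : SL2 h -> g *m h = h *m diag2 t -> \tr g = t + t^-1.
  move=> Sh e; rewrite -[g](mulmxK (SL2_unit Sh)) e mxtrace_mulC mulmxA.
  by rewrite mulVmx ?SL2_unit // mul1mx diag2E tr2E !mk2E.
apply: (bounded_trace_finite (Th := Th)) => g Sg.
  have [h Sh [[t [t0 t2 e]]|[t t2 e]|[t t2 e]]] := SL2_normal_form (SS Sg).
  - rewrite (trdiag _ _ _ Sh e).
    have [[j [jK tj]]|nj] := pselect (exists j, (0 < j <= K)%N /\ t ^+ (2 * j) = 1).
      exact: memTh tj.
    case: nT; exists g, h, t; split=> // j jK; apply/eqP => tj; apply: nj.
    by exists j.
  - have -> : \tr g = t + t^-1.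
      rewrite e mxtrace_scalar mulr2n; congr (_ + _).
      have t0 : t != 0 by apply: contra_eq_neq t2 => ->; rewrite expr0n eq_sym oner_neq0.
      by apply: (mulfI t0); rewrite -expr2 t2 divff.
    by apply: (memTh _ 1%N); rewrite ?K0 ?muln1.
  - by case: nU; exists g, h, t.
have n2 : (2 : C) != 0 by rewrite pnatr_eq0.
have [h Sh [[t [t0 t2 e]]|[t t2 e]|[t t2 e]]] := SL2_normal_form (SS Sg).
- rewrite (trdiag _ _ _ Sh e) => tr; have t1 : t = 1.
    apply/eqP; rewrite -subr_eq0; suff: (t - 1) ^+ 2 == 0 by rewrite expf_eq0.
    apply/eqP.
    transitivity (t * (t + t^-1 - 2)); first by field.
    by rewrite tr subrr mulr0.
  by rewrite t1 expr1n eqxx in t2.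
- rewrite e mxtrace_scalar => tr; congr (_%:M).
  by apply: (mulfI n2); rewrite mulr1 mulr_natl.
- by case: nU; exists g, h, t.
Qed.
End FiniteSL2.

(** * Generic vectors *)

Section Generic.
Variable C : numClosedFieldType.
Variables (F : seq nat) (m : nat -> nat).
Hypothesis uF : uniq F.
Hypothesis F0 : F != [::].
Hypothesis Fpos : forall k, k \in F -> (0 < k)%N.
Hypothesis mpos : forall k, k \in F -> (0 < m k)%N.
Local Notation n := (dimT F m).
Local Notation L1 := (@L1 C F m).
Local Notation rho1 := (@rhoT1 C F m).
Implicit Types (k j a : nat) (g h X Y : 'M[C]_2) (A B z : 'M[C]_n) (v w : 'cV[C]_n).

Lemma generic_fun r v (A : 'M[C]_(r, n)) : generic v ->
  (forall g, SL2 g -> A *m (rho1 g *m v) = 0) -> A = 0.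
Proof.
case=> s [W [orbW rkW]] A0.
have AW : A *m W = 0.
  apply/matrixP => i j; have [g [Sg e]] := orbW j.
  have /matrixP/(_ i ord0) := A0 g Sg; rewrite -e => E.
  rewrite [RHS]mxE; transitivity ((A *m col j W) i ord0); last by rewrite E mxE.
  by rewrite !mxE; apply: eq_bigr => l _; rewrite mxE.
have fW : row_free W by rewrite /row_free rkW.
by apply: (row_free_inj fW); rewrite AW mul0mx.
Qed.

Lemma generic_comm_eq v z z' : generic v ->
  (forall g, SL2 g -> z *m rho1 g = rho1 g *m z) ->
  (forall g, SL2 g -> z' *m rho1 g = rho1 g *m z') -> z *m v = z' *m v -> z = z'.
Proof.
move=> gv cz cz' e; apply/eqP; rewrite -subr_eq0; apply/eqP.
apply: (generic_fun gv) => g Sg.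
by rewrite mulmxA mulmxBl cz // cz' // -mulmxBr -mulmxA mulmxBl e subrr mulmx0.
Qed.

Lemma orbitH_rho v g w : SL2 g -> orbitH v w <-> orbitH v (rho1 g *m w).
Proof.
move=> Sg; split=> [[h [Sh ->]]|[h [Sh e]]].
  by exists (g *m h); rewrite rhoT1M // mulmxA; split=> //; apply: SL2_M.
exists (invmx g *m h); split; first exact/SL2_M/Sh/SL2_V.
by rewrite rhoT1M // -mulmxA -e mulmxA rhoT1K // mul1mx.
Qed.

Lemma generic_rho v g : SL2 g -> generic v -> generic (rho1 g *m v).
Proof.
move=> Sg [r [W [orbW rkW]]]; exists r, W; split=> // j.
have [h [Sh e]] := orbW j; exists (h *m invmx g); split; first exact/SL2_M/SL2_V.
by rewrite mulmxA -rhoT1M // mulmxKV ?SL2_unit.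
Qed.

Lemma stabOrb_rho v g : SL2 g -> stabOrb v (rho1 g).
Proof. by move=> Sg; split=> [|w]; [apply: rhoT1_unit | apply: orbitH_rho]. Qed.

Lemma stabOrb_group v : mxsubgroup (stabOrb v).
Proof.
split.
- by split=> [|w]; rewrite ?unitmx1 ?mul1mx.
- move=> A B [uA sA] [uB sB]; split=> [|w]; first by rewrite unitmx_mul uA.
  by rewrite -mulmxA -sA; apply: sB.
- move=> A [uA sA]; split=> [|w]; first by rewrite unitmx_inv.
  by rewrite [X in _ <-> X]sA mulKVmx.
Qed.

Lemma normGH_rho v g : SL2 g -> normGH v (rho1 g).
Proof.
move=> Sg; split; first by apply: Himg_idcomp => // h Sh; apply: stabOrb_rho.
move=> B; rewrite rhoT1_inv //; split=> [[h [Sh ->]]|[h [Sh e]]].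
  exists (g *m h *m invmx g); rewrite !rhoT1M //; split=> //.
  exact: (SL2_M (SL2_M Sg Sh) (SL2_V Sg)).
exists (invmx g *m h *m g); split; first exact: (SL2_M (SL2_M (SL2_V Sg) Sh) Sg).
rewrite !rhoT1M // -e !mulmxA rhoT1K // mul1mx -mulmxA rhoT1K //.
by rewrite mulmx1.
Qed.

(** As [z] commutes with $H$, moving [v] within its orbit already means preserving the orbit. *)
Definition stabC v z := centH z /\ exists2 g, SL2 g & z *m v = rho1 g *m v.

Lemma normGH_split v A : normGH v A ->
  exists2 h, SL2 h & exists2 z, stabC v z & A = rho1 h *m z.
Proof.
move=> [[[uA sA] _] nA].
have [|h Sh zL] := Himg_norm_split uF F0 Fpos mpos uA.
  by move=> g Sg; case: (nA (rho1 g)) => + _; apply; exists g.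
exists h => //; exists (rho1 (invmx h) *m A); last first.
  by rewrite mulmxA rhoT1V // mul1mx.
split; first split.
- by rewrite unitmx_mul uA andbT; apply/rhoT1_unit/SL2_V.
- move=> g _; rewrite (L1_schur uF (zL _ (tr_e2 C)) (zL _ (tr_f2 C))).
  exact: lift2_comm_rho.
have /sA [g [Sg e]] : orbitH v v by exists 1%:M; rewrite rhoT1_1 // mul1mx; split=> //; apply: SL2_1.
exists (invmx h *m g); first exact/SL2_M/Sg/SL2_V.
by rewrite rhoT1M // -!mulmxA e.
Qed.

(** Normalizer elements [rho1 h *m z] with the same [z] differ by an element of $H$. With finitely
    many [z], the closed image of $H$ has finite index and contains the identity component. *)
Lemma connNormGH_finite v (L : seq 'M[C]_n) : (forall z, stabC v z -> z \in L) ->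
  forall A, connNormGH v A <-> HimgV A.
Proof.
move=> ZL A; split; last first.
  by case=> g [Sg ->]; apply: Himg_idcomp => // h Sh; apply: normGH_rho.
move=> [nA]; apply; first exact: Himg_closed.
- exact: Himg_subgroup.
- by move=> _ [g [Sg ->]]; apply: normGH_rho.
apply: (finite_index_inv (L := L)
   (Q := fun A z => stabC v z /\ exists2 h, SL2 h & A = rho1 h *m z)).
  by move=> B /normGH_split [h Sh [z Zz ->]]; exists z; [apply: ZL | split=> //; exists h].
move=> A1 A2 z _ _ [[[uz cz] _] [h1 Sh1 e1]] [_ [h2 Sh2 e2]].
exists (invmx h1 *m h2); split; first exact/SL2_M/Sh2/SL2_V.
have uA1 : A1 \in unitmx by rewrite e1 unitmx_mul uz rhoT1_unit.
suff -> : A2 = A1 *m rho1 (invmx h1 *m h2) by rewrite mulKmx.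
rewrite e1 -mulmxA cz; last exact/SL2_M/Sh2/SL2_V.
by rewrite mulmxA -rhoT1M // mulmxA mulmxV ?SL2_unit // mul1mx e2.
Qed.

(** The counterpart of [stabC] in $\mathrm{SL}_2$; passing from [g] to [z] reverses the order of
    products. *)
Definition stabS v g := SL2 g /\ exists2 z, centH z & z *m v = rho1 g *m v.

(** By genericity [z] is determined by [z *m v], hence by [g]. *)
Lemma stabS_finite v (s : seq 'M[C]_2) : generic v -> (forall g, stabS v g -> g \in s) ->
  exists L : seq 'M[C]_n, forall z, stabC v z -> z \in L.
Proof.
move=> gv Ss; apply: (@finite_cover _ _ s (stabC v)
   (fun z g => z *m v = rho1 g *m v)) => [z [cz [g Sg e]]|z z' g [[_ cz] _] [[_ cz'] _] e e'].
  by exists g => //; apply: Ss; split=> //; exists z.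
by apply: (generic_comm_eq gv) => //; rewrite e e'.
Qed.

Lemma stabS_group v : [/\ forall g, stabS v g -> SL2 g, stabS v 1%:M,
  forall g h, stabS v g -> stabS v h -> stabS v (g *m h)
  & forall g, stabS v g -> stabS v (invmx g)].
Proof.
split.
- by move=> g [].
- split; first exact: SL2_1.
  exists 1%:M; last by rewrite rhoT1_1.
  by split=> [|g _]; rewrite ?unitmx1 // mulmx1 mul1mx.
- move=> g h [Sg [z [uz cz] ez]] [Sh [z' [uz' cz'] ez']]; split; first exact: SL2_M.
  exists (z' *m z).
    split=> [|g' Sg']; first by rewrite unitmx_mul uz'.
    by rewrite -mulmxA cz // mulmxA cz' // mulmxA.
  by rewrite -mulmxA ez mulmxA cz' // -mulmxA ez' mulmxA rhoT1M.
- move=> g [Sg [z [uz cz] ez]]; split; first exact: SL2_V.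
  have cV g' : SL2 g' -> invmx z *m rho1 g' = rho1 g' *m invmx z.
    by move=> Sg'; apply/esym/intertwineV => //; rewrite cz.
  exists (invmx z); first by split=> //; rewrite unitmx_inv.
  rewrite -[RHS](mulKmx uz) (mulmxA z) cz; last exact: SL2_V.
  by rewrite -(mulmxA _ z) ez (mulmxA _ (rho1 g)) rhoT1K // mul1mx.
Qed.

End Generic.

(** * Row spaces stable under a diagonal or a unipotent matrix *)

Section Support.
Variable C : numClosedFieldType.

Definition nat_entry r (A : 'M[C]_r) (i j : nat) : C :=
  if insub i is Some i' then if insub j is Some j' then A i' j' else 0 else 0.
Lemma nat_entryE r (A : 'M[C]_r) (i j : 'I_r) : nat_entry A i j = A i j.
Proof. by rewrite /nat_entry !valK. Qed.

Variables (r s : nat) (W : 'M[C]_(r, s)).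

Definition supp : {set 'I_s} := [set a | [exists j, W j a != 0]].

Lemma supp_row j a : W j a != 0 -> a \in supp.
Proof. by move=> ne; rewrite inE; apply/existsP; exists j. Qed.

(** The row space is then the coordinate subspace on the support, and its dimension is [r]. *)
Lemma card_supp : row_free W ->
  (forall a, a \in supp -> (delta_mx (ord0 : 'I_1) a <= W)%MS) -> #|supp| = r.
Proof.
move=> /eqP rkW dW.
pose E : 'M[C]_(#|supp|, s) := \matrix_(i, b) (enum_val i == b)%:R.
have EE : E *m E^T = 1%:M.
  apply/matrixP => i j; rewrite !mxE (bigD1 (enum_val i)) //= !mxE eqxx mul1r.
  rewrite big1 ?addr0 => [|b ne]; last by rewrite !mxE eq_sym (negPf ne) mul0r.
  by rewrite (inj_eq enum_val_inj) eq_sym.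
have rkE : \rank E = #|supp|.
  by apply/eqP; apply/row_freeP; exists E^T.
have EW : (E <= W)%MS.
  apply/row_subP => i; have -> : row i E = delta_mx ord0 (enum_val i).
    by apply/rowP => b; rewrite !mxE eqxx /= eq_sym.
  exact/dW/enum_valP.
have WE : (W <= E)%MS.
  apply/submxP; exists (\matrix_(j, i) W j (enum_val i)).
  apply/matrixP => j a; rewrite mxE.
  have [aS|aS] := boolP (a \in supp).
    rewrite (bigD1 (enum_rank_in aS a)) //= !mxE enum_rankK_in // eqxx mulr1.
    rewrite big1 ?addr0 // => i ne; rewrite !mxE (_ : _ == a = false) ?mulr0 //.
    apply: contraNF ne => /eqP e; apply/eqP/enum_val_inj.
    by rewrite enum_rankK_in.
  rewrite big1 => [|i _].
    by apply/eqP; apply: contraNT aS; apply: supp_row.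
  rewrite !mxE (_ : _ == a = false) ?mulr0 //.
  by apply: contraNF aS => /eqP <-; apply: enum_valP.
by apply/eqP; rewrite eqn_leq -{1}rkE -{1}rkW -{2}rkE -{2}rkW !mxrankS.
Qed.

(** Interpolation: multiplying a row by $\prod_{b\ne a}(d-d_b)$ isolates coordinate [a], and each
    factor keeps it in the row space. *)
Lemma diag_support (d : 'rV[C]_s) : injective (d ord0) -> (W *m diag_mx d <= W)%MS ->
  forall a, a \in supp -> (delta_mx (ord0 : 'I_1) a <= W)%MS.
Proof.
move=> inj_d WD a; rewrite inE => /existsP [j Wja].
have sub (bs : seq 'I_s) :
    ((\row_c (W j c * \prod_(b <- bs) (d ord0 c - d ord0 b)))%R <= W)%MS.
  elim: bs => [|b bs IHbs].
    rewrite (_ : \row_c _ = row j W) ?row_sub //.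
    by apply/rowP => c; rewrite !mxE big_nil mulr1.
  set u := \row_c _ in IHbs.
  rewrite (_ : \row_c _ = u *m diag_mx d - d ord0 b *: u).
    rewrite addmx_sub // -?scaleNr ?scalemx_sub //.
    exact: submx_trans (submxMr _ IHbs) WD.
  by apply/rowP => c; rewrite mul_mx_diag !mxE big_cons; ring.
have := sub [seq b <- enum 'I_s | b != a]; set u := \row_c _ => uW.
pose x := W j a * \prod_(b <- enum 'I_s | b != a) (d ord0 a - d ord0 b).
have x0 : x != 0.
  rewrite mulf_neq0 // prodf_seq_neq0; apply/allP => b _; apply/implyP => ne.
  by rewrite subr_eq0; apply: contra ne => /eqP /inj_d ->.
have -> : delta_mx (ord0 : 'I_1) a = x^-1 *: u.
  apply/rowP => c; rewrite !mxE eqxx /= big_filter.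
  have [->|ne] := eqVneq c a; first by rewrite -/x mulVf.
  suff -> : \prod_(b <- enum 'I_s | b != a) (d ord0 c - d ord0 b) = 0 by rewrite !mulr0.
  apply/eqP; rewrite prodf_seq_eq0; apply/hasP; exists c; first by rewrite mem_enum.
  by rewrite ne subrr eqxx.
exact: scalemx_sub.
Qed.

(** If [u] ends at coordinate $p+1$, then $uN-u$ ends at $p$ with value $(p+1)u_{p+1}\ne0$. By
    induction the coordinate vectors up to $p$ are in the row space; subtracting them from [u] gives
    the next one. *)
Lemma unip_support (N : 'M[C]_s) : (forall c a, N c a = 'C(c, a)%:R) ->
  (W *m N <= W)%MS -> forall p (u : 'rV[C]_s), (u <= W)%MS ->
  (forall a : 'I_s, (p < a)%N -> u ord0 a = 0) ->
  (forall a : 'I_s, (a = p :> nat) -> u ord0 a != 0) ->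
  forall a : 'I_s, (p < s)%N -> (a <= p)%N -> (delta_mx (ord0 : 'I_1) a <= W)%MS.
Proof.
move=> NE WN; elim=> [|p IHp] u uW u0 up a ltp; rewrite leq_eqVlt.
  rewrite ltn0 orbF => /eqP a0.
  have -> : delta_mx (ord0 : 'I_1) a = (u ord0 a)^-1 *: u.
    apply/rowP => c; rewrite !mxE eqxx /=.
    have [->|ne] := eqVneq c a; first by rewrite mulVf // up.
    rewrite (u0 c) ?mulr0 // lt0n; apply: contra ne => /eqP c0; apply/eqP/val_inj.
    by rewrite /= c0 a0.
  exact: scalemx_sub.
have IH (b : 'I_s) : (b <= p)%N -> (delta_mx (ord0 : 'I_1) b <= W)%MS.
  move=> lebp; apply: (IHp (u *m N - u)) => // [||c cp|]; last exact: ltnW.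
  - by rewrite addmx_sub ?eqmx_opp // (submx_trans (submxMr _ uW)).
  - move=> c pc; rewrite !mxE (bigD1 c) //= NE binn mulr1 big1 ?addr0 ?subrr //.
    move=> b' ne; rewrite NE; have [lt|le] := ltnP p.+1 b'; first by rewrite u0 ?mul0r.
    rewrite bin_small ?mulr0 // ltn_neqAle ne /=; apply: leq_trans le _ => //.
  - rewrite !mxE (bigD1 c) //= NE binn mulr1 addrC addKr.
    rewrite (bigD1 (Ordinal ltp)) //=; last by rewrite -val_eqE /= cp gtn_eqF.
    rewrite NE /= cp binSn big1 ?addr0 => [|b' /andP[ne1 ne2]].
      by rewrite mulf_neq0 ?pnatr_eq0 // up.
    rewrite NE; have [lt|le] := ltnP p.+1 b'; first by rewrite u0 ?mul0r.
    rewrite bin_small ?mulr0 // cp ltn_neqAle -{1}cp ne1 /= -ltnS ltn_neqAle le andbT.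
    by rewrite -val_eqE in ne2.
case/orP => [/eqP ap|]; last by rewrite ltnS; apply: IH.
have -> : delta_mx (ord0 : 'I_1) a = (u ord0 a)^-1 *:
    (u - \sum_(b : 'I_s | (b <= p)%N) u ord0 b *: delta_mx (ord0 : 'I_1) b).
  apply/rowP => c; rewrite !mxE eqxx /= summxE.
  have [le|lt] := leqP c p.
    rewrite (bigD1 c) //= big1 ?addr0 => [|b /andP[_ ne]].
      by rewrite !mxE !eqxx mulr1 subrr mulr0 -val_eqE /= ap ltn_eqF.
    by rewrite !mxE [c == b]eq_sym (negPf ne) andbF mulr0.
  rewrite big1 ?subr0 => [|b leb]; last first.
    rewrite !mxE (_ : c == b = false) ?andbF ?mulr0 //.
    by apply/negbTE; rewrite -val_eqE /= gtn_eqF // (leq_ltn_trans leb).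
  have [->|ne] := eqVneq c a; first by rewrite mulVf // up.
  by rewrite (u0 c) ?mulr0 // ltn_neqAle lt andbT -ap eq_sym val_eqE.
rewrite scalemx_sub // addmx_sub ?eqmx_opp // summx_sub // => b leb.
by rewrite scalemx_sub // IH.
Qed.
End Support.

(** * Normal forms of a generic vector *)

Section NormalForm.
Variable C : numClosedFieldType.
Variables (F : seq nat) (m : nat -> nat).
Hypothesis uF : uniq F.
Local Notation n := (dimT F m).
Local Notation L1 := (@L1 C F m).
Local Notation rho1 := (@rhoT1 C F m).
Implicit Types (k j a : nat) (g h X Y : 'M[C]_2) (A B z : 'M[C]_n) (v w : 'cV[C]_n).

Lemma comm_rho_L1 z : (forall g, SL2 g -> z *m rho1 g = rho1 g *m z) ->
  z *m L1 e2 = L1 e2 *m z /\ z *m L1 f2 = L1 f2 *m z.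
Proof.
move=> cz; pose P A := z *m A = A *m z.
have P0 : P 0 by rewrite /P mulmx0 mul0mx.
have PL (c : C) (u w : 'M_n) : P u -> P w -> P (c *: u + w).
  by move=> Pu Pw; rewrite /P mulmxDr mulmxDl -scalemxAr -scalemxAl Pu Pw.
split.
  have [N [d [d1 _ <- NE]]] := unip_curve C m uF.
  by apply: (curve_coef (P := P)) d1 => // t; rewrite -NE; apply/cz/SL2_unip.
have [N [d [d1 _ <- NE]]] := low_curve C m uF.
by apply: (curve_coef (P := P)) d1 => // t; rewrite -NE; apply/cz/SL2_low.
Qed.

Lemma centH_lift2 z : (forall g, SL2 g -> z *m rho1 g = rho1 g *m z) ->
  z = lift2 F m (fun k i j => cm z (k, i, 0%N) (k, j, 0%N)).
Proof. by move/comm_rho_L1 => [ze zf]; apply: L1_schur. Qed.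

(** A linear relation among the components persists along the orbit by equivariance. Read at the
    coefficient of $x^k$ it is a linear functional on $V$ vanishing on the orbit, hence zero. *)
Lemma comp_indep v k (x : nat -> C) : generic v -> k \in F ->
  (forall a, (a <= k)%N -> \sum_(j < m k) x j * cf v (k, j : nat, a) = 0) ->
  forall j, (j < m k)%N -> x j = 0.
Proof.
move=> gv Fk x0 j ltj.
pose A : 'M[C]_(1, n) := \row_p (let t := tix p in
  if (t.1.1 == k) && (t.2 == 0%N) then x t.1.2 else 0).
have AE u : (A *m u) ord0 ord0 = \sum_(j < m k) x j * cf u (k, j : nat, 0%N).
  rewrite mxE -(collapse2 _ uF (fun j => x j * cf u (k, j, 0%N)) Fk (leq0n k)) -sum_tix.
  apply: eq_bigr => p _; rewrite mxE -cf_tix //.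
  by case: (tix p) => [[k' j'] a'] /=; case: ifP => [/andP[/eqP-> /eqP->]|]; rewrite ?mul0r.
have A0 : A = 0.
  apply: (generic_fun gv) => g _; apply/matrixP => i1 i2; rewrite !ord1 AE mxE.
  transitivity (\sum_(j < m k) \sum_(c < k.+1) rhoE k g 0%N c *
      (x j * cf v (k, j : nat, c : nat))).
    apply: eq_bigr => i _.
    have vd : (k, i : nat, 0%N) \in tidx F m by rewrite mem_tidx ?Fk ?ltn_ord.
    rewrite rhoT1E cf_lift1 // mulr_sumr.
    by apply: eq_bigr => c _; ring.
  rewrite exchange_big big1 // => c _ /=.
  by rewrite -mulr_sumr x0 ?mulr0 // -ltnS.
have [p pE] : exists p : 'I_n, tix p = (k, j, 0%N).
  by apply: tix_surj; rewrite mem_tidx // Fk ltj.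
by have := congr1 (fun M : 'M_(1, n) => M ord0 p) A0; rewrite !mxE pE /= !eqxx.
Qed.

(** Its row space is the span in $R_k$ of the components of [v], on which the elements of [stabS v]
    act. *)
Definition comp_mx v k : 'M[C]_(m k, k.+1) := \matrix_(j, a) cf v (k, j : nat, a : nat).

Lemma comp_mx_free v k : generic v -> k \in F -> row_free (comp_mx v k).
Proof.
move=> gv Fk; apply: inj_row_free => u u0; apply/rowP => j; rewrite mxE.
pose x i := if insub i is Some i' then u ord0 i' else 0 : C.
have xE (i : 'I_(m k)) : x i = u ord0 i by rewrite /x valK.
rewrite -xE; apply: (comp_indep gv Fk) => // a lea.
have /rowP/(_ (Ordinal (lea : a < k.+1)%N)) := u0; rewrite !mxE => E; rewrite -[RHS]E.
by apply: eq_bigr => i _; rewrite xE mxE.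
Qed.

(** By Schur's lemma [z] only mixes the copies, so [D] sends each component to a combination of
    components. *)
Lemma comp_mx_stable v k z D : (forall g, SL2 g -> z *m rho1 g = rho1 g *m z) ->
  k \in F -> z *m v = rho1 D *m v ->
  (comp_mx v k *m (rhoK k D)^T <= comp_mx v k)%MS.
Proof.
move=> cz Fk e; have zS := centH_lift2 cz.
apply/submxP; exists (\matrix_(i, j) cm z (k, i : nat, 0%N) (k, j : nat, 0%N)).
apply/matrixP => j a; rewrite !mxE.
have vd : (k, j : nat, a : nat) \in tidx F m by rewrite mem_tidx ?Fk ?ltn_ord //= -ltnS.
transitivity (cf (rho1 D *m v) (k, j : nat, a : nat)).
  by rewrite rhoT1E cf_lift1 //; apply: eq_bigr => c _; rewrite !mxE mulrC.
rewrite -e {1}zS cf_lift2 //.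
by apply: eq_bigr => i _; rewrite !mxE.
Qed.

(** [I k] lists [m k] coordinates that carry all components. The square matrix [B k] of coefficients
    there is invertible by independence; its inverse followed by the scalings [c k j] is the change
    of basis. *)
Lemma normal_form v (I : nat -> seq nat) (c : nat -> nat -> C) : generic v ->
  (forall k, k \in F -> [/\ uniq (I k), size (I k) = m k,
     (forall a, a \in I k -> (a <= k)%N) &
     forall j a, (j < m k)%N -> (a <= k)%N -> cf v (k, j, a) != 0 -> a \in I k]) ->
  (forall k j, k \in F -> (j < m k)%N -> c k j != 0) ->
  exists2 s, centH s & forall k j a, k \in F -> (j < m k)%N -> (a <= k)%N ->
    cf (s *m v) (k, j, a) = c k j * (a == nth 0%N (I k) j)%:R.
Proof.
move=> gv IP c0.
pose B k : 'M[C]_(m k) := \matrix_(j, i) cf v (k, j : nat, nth 0%N (I k) i).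
have uB k : k \in F -> B k \in unitmx.
  move=> Fk; rewrite -row_free_unit; apply: inj_row_free => u u0.
  have [uI sI Ik Isupp] := IP k Fk.
  apply/rowP => j; rewrite mxE.
  pose x i := if insub i is Some i' then u ord0 i' else 0 : C.
  have xE (i : 'I_(m k)) : x i = u ord0 i by rewrite /x valK.
  rewrite -xE; apply: (comp_indep gv Fk) => // a lea.
  have [aI|aI] := boolP (a \in I k); last first.
    rewrite big1 // => i _; rewrite (_ : cf v _ = 0) ?mulr0 //.
    by apply/eqP; apply: contraNT aI; apply: Isupp.
  have lt : (index a (I k) < m k)%N by rewrite -sI index_mem.
  have /rowP/(_ (Ordinal lt)) := u0; rewrite !mxE => E; rewrite -[RHS]E.
  by apply: eq_bigr => i _; rewrite xE mxE nth_index.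
pose S k i j := c k i * nat_entry (invmx (B k)) i j.
pose S' k i j := nat_entry (B k) i j / c k j.
have SS' : lift2 F m S *m lift2 F m S' = 1%:M.
  rewrite lift2M // -lift2_1 //; apply: eq_lift2 => k i j Fk lti ltj.
  have := mulVmx (uB k Fk) => /matrixP/(_ (Ordinal lti) (Ordinal ltj)).
  rewrite !mxE => e.
  transitivity (c k i / c k j * \sum_(l < m k) (invmx (B k)) (Ordinal lti) l * B k l (Ordinal ltj)).
    rewrite mulr_sumr; apply: eq_bigr => l _; rewrite /S /S'.
    rewrite -(nat_entryE (invmx _)) -(nat_entryE (B k)) /=; ring.
  rewrite e -val_eqE /=; case: eqP => [<-|]; rewrite ?mulr0 // mulr1 divff //.
  exact: c0.
exists (lift2 F m S).
  split; first by case: (mulmx1_unit SS').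
  by move=> g _; apply: lift2_comm_rho.
move=> k j a Fk ltj lea; rewrite cf_lift2; [|done|by rewrite mem_tidx // Fk ltj].
have [uI sI Ik Isupp] := IP k Fk.
have [aI|aI] := boolP (a \in I k); last first.
  rewrite big1 => [|i _].
    rewrite (_ : a == _ = false) ?mulr0 //; apply: contraNF aI => /eqP ->.
    by apply: mem_nth; rewrite sI.
  rewrite (_ : cf v _ = 0) ?mulr0 //.
  by apply/eqP; apply: contraNT aI; apply: Isupp.
have lt : (index a (I k) < m k)%N by rewrite -sI index_mem.
have := mulVmx (uB k Fk) => /matrixP/(_ (Ordinal ltj) (Ordinal lt)).
rewrite !mxE => e.
transitivity (c k j * \sum_(l < m k) (invmx (B k)) (Ordinal ltj) l * B k l (Ordinal lt)).
  rewrite mulr_sumr; apply: eq_bigr => l _; rewrite /S -(nat_entryE (invmx _)) /=.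
  by rewrite !mxE /= nth_index // mulrA.
rewrite e -val_eqE /=; congr (_ * _%:R); congr nat_of_bool.
by rewrite -{2}(nth_index 0%N aI) nth_uniq ?sI // eq_sym.
Qed.
End NormalForm.

Section HighestWeight.
Variable C : numClosedFieldType.

(* Coefficientwise form of ((Y + c) - (X + c))^M = (Y - X)^M. *)
Lemma binomial_shift (c : C) M a b :
  \sum_(i < M.+1) ((c%:P + 'X) ^+ i)`_a * ((c%:P + 'X) ^+ (M - i))`_b
      * ((-1) ^+ i *+ 'C(M, i)) =
  ((-1) ^+ a *+ 'C(M, a)) * (a + b == M)%N%:R :> C.
Proof.
(* The inner variable is $X$, the outer one $Y$: [p%:P] is $X+c$ and [q] is $Y+c$. *)
pose p : {poly C} := c%:P + 'X; pose q : {poly {poly C}} := map_poly polyC p.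
have qE : q = c%:P%:P + 'X by rewrite /q /p rmorphD /= map_polyC map_polyX.
have key i j : (q ^+ j * p%:P ^+ i)`_b`_a = (p ^+ i)`_a * (p ^+ j)`_b.
  have -> : q ^+ j = map_poly polyC (p ^+ j) by rewrite rmorphXn.
  have -> : p%:P ^+ i = (p ^+ i)%:P by rewrite rmorphXn.
  by rewrite coefMC coef_map /= coefCM mulrC.
have key' i j : ('X ^+ j * ('X%:P) ^+ i : {poly {poly C}})`_b`_a
    = ((i == a) && (j == b))%:R.
  have -> : ('X%:P) ^+ i = ('X^i)%:P :> {poly {poly C}} by rewrite rmorphXn.
  rewrite coefMC coefXn eq_sym andbC; case: (j == b); last by rewrite mul0r coef0.
  by rewrite mul1r coefXn eq_sym.
have E : (q - p%:P) ^+ M = ('X - 'X%:P) ^+ M.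
  by rewrite qE /p rmorphD /= opprD addrACA subrr add0r.
have /(congr1 (fun r : {poly {poly C}} => r`_b`_a)) := E.
rewrite !exprBn !coef_sum => e.
transitivity (\sum_(i < M.+1) ((-1) ^+ i * q ^+ (M - i) * p%:P ^+ i *+ 'C(M, i))`_b`_a).
  apply: eq_bigr => i _; rewrite coefMn coefMn.
  have -> : (-1) ^+ i = (((-1) ^+ i : C)%:P)%:P :> {poly {poly C}}.
    by rewrite !rmorphXn !rmorphN1.
  by rewrite -(mulrA _%:P) coefCM coefCM key -/p mulrnAr mulrC.
rewrite e {e E key}.
transitivity (\sum_(i < M.+1) (((-1) ^+ i *+ 'C(M, i)) * ((i == a :> nat) && (M - i == b)%N)%:R : C)).
  apply: eq_bigr => i _; rewrite coefMn coefMn.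
  have -> : (-1) ^+ i = (((-1) ^+ i : C)%:P)%:P :> {poly {poly C}}.
    by rewrite !rmorphXn !rmorphN1.
  by rewrite -(mulrA _%:P) coefCM coefCM key' mulrnAl.
clear key'; have [leaM|ltMa] := leqP a M; last first.
  rewrite bin_small // mulr0n mul0r big1 // => i _.
  by rewrite ltn_eqF ?mulr0 // (leq_trans (ltn_ord i)).
rewrite (bigD1 (Ordinal (leaM : a < M.+1)%N)) //= eqxx big1 ?addr0 => [|i ne].
  by rewrite -(eqn_add2l a) subnKC // eq_sym.
by rewrite (negPf (_ : i != a :> nat)) // mulr0.
Qed.

End HighestWeight.

Section NormalFormCases.
Variable C : numClosedFieldType.
Variables (F : seq nat) (m : nat -> nat).
Hypothesis uF : uniq F.
Hypothesis F0 : F != [::].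
Hypothesis Fpos : forall k, k \in F -> (0 < k)%N.
Hypothesis mpos : forall k, k \in F -> (0 < m k)%N.
Local Notation n := (dimT F m).
Local Notation rho1 := (@rhoT1 C F m).
Implicit Types (k j a b : nat) (g h X Y : 'M[C]_2) (A B z : 'M[C]_n) (v w : 'cV[C]_n).

Lemma mem_tidxW k b a : ((k, b, a) \in tidx F succn) = [&& k \in F, (b <= k)%N & (a <= k)%N].
Proof. by rewrite mem_tidx // /succn ltnS. Qed.

Lemma cf_rhoDiag g (u : 'cV[C]_(dimT F succn)) k b a : (k, b, a) \in tidx F succn ->
  cf (rhoDiag F g *m u) (k, b, a) = \sum_(a' < k.+1) \sum_(b' < k.+1)
     rhoE k g a a' * rhoE k g b b' * cf u (k, b' : nat, a' : nat).
Proof.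
move=> vd; rewrite /rhoDiag -mulmxA rhoT1E cf_lift1 //; apply: eq_bigr => a' _.
have vd' : (k, b, a' : nat) \in tidx F succn.
  by move: vd; rewrite !mem_tidxW => /and3P[-> ->] _; rewrite -ltnS ltn_ord.
rewrite rhoT2E cf_lift2 // mulr_sumr; apply: eq_bigr => b' _.
by rewrite mulrA.
Qed.

(** With the form index as exponent of $X$ and the copy index as exponent of $Y$, the vector is
    $(Y-X)^M$, $M=m_k-1$. Since [unip2 c] shifts both variables by $c$ it is invariant, and its
    weight is $2k-2M=2k+2-2m_k$. *)
Lemma hwv_case2 w : (forall k, k \in F -> (m k <= k.+1)%N) ->
  (exists2 k, k \in F & (2 <= m k)%N) ->
  (forall k b a, k \in F -> (b < m k)%N -> (a <= k)%N ->
     cf w (k, b, a) = ((-1) ^+ a *+ 'C((m k).-1, a)) * (a + b == (m k).-1)%N%:R) ->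
  case2 w.
Proof.
move=> mle m2 wE; split=> // [k Fk|]; first by rewrite mpos ?mle.
exists 1%:M; split; [exact: unitmx1|by move=> g _; rewrite mulmx1 mul1mx|].
move=> k Fk; set M := (m k).-1; set u := blk k _.
have mE : m k = M.+1 by rewrite prednK // mpos.
have leMk : (M <= k)%N by rewrite -ltnS -mE mle.
have uE b a : (b <= k)%N -> (a <= k)%N ->
    cf u (k, b, a) = ((-1) ^+ a *+ 'C(M, a)) * (a + b == M)%N%:R.
  move=> leb lea; have vd : (k, b, a) \in tidx F succn by rewrite mem_tidxW Fk leb.
  have [p pE] := tix_surj vd; rewrite -pE cf_tix // mxE pE eqxx mul1mx mxE.
  transitivity (cf w (k, b, a)).
    rewrite /cf [RHS]big_mkcond; apply: eq_bigr => q _; rewrite !mxE pE eq_sym.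
    by case: eqP; rewrite ?mul1r ?mul0r.
  have [ltb|leb'] := ltnP b (m k); first exact: wE.
  rewrite cf_out; last by rewrite mem_tidx // Fk ltnNge leb'.
  rewrite gtn_eqF ?mulr0 //.
  by rewrite (@leq_trans b) ?leq_addl // -mE.
have u0 k' b a : k' != k -> cf u (k', b, a) = 0.
  move=> ne; have [vd|nvd] := boolP ((k', b, a) \in tidx F succn); last by rewrite cf_out.
  by have [p pE] := tix_surj vd; rewrite -pE cf_tix // mxE pE /= (negPf ne).
have ext (c : C) g :
    (forall b a, (b <= k)%N -> (a <= k)%N -> \sum_(a' < k.+1) \sum_(b' < k.+1)
     rhoE k g a a' * rhoE k g b b' * cf u (k, b' : nat, a' : nat) = c * cf u (k, b, a)) ->
    rhoDiag F g *m u = c *: u.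
  move=> e; apply: cfP => // -[[k' b] a] vd; rewrite cf_rhoDiag // cfZ.
  have [ek|ne] := eqVneq k' k; last first.
    by rewrite u0 // mulr0 big1 // => a' _; rewrite big1 // => b' _; rewrite u0 ?mulr0.
  by subst k'; move: vd; rewrite mem_tidxW => /and3P[_ ? ?]; apply: e.
split.
- apply: contraTneq isT => u00; have := uE M 0%N leMk isT.
  rewrite u00 cf0 expr0 bin0. rewrite add0n eqxx mulr1 => /esym/eqP.
  by rewrite oner_eq0.
- move=> t t0; apply: ext => // b a leb lea.
  rewrite (bigD1 (Ordinal (lea : a < k.+1)%N)) //= [X in _ + X]big1 ?addr0; last first.
    move=> a' ne; rewrite big1 // => b' _; rewrite rhoE_diag (_ : a == a' = false) ?mulr0 ?mul0r //.
    by apply/negbTE; rewrite eq_sym.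
  rewrite (bigD1 (Ordinal (leb : b < k.+1)%N)) //= [X in _ + X]big1 ?addr0; last first.
    move=> b' ne; rewrite [rhoE k _ b _]rhoE_diag (_ : b == b' = false) ?mulr0 ?mul0r //.
    by apply/negbTE; rewrite eq_sym.
  rewrite !rhoE_diag !eqxx !mulr1 uE //.
  have [e|ne] := eqVneq (a + b)%N M; last by rewrite !mulr0.
  congr (_ * _); have dE : (k - a + (k - b) = 2 * k + 2 - 2 * m k + (a + b))%N.
    by rewrite mE e; have := leMk; move: lea leb; lia.
  have -> : t ^+ (k - a) * t^-1 ^+ a * (t ^+ (k - b) * t^-1 ^+ b) =
      t ^+ (k - a + (k - b)) * t^-1 ^+ (a + b) by rewrite !exprD; ring.
  by rewrite dE exprD -mulrA -exprMn divff // expr1n mulr1.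
- move=> c; rewrite -[RHS]scale1r; apply: ext => // b a leb lea; rewrite mul1r uE //.
  rewrite -(binomial_shift c).
  have rE i d : rhoE k (unip2 c) d i = ((c%:P + 'X) ^+ i)`_d.
    by rewrite rhoEE /img0 /img1 unip2E !mk2E scale0r addr0 expr1n mul1r scale1r.
  rewrite (big_ord_widen k.+1 (fun i => ((c%:P + 'X) ^+ i)`_a * ((c%:P + 'X) ^+ (M - i))`_b
      * ((-1) ^+ i *+ 'C(M, i)))) // [RHS]big_mkcond.
  apply: eq_bigr => a' _; have lea' : (a' <= k)%N by rewrite -ltnS.
  case: ltnP => [lt|le]; last first.
    rewrite big1 // => b' _; rewrite uE // -1?ltnS ?ltn_ord // gtn_eqF ?mulr0 //.
    by rewrite (leq_trans le) // leq_addr.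
  have ltb : (M - a' < k.+1)%N by rewrite ltnS (leq_trans (leq_subr _ _)).
  rewrite (bigD1 (Ordinal ltb)) //= big1 ?addr0 => [|b' ne].
    by rewrite !rE uE // subnKC // eqxx mulr1.
  rewrite uE // -1?ltnS ?ltn_ord // (_ : (a' + b' == M)%N = false) ?mulr0 //.
  by apply: contraNF ne => /eqP e; apply/eqP/val_inj; rewrite /= -e addKn.
Qed.

Lemma weightvec_comp w k j a0 (c : C) : k \in F -> (j < m k)%N -> (a0 <= k)%N -> c != 0 ->
  (forall a, (a <= k)%N -> cf w (k, j, a) = c * (a == a0)%:R) ->
  weightvec (compV w k j) ((k - a0)%:Z - a0%:Z).
Proof.
move=> Fk ltj lea0 c0 wE.
have cE (a : 'I_k.+1) : compV w k j a ord0 = c * (a == a0 :> nat)%:R.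
  by rewrite mxE -wE // -ltnS.
split.
  apply: contraNneq c0 => e; have := cE (Ordinal (lea0 : a0 < k.+1)%N).
  by rewrite e mxE eqxx mulr1 => <-.
move=> t t0; apply/colP => a; rewrite mxE (bigD1 a) //= big1 ?addr0 => [|b ne].
  rewrite mxE rhoE_diag eqxx mulr1 [RHS]mxE cE.
  have [->|ne] := eqVneq (a : nat) a0; last by rewrite !mulr0.
  by rewrite expfzDr // -exprnN -exprVn.
by rewrite mxE rhoE_diag (_ : (a == b :> nat) = false) ?mulr0 ?mul0r //;
  apply/negbTE; rewrite eq_sym.
Qed.

(** The coefficient of $x^{2r}$ in the image of $x^ry^r$ is $(g_{00}g_{01})^r$. If it vanishes, one
    factor is 0, and the middle coefficient is $(g_{01}g_{10})^r=(-1)^r$ or $(g_{00}g_{11})^r=1$. *)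
Lemma middle_weight g r (zeta : C) : (0 < r)%N -> SL2 g ->
  rhoE (r + r) g 0%N r = 0 -> rhoE (r + r) g r r = zeta -> zeta = 1 \/ zeta = -1.
Proof.
rewrite /SL2 det2E => r0; rewrite !rhoEE addnK /img0 /img1.
move: (g i0 i0) (g i0 i1) (g i1 i0) (g i1 i1) => a b c d dt.
have c0 (x y : C) : ((x%:P + y *: 'X) ^+ r)`_0 = x ^+ r.
  by rewrite -horner_coef0 horner_exp !hornerE ?mulr0 ?addr0.
rewrite coef0M !c0 => /eqP; rewrite mulf_eq0 !expf_eq0 r0 /=.
have sgn : (-1 : C) ^+ r = 1 \/ (-1 : C) ^+ r = -1.
  have [o|e] := boolP (odd r); [right|left]; rewrite -signr_odd ?o ?(negPf e) ?expr1 ?expr0 //.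
case/orP => /eqP z0; move: dt; rewrite z0.
  rewrite mul0r sub0r => /eqP; rewrite eqr_oppLR => /eqP bc <-.
  rewrite add0r exprZn -scalerAl coefZ coefXnM ltnn subnn c0 -exprMn mulrC.
  by rewrite bc.
rewrite mul0r subr0 => ad <-; left.
by rewrite add0r exprZn -scalerAr coefZ coefMXn ltnn subnn c0 -exprMn mulrC ad expr1n.
Qed.
End NormalFormCases.

Section NontrivialNormalizer.
Variable C : numClosedFieldType.
Variables (F : seq nat) (m : nat -> nat).
Hypothesis uF : uniq F.
Hypothesis F0 : F != [::].
Hypothesis Fpos : forall k, k \in F -> (0 < k)%N.
Hypothesis mpos : forall k, k \in F -> (0 < m k)%N.
Local Notation n := (dimT F m).
Local Notation rho1 := (@rhoT1 C F m).
Implicit Types (k j a b : nat) (g h X Y : 'M[C]_2) (A B z : 'M[C]_n) (v w : 'cV[C]_n).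

Lemma diag_weight_inj k (t : C) : t != 0 ->
  (forall j, (0 < j <= k)%N -> t ^+ (2 * j) != 1) ->
  injective ((\row_(a < k.+1) (t ^+ (k - a) * t^-1 ^+ a)) ord0).
Proof.
move=> t0 tn; have lt (a b : 'I_k.+1) : (a < b)%N ->
    t ^+ (k - a) * t^-1 ^+ a = t ^+ (k - b) * t^-1 ^+ b -> False.
  move=> ltab e; have ltb := ltn_ord b.
  have /negP tn' : t ^+ (2 * (b - a)) != 1 by apply: tn; lia.
  apply: tn'.
  apply/eqP; have tk : t ^+ (k - b + a) != 0 by rewrite expf_neq0.
  apply: (mulfI tk); rewrite mulr1 -exprD.
  have -> : (k - b + a + 2 * (b - a) = (k - a) + b)%N by lia.
  have := congr1 (fun x => x * (t ^+ a * t ^+ b)) e.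
  rewrite !exprVn !exprD => e'; transitivity (t ^+ (k - a) / t ^+ a * (t ^+ a * t ^+ b)).
    by field; rewrite expf_neq0.
  by rewrite e'; field; rewrite expf_neq0.
move=> a b; rewrite !mxE => e; apply/val_inj.
by case: (ltngtP (val a) (val b)) => // ltab; [case: (lt a b)|case: (lt b a)].
Qed.

Lemma delta_supp r s (W : 'M[C]_(r, s)) (b : 'I_s) :
  (delta_mx (ord0 : 'I_1) b <= W)%MS -> b \in supp W.
Proof.
case/submxP => x /matrixP/(_ ord0 b); rewrite !mxE !eqxx => e.
apply: contraT; rewrite inE negb_exists => /forallP W0.
have := oner_neq0 C; rewrite [X in X != _](_ : 1 = 0) ?eqxx //.
transitivity (true%:R : C) => //; rewrite [LHS]e big1 // => j _.
by have := W0 j; rewrite negbK => /eqP ->; rewrite mulr0.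
Qed.

Lemma torus_supp v k z (t : C) : (forall g, SL2 g -> z *m rho1 g = rho1 g *m z) ->
  generic v -> k \in F -> t != 0 -> (forall j, (0 < j <= k)%N -> t ^+ (2 * j) != 1) ->
  z *m v = rho1 (diag2 t) *m v -> #|supp (comp_mx v k)| = m k.
Proof.
move=> cz gv Fk t0 tn e; apply: card_supp; first exact: comp_mx_free.
apply: diag_support (diag_weight_inj t0 tn) _.
have := comp_mx_stable uF cz Fk e; congr (_ *m _ <= _)%MS.
apply/matrixP => a b; rewrite !mxE rhoE_diag eq_sym -val_eqE /=.
by have [->|] := eqVneq (a : nat) b; rewrite ?mulr1 ?mulr1n // mulr0.
Qed.

(** The support is closed downwards: a row that is nonzero at [a] ends at some $p\ge a$, and all
    coordinate vectors up to $p$ lie in the row space. Having [m k] elements, it is an initial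
    segment. *)
Lemma unip_supp v k z (t : C) : (forall g, SL2 g -> z *m rho1 g = rho1 g *m z) ->
  generic v -> k \in F -> t ^+ 2 = 1 -> z *m v = rho1 (t *: unip2 1) *m v ->
  #|supp (comp_mx v k)| = m k /\ forall a : 'I_k.+1, a \in supp (comp_mx v k) -> (a < m k)%N.
Proof.
move=> cz gv Fk t2 e; have t0 : t != 0.
  by apply: contra_eq_neq t2 => ->; rewrite expr0n eq_sym oner_neq0.
set W := comp_mx v k; pose N : 'M[C]_k.+1 := (rhoK k (unip2 1))^T.
have NE (c a : 'I_k.+1) : N c a = 'C(c, a)%:R by rewrite !mxE rhoE_unip expr1n.
have WN : (W *m N <= W)%MS.
  have := comp_mx_stable uF cz Fk e.
  have -> : rhoK k (t *: unip2 1) = t ^+ k *: rhoK k (unip2 1).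
    rewrite -mul_scalar_mx rhoKM -mul_scalar_mx; congr (_ *m _).
    by apply/matrixP => a b; rewrite !mxE rhoE_scal -1?ltnS // mulr_natr.
  rewrite linearZ /= -scalemxAr => h; rewrite -[_ *m N](scalerK (expf_neq0 k t0)).
  exact: scalemx_sub.
have key (a : 'I_k.+1) : a \in supp W -> forall b : 'I_k.+1, (b <= a)%N -> (delta_mx (ord0 : 'I_1) b <= W)%MS.
  rewrite inE => /existsP [j Wja] b leba.
  pose p := [arg max_(c > a | W j c != 0) (c : nat)].
  have [Wjp pmax] : W j p != 0 /\ forall c, W j c != 0 -> (c <= p)%N.
    by rewrite /p; case: arg_maxnP => // p' ? pm; split=> // c; apply: pm.
  apply: (unip_support NE WN (p := p) (u := row j W)) => //.
  - exact: row_sub.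
  - move=> c ltpc; rewrite mxE; apply/eqP; apply: contraTT ltpc => /pmax.
    by rewrite -leqNgt.
  - by move=> c cp; rewrite mxE (_ : c = p) //; apply/val_inj.
  - by rewrite (leq_trans leba) // pmax.
have cS : #|supp W| = m k.
  by apply: card_supp => [|a aS]; [exact: comp_mx_free|exact: key aS _ _].
split=> // a aS.
pose f (i : 'I_a.+1) : 'I_k.+1 := widen_ord (ltn_ord a) i.
have finj : injective f by move=> i i' /(congr1 val) /= /val_inj.
rewrite -cS -[X in (X <= _)%N]card_ord -(card_codom finj).
apply/subset_leq_card/subsetP => _ /codomP [i ->].
by apply/delta_supp/(key _ aS); rewrite /= -ltnS.
Qed.

(** Replacing [v] by [rho1 (invmx h) *m v] brings [g] to its normal form [D] and keeps [z]. *)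
Lemma conj_comp v z g h D : (forall g, SL2 g -> z *m rho1 g = rho1 g *m z) ->
  SL2 h -> g *m h = h *m D -> z *m v = rho1 g *m v ->
  z *m (rho1 (invmx h) *m v) = rho1 D *m (rho1 (invmx h) *m v).
Proof.
move=> cz Sh gh e; rewrite (mulmxA z) (cz _ (SL2_V Sh)) -(mulmxA _ z) e.
rewrite !mulmxA -(rhoT1M _ uF) -(rhoT1M _ uF).
by rewrite (intertwineV (SL2_unit Sh) gh).
Qed.

Lemma generic_case2_case3 v : generic v -> ~ (forall A, connNormGH v A <-> HimgV A) ->
  exists s h, [/\ centH s, SL2 h & let w := s *m (rho1 h *m v) in case2 w \/ case3 w].
Proof.
move=> gv nconn; have [SS S1 SM SV] := stabS_group uF v.
have notfin (L : seq 'M[C]_n) : (forall z, stabC v z -> z \in L) -> False.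
  by move=> ZL; apply: nconn; apply: (connNormGH_finite uF F0 Fpos mpos ZL).
(* The weights of [diag2 t] on $R_k$ are distinct when $t^{2j}\ne1$ for $0<j\le k$; the largest
   degree serves all [k]. *)
pose K := (\max_(l <- F) l)%N.
have K0 : (0 < K)%N.
  by rewrite (leq_trans (Fpos (k0F F0))) // leq_maxF // k0F.
case: (SL2_group_trichotomy SS SM SV K0).
- case=> g [h [t [[Sg [z [uz cz] ez]] Sh gh t0 tn]]].
  have := conj_comp cz Sh gh ez; set v' := _ *m v => ezv.
  have gv' : generic v' by apply/generic_rho/gv/SL2_V.
  have cS k : k \in F -> #|supp (comp_mx v' k)| = m k.
    move=> Fk; apply: (torus_supp cz gv' Fk t0 _ ezv) => j /andP[j0 jk].
    by apply: tn; rewrite j0 (leq_trans jk) // leq_maxF.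
  pose I k : seq nat := [seq val x | x <- enum (supp (comp_mx v' k))].
  have IP k : k \in F -> [/\ uniq (I k), size (I k) = m k,
     (forall a, a \in I k -> (a <= k)%N) &
     forall j a, (j < m k)%N -> (a <= k)%N -> cf v' (k, j, a) != 0 -> a \in I k].
    move=> Fk; split.
    + by rewrite map_inj_uniq; [exact: enum_uniq|exact: val_inj].
    + by rewrite size_map -cardE cS.
    + by move=> a /mapP [a' _ ->]; have := ltn_ord a'; rewrite ltnS.
    + move=> j a ltj lea ne; apply/mapP; exists (Ordinal (lea : a < k.+1)%N) => //.
      by rewrite mem_enum; apply: (@supp_row _ _ _ _ (Ordinal ltj)); rewrite mxE.
  have [s cs sE] := normal_form uF gv' IP (c := fun _ _ => 1) (fun _ _ _ _ => oner_neq0 C).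
  have Ile k j : k \in F -> (j < m k)%N -> (nth 0%N (I k) j <= k)%N.
    by move=> Fk ltj; have [_ sI Ik _] := IP k Fk; apply: Ik; rewrite mem_nth ?sI.
  have wv k j : k \in F -> (j < m k)%N -> weightvec (compV (s *m v') k j)
      ((k - nth 0%N (I k) j)%:Z - (nth 0%N (I k) j)%:Z).
    move=> Fk ltj; apply: (@weightvec_comp C F m _ _ _ _ 1) => //.
    - exact: Ile.
    - exact: oner_neq0.
    - by move=> a lea; rewrite sE.
  have [[k [j [Fk ltj ne]]]|allmid] := pselect (exists k j, [/\ k \in F, (j < m k)%N
      & (k - nth 0%N (I k) j)%:Z - (nth 0%N (I k) j)%:Z != 0]).
    exists s, (invmx h); split=> //; first exact: SL2_V.
    right; split; last by exists k, j, ((k - nth 0%N (I k) j)%:Z - (nth 0%N (I k) j)%:Z);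
      split=> //; apply: wv.
    by move=> k' j' Fk' ltj'; eexists; apply: wv.
  (* Every component is now a multiple of $x^ry^r$ with $k=2r$, so independence leaves one component
     for each degree. *)
  have mid k j : k \in F -> (j < m k)%N -> (k = nth 0%N (I k) j + nth 0%N (I k) j)%N.
    move=> Fk ltj; apply: contrapT => ne; apply: allmid; exists k, j; split=> //.
    have := Ile _ _ Fk ltj; move: ne; set a := nth _ _ _ => ne le; apply/eqP => e.
    by apply: ne; lia.
  have m1 k : k \in F -> m k = 1%N.
    move=> Fk; have := mpos Fk; rewrite leq_eqVlt => /orP[/eqP <- //|m2].
    have [uI sI _ _] := IP k Fk.
    have := mid k 0%N Fk (mpos Fk); have := mid k 1%N Fk m2 => e1 e0.
    have : nth 0%N (I k) 0 == nth 0%N (I k) 1 by apply/eqP; lia.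
    by rewrite nth_uniq ?sI // mpos.
  exfalso.
  (* An element of [stabC v] is a scalar on each $R_k$; it sends the weight-zero component to its
     image under a group element, which makes the scalar a sign. So only finitely many exist. *)
  have [L LP] : exists L : seq 'M[C]_n, forall z, stabC v z -> z \in L.
    apply: (@finite_cover _ _ (all_seqs [:: 1; -1] (size F)) (stabC v)
      (fun z s => s = [seq cm z (k, 0%N, 0%N) (k, 0%N, 0%N) | k <- F])); last first.
      move=> z1 z2 _ [[_ c1] _] [[_ c2] _] -> e.
      rewrite (centH_lift2 uF c1) (centH_lift2 uF c2); apply: eq_lift2 => // k i j Fk.
      rewrite m1 // !ltnS !leqn0 => /eqP -> /eqP ->.
      by move/eq_in_map: e => /(_ k Fk).
    move=> z1 [[_ c1] [g1 Sg1 e1]].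
    exists [seq cm z1 (k, 0%N, 0%N) (k, 0%N, 0%N) | k <- F] => //.
    rewrite -(size_map (fun k => cm z1 (k, 0%N, 0%N) (k, 0%N, 0%N))).
    apply: mem_all_seqs => _ /mapP [k Fk ->]; rewrite !inE.
    pose r := nth 0%N (I k) 0; have kr : k = (r + r)%N := mid k 0%N Fk (mpos Fk).
    have gg : g1 *m h = h *m (invmx h *m g1 *m h).
      by rewrite -mulmxA mulKVmx ?SL2_unit.
    have := conj_comp c1 Sh gg e1; rewrite -/v'; set g2 := _ *m h => e2.
    have Sg2 : SL2 g2 by exact: SL2_M (SL2_M (SL2_V Sh) Sg1) Sh.
    have [uI sI Ik Isupp] := IP k Fk.
    have only0 a : (a <= k)%N -> a != r -> cf v' (k, 0%N, a) = 0.
      move=> lea; apply: contra_neq_eq => /(Isupp _ _ (mpos Fk) lea).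
      have -> : I k = [:: r] by rewrite /r; move: sI; rewrite m1 //; case: (I k) => [|? []].
      by rewrite inE => /eqP.
    have rk : (r <= k)%N by rewrite kr leq_addr.
    have x0 : cf v' (k, 0%N, r) != 0.
      apply/negP => /eqP x0; move/negP: (oner_neq0 C); apply.
      apply/eqP; apply: (comp_indep uF gv' Fk (x := fun=> 1)) (mpos Fk) => a lea.
      rewrite big1 // => i _; have -> : (i : nat) = 0%N.
        by apply/eqP; rewrite -leqn0 -ltnS; have := ltn_ord i; rewrite {2}(m1 _ Fk).
      by have [->|ne] := eqVneq a r; rewrite ?x0 ?only0 // mulr0.
    have vd a : (a <= k)%N -> (k, 0%N, a) \in tidx F m by move=> ?; rewrite mem_tidx // Fk mpos.
    have E a : (a <= k)%N -> cm z1 (k, 0%N, 0%N) (k, 0%N, 0%N) * cf v' (k, 0%N, a) =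
        rhoE k g2 a r * cf v' (k, 0%N, r).
      move=> lea; have := congr1 (fun u => cf u (k, 0%N, a)) e2.
      rewrite {1}(centH_lift2 uF c1) cf_lift2 ?vd // rhoT1E cf_lift1 ?vd //.
      rewrite (sum_ord_nat (G := fun c => rhoE k g2 a c * cf v' (k, 0%N, c)) rk); last first.
        by move=> c ne; have [lec|ltc] := leqP c k; [rewrite only0 ?mulr0|
           rewrite cf_out ?mulr0 // mem_tidx // [(c <= k)%N]leqNgt ltc !andbF].
      move=> <-; rewrite (bigD1 (Ordinal (mpos Fk))) //= big1 ?addr0 // => i.
      by case/negP; apply/eqP/val_inj/eqP; rewrite /= -leqn0 -ltnS -(m1 _ Fk).
    have r0 : (0 < r)%N by have := Fpos Fk; rewrite {1}kr; case: (r).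
    have := @middle_weight C g2 r (cm z1 (k, 0%N, 0%N) (k, 0%N, 0%N)) r0 Sg2.
    rewrite -kr => mw; case: mw => [||->|->]; rewrite ?eqxx ?orbT //.
      have r0' : 0%N != r by rewrite eq_sym -lt0n.
      by apply: (mulIf x0); rewrite -E // (only0 0%N) // mulr0 mul0r.
    by apply: (mulIf x0); rewrite -E.
  exact: notfin LP.
- case=> g [h [t [[Sg [z [uz cz] ez]] Sh t2 gh]]].
  have := conj_comp cz Sh gh ez; set v' := _ *m v => ezv.
  have gv' : generic v' by apply/generic_rho/gv/SL2_V.
  have sP k : k \in F -> #|supp (comp_mx v' k)| = m k /\
      forall a : 'I_k.+1, a \in supp (comp_mx v' k) -> (a < m k)%N.
    by move=> Fk; apply: (unip_supp cz gv' Fk t2 ezv).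
  have mle k : k \in F -> (m k <= k.+1)%N.
    by move=> /sP [e _]; rewrite -[X in (X <= _)%N]e (leq_trans (max_card _)) ?card_ord.
  (* Reversed so that copy [j] gets form index $m_k-1-j$, as the condition $a+b=m_k-1$ of the
     highest weight vector demands. *)
  pose I k : seq nat := rev (iota 0 (m k)).
  have IP k : k \in F -> [/\ uniq (I k), size (I k) = m k,
     (forall a, a \in I k -> (a <= k)%N) &
     forall j a, (j < m k)%N -> (a <= k)%N -> cf v' (k, j, a) != 0 -> a \in I k].
    move=> Fk; split.
    + by rewrite rev_uniq iota_uniq.
    + by rewrite size_rev size_iota.
    + by move=> a; rewrite mem_rev mem_iota /= add0n => lt; rewrite -ltnS (leq_trans lt) // mle.
    + move=> j a ltj lea ne; rewrite mem_rev mem_iota /= add0n.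
      have [_ lt] := sP k Fk; apply: (lt (Ordinal (lea : a < k.+1)%N)).
      by apply: (@supp_row _ _ _ _ (Ordinal ltj)); rewrite mxE.
  have nthI k j : (j < m k)%N -> nth 0%N (I k) j = (m k - j.+1)%N.
    by move=> ltj; rewrite nth_rev ?size_iota // nth_iota ?add0n // -subSn // subSS leq_subr.
  (* The coefficients of $(Y-X)^{m_k-1}$. *)
  pose c k j : C := (-1) ^+ (m k - j.+1) *+ 'C((m k).-1, m k - j.+1).
  have c0 k j : k \in F -> (j < m k)%N -> c k j != 0.
    move=> Fk ltj; rewrite /c -mulr_natr mulf_neq0 ?signr_eq0 // pnatr_eq0 -lt0n bin_gt0.
    by lia.
  have [s cs sE] := normal_form uF gv' IP c0.
  exists s, (invmx h); split=> //; first exact: SL2_V.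
  have [m2|m1] := pselect (exists2 k, k \in F & (2 <= m k)%N).
    left; apply: hwv_case2 => // k b a Fk ltb lea; rewrite sE // nthI // /c.
    have <- : (a == m k - b.+1)%N = (a + b == (m k).-1)%N by lia.
    by case: eqP => [<-|]; rewrite ?mulr1 ?mulr0.
  (* If every $m_k$ is 1, the components are highest weight vectors, of weight $k>0$. *)
  right; split=> [k j Fk ltj|].
    exists ((k - nth 0%N (I k) j)%:Z - (nth 0%N (I k) j)%:Z).
    apply: (weightvec_comp Fk ltj _ (c0 k j Fk ltj)) => [|a lea]; last by rewrite sE.
    by rewrite nthI //; have := mle k Fk; lia.
  have Fk := k0F F0; set k := head 0%N F in Fk.
  have mk : m k = 1%N.
    by apply/eqP; rewrite eqn_leq mpos // leqNgt andbT; apply/negP => m2; apply: m1; exists k.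
  exists k, 0%N, ((k - 0)%:Z - 0%:Z); split; rewrite ?mpos //.
    by rewrite subr0 subn0; have := Fpos Fk; lia.
  apply: (weightvec_comp Fk (mpos Fk) _ (c0 k 0%N Fk (mpos Fk))) => // a lea.
  by rewrite sE ?mpos // nthI ?mpos // mk.
- by case=> s sP; have [L LP] := stabS_finite gv sP; case: (notfin L LP).
Qed.
End NontrivialNormalizer.

(** * The second factor *)

Section Swap.
Variable C : numClosedFieldType.
Variable F : seq nat.
Hypothesis uF : uniq F.
Local Notation n := (dimT F succn).
Local Notation L1 := (@L1 C F succn).
Local Notation rho1 := (@rhoT1 C F succn).
Local Notation rho2 := (@rhoT2 C F succn).
Implicit Types (k a b : nat) (g h X Y : 'M[C]_2) (A B z : 'M[C]_n) (v : 'cV[C]_n).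

Lemma mem_tidxs k b a :
  ((k, b, a) \in tidx F succn) = [&& k \in F, (b <= k)%N & (a <= k)%N].
Proof. by rewrite mem_tidx // /succn ltnS. Qed.

Definition swap3 (s : nat * nat * nat) := (s.1.1, s.2, s.1.2).
(** The exchange of the two tensor factors; conjugation by it carries facts about the first action
    to the second. *)
Definition Psw : 'M[C]_n := \matrix_(p, q) (tix p == swap3 (tix q))%:R.

Lemma swap3K : involutive swap3. Proof. by case=> [[]]. Qed.
Lemma mem_swap3 s : (swap3 s \in tidx F succn) = (s \in tidx F succn).
Proof. by case: s => [[k b] a]; rewrite /swap3 !mem_tidxs /= [_ && (_ <= k)%N]andbC. Qed.

Lemma cm_Psw s t : s \in tidx F succn -> t \in tidx F succn ->
  cm Psw s t = (s == swap3 t)%:R.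
Proof. by move=> ss tt; rewrite /Psw (cm_mx uF (fun s t => (s == swap3 t)%:R)). Qed.

Lemma cm_Pswl A s t : s \in tidx F succn -> t \in tidx F succn ->
  cm (Psw *m A) s t = cm A (swap3 s) t.
Proof.
move=> ss tt; rewrite cm_mul // (bigD1_seq (swap3 s)) ?mem_swap3 ?tidx_uniq //=.
rewrite cm_Psw ?mem_swap3 // swap3K eqxx mul1r big1_seq ?addr0 // => u /andP[ne uu].
rewrite cm_Psw // (_ : s == swap3 u = false) ?mul0r //.
by apply: contraNF ne => /eqP ->; rewrite swap3K.
Qed.
Lemma cm_Pswr A s t : s \in tidx F succn -> t \in tidx F succn ->
  cm (A *m Psw) s t = cm A s (swap3 t).
Proof.
move=> ss tt; rewrite cm_mul // (bigD1_seq (swap3 t)) ?mem_swap3 ?tidx_uniq //=.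
rewrite cm_Psw ?mem_swap3 // eqxx mulr1 big1_seq ?addr0 // => u /andP[ne uu].
by rewrite cm_Psw // (negPf ne) mulr0.
Qed.
Lemma cf_Psw v s : s \in tidx F succn -> cf (Psw *m v) s = cf v (swap3 s).
Proof.
move=> ss; rewrite cf_mul // (bigD1_seq (swap3 s)) ?mem_swap3 ?tidx_uniq //=.
rewrite cm_Psw ?mem_swap3 // swap3K eqxx mul1r big1_seq ?addr0 // => u /andP[ne uu].
rewrite cm_Psw // (_ : s == swap3 u = false) ?mul0r //.
by apply: contraNF ne => /eqP ->; rewrite swap3K.
Qed.
Lemma PswK : Psw *m Psw = 1%:M.
Proof.
apply: cmP => // s t ss tt; rewrite cm_Pswl // cm_Psw ?mem_swap3 // cm1 //.
by rewrite (inj_eq (inv_inj swap3K)).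
Qed.
Lemma Psw_lift1 (B : nat -> nat -> nat -> C) :
  Psw *m lift1 F succn B *m Psw = lift2 F succn B.
Proof.
apply: cmP => // -[[k b] a] [[k' b'] a'] ss tt.
rewrite cm_Pswr // cm_Pswl ?mem_swap3 // /swap3 /= cm_lift1 ?cm_lift2 //.
- by rewrite -mem_swap3.
- by rewrite -mem_swap3.
Qed.
Lemma Psw_lift2 (B : nat -> nat -> nat -> C) :
  Psw *m lift2 F succn B *m Psw = lift1 F succn B.
Proof. by rewrite -Psw_lift1 !mulmxA PswK mul1mx -mulmxA PswK mulmx1. Qed.

Definition conjP A := Psw *m A *m Psw.
Lemma conjPM A B : conjP (A *m B) = conjP A *m conjP B.
Proof. by rewrite /conjP !mulmxA -(mulmxA _ Psw Psw) PswK mulmx1. Qed.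
Lemma conjPK : involutive conjP.
Proof. by move=> A; rewrite /conjP !mulmxA PswK mul1mx -mulmxA PswK mulmx1. Qed.
Lemma conjP_lin (c : C) A B : conjP (c *: A + B) = c *: conjP A + conjP B.
Proof. by rewrite /conjP mulmxDr mulmxDl -scalemxAr -scalemxAl. Qed.
Lemma conjP1 : conjP 1%:M = 1%:M.
Proof. by rewrite /conjP mulmx1 PswK. Qed.
Lemma conjPD A B : conjP (A + B) = conjP A + conjP B.
Proof. by rewrite -[A]scale1r conjP_lin !scale1r. Qed.
Lemma conjPN A : conjP (- A) = - conjP A.
Proof. by rewrite /conjP mulmxN mulNmx. Qed.
Lemma conjP_lie A B : conjP (lie A B) = lie (conjP A) (conjP B).
Proof. by rewrite /lie conjPD conjPN !conjPM. Qed.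
Lemma conjP_tr A : \tr (conjP A) = \tr A.
Proof. by rewrite /conjP mxtrace_mulC mulmxA PswK mul1mx. Qed.

Definition L2 X : 'M[C]_n := lift2 F succn (fun k => drhoE k X).
Lemma L2E X : L2 X = conjP (L1 X). Proof. by rewrite /L2 -Psw_lift1. Qed.
Lemma conjP_L2 X : conjP (L2 X) = L1 X. Proof. by rewrite L2E conjPK. Qed.
Lemma rho2E g : rho2 g = conjP (rho1 g).
Proof. by rewrite rhoT2E -Psw_lift1 -rhoT1E. Qed.

Lemma rhoT2M g h : rho2 (g *m h) = rho2 g *m rho2 h.
Proof. by rewrite !rho2E rhoT1M // conjPM. Qed.
Lemma rhoT2_1 : rho2 1%:M = 1%:M.
Proof. by rewrite rho2E rhoT1_1 // conjP1. Qed.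
Lemma rhoT2V g : SL2 g -> rho2 g *m rho2 (invmx g) = 1%:M.
Proof. by move=> Sg; rewrite -rhoT2M mulmxV ?rhoT2_1 // SL2_unit. Qed.
Lemma rhoT2K g : SL2 g -> rho2 (invmx g) *m rho2 g = 1%:M.
Proof. by move=> Sg; rewrite -rhoT2M mulVmx ?rhoT2_1 // SL2_unit. Qed.
Lemma rhoT2_unit g : SL2 g -> rho2 g \in unitmx.
Proof. by move=> Sg; case: (mulmx1_unit (rhoT2V Sg)). Qed.
Lemma L2_lin (c : C) X Y : L2 (c *: X + Y) = c *: L2 X + L2 Y.
Proof. by rewrite !L2E L1_lin // conjP_lin. Qed.
Lemma L2D X Y : L2 (X + Y) = L2 X + L2 Y.
Proof. by rewrite !L2E L1D // conjPD. Qed.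
Lemma L20 : L2 0 = 0.
Proof. by rewrite L2E L10 /conjP mulmx0 mul0mx. Qed.
Lemma L2Z (c : C) X : L2 (c *: X) = c *: L2 X.
Proof. by have := L2_lin c X 0; rewrite L20 !addr0. Qed.
Lemma L2N X : L2 (- X) = - L2 X.
Proof. by rewrite -!scaleN1r L2Z. Qed.
Lemma L2_lie X Y : L2 (lie X Y) = lie (L2 X) (L2 Y).
Proof. by rewrite !L2E L1_lie // conjP_lie. Qed.
Lemma rhoT2_L2 g X Y : X *m g = g *m Y -> L2 X *m rho2 g = rho2 g *m L2 Y.
Proof. by move=> e; rewrite !L2E !rho2E -!conjPM (rhoT1_L1 _ uF e). Qed.

Lemma rho12C g h : rho1 g *m rho2 h = rho2 h *m rho1 g.
Proof. by rewrite rhoT1E rhoT2E lift12C. Qed.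
Lemma L12C X Y : L1 X *m L2 Y = L2 Y *m L1 X.
Proof. exact: lift12C. Qed.
Lemma rho1_L2C g Y : rho1 g *m L2 Y = L2 Y *m rho1 g.
Proof. by rewrite rhoT1E lift12C. Qed.
Lemma rho2_L1C g Y : rho2 g *m L1 Y = L1 Y *m rho2 g.
Proof. by rewrite rhoT2E -lift12C. Qed.

Lemma L2_schur z : z *m L2 e2 = L2 e2 *m z -> z *m L2 f2 = L2 f2 *m z ->
  exists mu, z = lift1 F succn mu.
Proof.
move=> ze zf; have conj X : z *m L2 X = L2 X *m z -> conjP z *m L1 X = L1 X *m conjP z.
  by move=> e; rewrite -conjP_L2 -!conjPM e.
exists (fun k i j => cm (conjP z) (k, i, 0%N) (k, j, 0%N)).
by rewrite -Psw_lift2 -L1_schur ?conj // -/(conjP _) conjPK.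
Qed.

Lemma cm_L2el A k b a t : (k, b, a) \in tidx F succn -> t \in tidx F succn ->
  cm (L2 e2 *m A) (k, b, a) t = b.+1%:R * cm A (k, b.+1, a) t.
Proof.
move=> s tt; have s' : (k, a, b) \in tidx F succn by rewrite -mem_swap3.
rewrite L2E /conjP -!mulmxA cm_Pswl // cm_L1el //; congr (_ * _).
have [s2|s2] := boolP ((k, b.+1, a) \in tidx F succn).
  by rewrite cm_Pswl // -mem_swap3.
by rewrite !cm_outl // -mem_swap3.
Qed.
Lemma cm_L2er A k b a s : s \in tidx F succn -> (k, b, a) \in tidx F succn ->
  cm (A *m L2 e2) s (k, b, a) = b%:R * cm A s (k, b.-1, a).
Proof.
move=> ss t; have t' : (k, a, b) \in tidx F succn by rewrite -mem_swap3.
rewrite L2E /conjP !mulmxA cm_Pswr // cm_L1er //; congr (_ * _).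
rewrite cm_Pswr //; move: t'; rewrite !mem_tidxs => /and3P[-> -> le] /=.
by rewrite (leq_trans (leq_pred _)).
Qed.
Lemma cm_L2hl A k b a t : (k, b, a) \in tidx F succn -> t \in tidx F succn ->
  cm (L2 h2 *m A) (k, b, a) t = wt C k b * cm A (k, b, a) t.
Proof.
move=> s tt; have s' : (k, a, b) \in tidx F succn by rewrite -mem_swap3.
by rewrite L2E /conjP -!mulmxA cm_Pswl // cm_L1hl // cm_Pswl.
Qed.
Lemma cm_L2hr A k b a s : s \in tidx F succn -> (k, b, a) \in tidx F succn ->
  cm (A *m L2 h2) s (k, b, a) = wt C k b * cm A s (k, b, a).
Proof.
move=> ss t; have t' : (k, a, b) \in tidx F succn by rewrite -mem_swap3.
by rewrite L2E /conjP !mulmxA cm_Pswr // cm_L1hr // cm_Pswr.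
Qed.
Lemma cf_L2e v k b a : (k, b, a) \in tidx F succn ->
  cf (L2 e2 *m v) (k, b, a) = b.+1%:R * cf v (k, b.+1, a).
Proof.
move=> s; have s' : (k, a, b) \in tidx F succn by rewrite -mem_swap3.
rewrite L2E /conjP -!mulmxA cf_Psw // cf_L1e //; congr (_ * _).
have [s2|s2] := boolP ((k, b.+1, a) \in tidx F succn).
  by rewrite cf_Psw // -mem_swap3.
by rewrite !cf_out // -mem_swap3.
Qed.
Lemma cf_L2h v k b a : (k, b, a) \in tidx F succn ->
  cf (L2 h2 *m v) (k, b, a) = wt C k b * cf v (k, b, a).
Proof.
move=> s; have s' : (k, a, b) \in tidx F succn by rewrite -mem_swap3.
by rewrite L2E /conjP -!mulmxA cf_Psw // cf_L1h // cf_Psw.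
Qed.

Lemma unip_curve2 : exists (N : nat -> 'M[C]_n) d,
  [/\ (1 < d)%N, N 0%N = 1%:M, N 1%N = L2 e2 &
      forall t, rho2 (unip2 t) = \sum_(i < d) t ^+ i *: N i].
Proof.
have [N [d [d1 N0 N1 NE]]] := unip_curve C succn uF.
exists (fun i => conjP (N i)), d; split=> // [||t]; rewrite ?N0 ?conjP1 ?N1 ?L2E //.
rewrite rho2E NE /conjP mulmx_sumr mulmx_suml; apply: eq_bigr => i _.
by rewrite -scalemxAr -scalemxAl.
Qed.
Lemma low_curve2 : exists (N : nat -> 'M[C]_n) d,
  [/\ (1 < d)%N, N 0%N = 1%:M, N 1%N = L2 f2 &
      forall t, rho2 (low2 t) = \sum_(i < d) t ^+ i *: N i].
Proof.
have [N [d [d1 N0 N1 NE]]] := low_curve C succn uF.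
exists (fun i => conjP (N i)), d; split=> // [||t]; rewrite ?N0 ?conjP1 ?N1 ?L2E //.
rewrite rho2E NE /conjP mulmx_sumr mulmx_suml; apply: eq_bigr => i _.
by rewrite -scalemxAr -scalemxAl.
Qed.
End Swap.

(** * The Lie algebra of the stabilizer in case (1) *)

Section MoreCurves.
Variable C : numClosedFieldType.

Lemma curve_eq r s (u u' : nat -> 'M[C]_(r, s)) d d' : (1 < d)%N -> (1 < d')%N ->
  (forall t : C, \sum_(i < d) t ^+ i *: u i = \sum_(i < d') t ^+ i *: u' i) ->
  u 1%N = u' 1%N.
Proof.
move=> d1 d1' e; rewrite -(cfm_polycurve u d1) -(cfm_polycurve u' d1').
congr (cfm 1 _); apply/matrixP => i j; apply/eqP; rewrite -subr_eq0; apply/eqP/poly_all0 => t.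
have := e t; rewrite -!evm_polycurve => /matrixP/(_ i j).
by rewrite !mxE hornerD hornerN /horner_eval => ->; rewrite subrr.
Qed.

(** The product rule at 0 for a curve $N(t)AN'(t)$ in the subspace [P]. With $N'(t)=N(-t)$ it yields
    a bracket. *)
Lemma prod_curve r s (P : 'M[C]_(r, s) -> Prop) (N : nat -> 'M[C]_r) A (N' : nat -> 'M[C]_s) d d' :
  P 0 -> (forall (c : C) u w, P u -> P w -> P (c *: u + w)) ->
  (1 < d)%N -> (1 < d')%N -> N 0%N = 1%:M -> N' 0%N = 1%:M ->
  (forall t, P ((\sum_(i < d) t ^+ i *: N i) *m A *m (\sum_(i < d') t ^+ i *: N' i))) ->
  P (N 1%N *m A + A *m N' 1%N).
Proof.
move=> P0 PL d1 d1' N0 N0' PQ.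
pose Q := polycurve d N *m cmx A *m polycurve d' N'.
have [e e1 QE] := evm_sum Q.
have -> : N 1%N *m A + A *m N' 1%N = cfm 1 Q.
  rewrite !cfm1M cfm0M !cfm_polycurve ?(ltnW d1) ?(ltnW d1') // cfm0_cmx cfm1_cmx.
  by rewrite N0 N0' mul1mx mulmx0 add0r mulmx1 addrC.
apply: (curve_coef (P := P) (N := fun i => cfm i Q) P0 PL) e1 => t.
by rewrite -QE !evmM !evm_polycurve evm_cmx.
Qed.

Lemma curve_opp r s (N : nat -> 'M[C]_(r, s)) d t :
  \sum_(i < d) (- t) ^+ i *: N i = \sum_(i < d) t ^+ i *: ((-1) ^+ i *: N i).
Proof. by apply: eq_bigr => i _; rewrite scalerA -exprMn mulrN1. Qed.
End MoreCurves.

(** * The vector fixed by the diagonal and tangent directions to its orbit *)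

Section Vector.
Variable C : numClosedFieldType.
Variable F : seq nat.
Hypothesis uF : uniq F.
Hypothesis F0 : F != [::].
Hypothesis Fpos : forall k, k \in F -> (0 < k)%N.
Local Notation n := (dimT F succn).
Local Notation L1 := (@L1 C F succn).
Local Notation L2 := (@L2 C F).
Local Notation rho1 := (@rhoT1 C F succn).
Local Notation rho2 := (@rhoT2 C F succn).
Implicit Types (k a b : nat) (g h X Y : 'M[C]_2) (A B z N : 'M[C]_n) (v : 'cV[C]_n).

Variable w : 'cV[C]_n.
Hypothesis wfix : forall g, SL2 g -> rhoDiag F g *m w = w.
Hypothesis wnz : forall k, k \in F -> exists b a, cf w (k, b, a) != 0.

Lemma rho2_w g : SL2 g -> rho2 g *m w = rho1 (invmx g) *m w.
Proof.
move=> Sg; rewrite -{2}(wfix Sg) /rhoDiag !mulmxA rhoT1K // mul1mx //.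
Qed.

Lemma invmx_unip (t : C) : invmx (unip2 t) = unip2 (- t).
Proof.
rewrite -[LHS]mulmx1 -unip2_0 -(subrr t) unip2D mulKmx //.
exact/SL2_unit/SL2_unip.
Qed.
Lemma invmx_low (t : C) : invmx (low2 t) = low2 (- t).
Proof.
rewrite -[LHS]mulmx1 -low2_0 -(subrr t) low2D mulKmx //.
exact/SL2_unit/SL2_low.
Qed.

Lemma L2e_w : L2 e2 *m w = - (L1 e2 *m w).
Proof.
have [N [d [d1 N0 <- NE]]] := unip_curve C succn uF.
have [N' [d' [d1' N0' <- NE']]] := unip_curve2 C uF.
rewrite (@curve_eq _ _ _ (fun i => N' i *m w) (fun i => ((-1) ^+ i *: N i) *m w) _ _ d1' d1).
  by rewrite expr1 scaleN1r mulNmx.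
move=> t; transitivity (rho2 (unip2 t) *m w).
  by rewrite NE' mulmx_suml; apply: eq_bigr => i _; rewrite scalemxAl.
rewrite rho2_w; last exact: SL2_unip.
by rewrite invmx_unip NE curve_opp mulmx_suml; apply: eq_bigr => i _; rewrite scalemxAl.
Qed.
Lemma L2f_w : L2 f2 *m w = - (L1 f2 *m w).
Proof.
have [N [d [d1 N0 <- NE]]] := low_curve C succn uF.
have [N' [d' [d1' N0' <- NE']]] := low_curve2 C uF.
rewrite (@curve_eq _ _ _ (fun i => N' i *m w) (fun i => ((-1) ^+ i *: N i) *m w) _ _ d1' d1).
  by rewrite expr1 scaleN1r mulNmx.
move=> t; transitivity (rho2 (low2 t) *m w).
  by rewrite NE' mulmx_suml; apply: eq_bigr => i _; rewrite scalemxAl.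
rewrite rho2_w; last exact: SL2_low.
by rewrite invmx_low NE curve_opp mulmx_suml; apply: eq_bigr => i _; rewrite scalemxAl.
Qed.
Lemma L2h_w : L2 h2 *m w = - (L1 h2 *m w).
Proof.
rewrite -lie_ef L2_lie // L1_lie // /lie !mulmxBl -!mulmxA L2e_w L2f_w !mulmxN.
rewrite [L2 e2 *m (_ *m _)]mulmxA -L12C // -mulmxA L2e_w mulmxN opprK.
rewrite [L2 f2 *m (_ *m _)]mulmxA -L12C // -mulmxA L2f_w mulmxN opprK.
by rewrite opprB.
Qed.

Lemma w_support k b a : (k, b, a) \in tidx F succn -> (a + b)%N != k -> cf w (k, b, a) = 0.
Proof.
move=> vd ne; have := congr1 (fun u => cf u (k, b, a)) L2h_w.
rewrite cfN cf_L2h // cf_L1h // => /eqP; rewrite -subr_eq0 opprK -mulrDl mulf_eq0.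
case/orP => [|/eqP //]; rewrite (_ : _ + _ = (k%:R - (a + b)%:R) *+ 2); last first.
  by rewrite /wt natrD; ring.
by rewrite mulrn_eq0 /= subr_eq0 eqr_nat eq_sym (negPf ne).
Qed.

(** Being killed by the diagonal $e$ is a recurrence along $a+b=k$, solved by the multiples of
    $(x\bar y-y\bar x)^k$. *)
Lemma w_entry k a : k \in F -> (a <= k)%N ->
  cf w (k, (k - a)%N, a) = (-1) ^+ a * 'C(k, a)%:R * cf w (k, k, 0%N).
Proof.
move=> Fk; elim: a => [|a IHa] lea.
  by rewrite subn0 expr0 bin0 !mul1r.
have n0 : (a.+1%:R : C) != 0 by rewrite pnatr_eq0.
have vd : (k, (k - a.+1)%N, a) \in tidx F succn.
  by rewrite mem_tidxs Fk leq_subr ltnW.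
have := congr1 (fun u => cf u (k, (k - a.+1)%N, a)) L2e_w.
rewrite cfN cf_L2e // cf_L1e // subnSK // IHa ?(ltnW lea) // => e.
apply: (mulfI n0); apply: oppr_inj; rewrite -e !mulrA.
have -> : (a.+1%:R * (-1) ^+ a.+1 * 'C(k, a.+1)%:R : C) =
    - ((-1) ^+ a * (a.+1 * 'C(k, a.+1))%N%:R) by rewrite exprS natrM; ring.
by rewrite mul_bin_left natrM; ring.
Qed.

Lemma w_neq0 k : k \in F -> cf w (k, k, 0%N) != 0.
Proof.
move=> Fk; have [b [a]] := wnz Fk; apply: contraNneq => w0.
have [vd|nvd] := boolP ((k, b, a) \in tidx F succn); last by rewrite cf_out.
have [e|ne] := eqVneq (a + b)%N k; last by rewrite w_support.
have le : (a <= k)%N by rewrite -e leq_addr.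
have -> : b = (k - a)%N by rewrite -e addKn.
by rewrite w_entry // w0 mulr0.
Qed.

Lemma w_anti_neq0 k b : k \in F -> (b <= k)%N -> cf w (k, b, (k - b)%N) != 0.
Proof.
move=> Fk le; rewrite -{1}(subKn le) w_entry ?leq_subr // mulf_neq0 ?w_neq0 //.
by rewrite mulf_neq0 ?signr_eq0 // pnatr_eq0 -lt0n bin_gt0 leq_subr.
Qed.

(* On w the two actions of a group element, or of a Lie algebra element, are
   determined by one matrix, which this operator recovers. *)
Definition recov v : 'M[C]_n := lift1 F succn
  (fun k a c => cf v (k, (k - c)%N, a) / cf w (k, (k - c)%N, c)).

Lemma cf_lift1_w (B : nat -> nat -> nat -> C) k b a : (k, b, a) \in tidx F succn ->
  cf (lift1 F succn B *m w) (k, b, a) = B k a (k - b)%N * cf w (k, b, (k - b)%N).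
Proof.
move=> vd; rewrite cf_lift1 //; move: vd; rewrite mem_tidxs => /and3P[Fk leb lea].
rewrite (sum_ord_nat (G := fun c => B k a c * cf w (k, b, c)) (b := k - b)) ?leq_subr //.
move=> c ne; have [lec|ltc] := leqP c k; last first.
  by rewrite cf_out ?mulr0 // mem_tidxs [(c <= k)%N]leqNgt ltc !andbF.
by rewrite w_support ?mulr0 ?mem_tidxs ?Fk ?leb //; move: ne; lia.
Qed.

Lemma recov_lift1 (B : nat -> nat -> nat -> C) :
  recov (lift1 F succn B *m w) = lift1 F succn B.
Proof.
apply: eq_lift1 => k a c Fk lea lec; rewrite cf_lift1_w ?mem_tidxs ?Fk ?leq_subr //.
rewrite subKn // mulfK //; have := w_anti_neq0 Fk (leq_subr c k); rewrite subKn //.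
Qed.
Lemma recovK v : recov v *m w = v.
Proof.
apply: cfP => // -[[k b] a] vd; rewrite cf_lift1_w //.
move: vd; rewrite mem_tidxs => /and3P[Fk leb lea].
by rewrite subKn // divfK // w_anti_neq0.
Qed.
Lemma recov_lin (c : C) u v : recov (c *: u + v) = c *: recov u + recov v.
Proof.
rewrite /recov -lift1_lin; apply: eq_lift1 => k a b *.
by rewrite cfD cfZ mulrDl mulrA.
Qed.

Lemma recov_sum d (u : nat -> 'cV[C]_n) (t : C) :
  recov (\sum_(i < d) t ^+ i *: u i) = \sum_(i < d) t ^+ i *: recov (u i).
Proof.
have r0 : recov 0 = 0.
  by apply/matrixP => p q; rewrite !mxE cf0 mul0r; case: ifP.
elim: d => [|d IHd]; first by rewrite !big_ord0.
by rewrite !big_ord_recr /= addrC recov_lin IHd addrC.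
Qed.

(** [recov] turns the curve of vectors into a curve in the image of $H$ through 1, whose velocity is
    known to come from $\mathfrak{sl}_2$. *)
Lemma orbit_curve d (u : nat -> 'cV[C]_n) : (1 < d)%N -> u 0%N = w ->
  (forall t, orbitH w (\sum_(i < d) t ^+ i *: u i)) ->
  exists2 X, \tr X = 0 & u 1%N = L1 X *m w.
Proof.
move=> d1 u0 uo.
have mpos k : k \in F -> (0 < succn k)%N by [].
have [|t|X trX e] := @Himg_curve C F succn uF F0 Fpos mpos (fun i => recov (u i)) d d1.
- rewrite u0 -[X in recov X](mul1mx w) -(rhoT1_1 _ _ uF) rhoT1E recov_lift1.
  by [].
- by rewrite -recov_sum; have [g [Sg ->]] := uo t; exists g; rewrite rhoT1E recov_lift1.
- by exists X; rewrite // -e recovK.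
Qed.

Lemma L1w_inj X : L1 X *m w = 0 -> X = 0.
Proof.
move=> e; have mpos k : k \in F -> (0 < succn k)%N by [].
apply/eqP; rewrite -(L1_eq0 uF F0 Fpos mpos) -[L1 X]recov_lift1 -/(L1 X) e.
by rewrite -[0](scale0r w) -[X in recov X]addr0 recov_lin scale0r add0r;
  apply/eqP/matrixP => p q; rewrite !mxE cf0 mul0r; case: ifP.
Qed.

(** Unlike [w] it is supported on equal indices [a = b], so a weight space of the first factor meets
    its support at most once in each degree. On it the two copies of [h2] act alike, and [f2] of the
    first factor acts as [e2] of the second. *)
Definition yv := rho1 wey2 *m w.

Lemma L1_y X X' : X *m wey2 = wey2 *m X' -> L2 X' *m w = - (L1 X' *m w) ->
  L1 X *m yv = - (L2 X' *m yv).
Proof.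
move=> e eX; rewrite /yv mulmxA (rhoT1_L1 _ uF e) -mulmxA.
by rewrite [in RHS]mulmxA -rho1_L2C // -mulmxA eX mulmxN opprK.
Qed.
Lemma L1f_y : L1 f2 *m yv = L2 e2 *m yv.
Proof.
rewrite (@L1_y _ (- e2)).
- by rewrite L2N // mulNmx opprK.
- by rewrite /e2 /f2 /wey2; mx2; ring.
- by rewrite L2N // L1N // !mulNmx L2e_w.
Qed.
Lemma L1h_y : L1 h2 *m yv = L2 h2 *m yv.
Proof.
rewrite (@L1_y _ (- h2)).
- by rewrite L2N // mulNmx opprK.
- by rewrite /h2 /wey2; mx2; ring.
- by rewrite L2N // L1N // !mulNmx L2h_w.
Qed.

Lemma cf_y k b a : (k, b, a) \in tidx F succn ->
  cf yv (k, b, a) = (-1) ^+ b * (a == b)%:R * cf w (k, b, (k - b)%N).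
Proof.
move=> vd; rewrite /yv rhoT1E cf_lift1_w // rhoE_wey.
by move: vd; rewrite mem_tidxs => /and3P[_ leb _]; rewrite subKn.
Qed.
Lemma y_off k b a : a != b -> cf yv (k, b, a) = 0.
Proof.
move=> ne; have [vd|?] := boolP ((k, b, a) \in tidx F succn); last by rewrite cf_out.
by rewrite cf_y // (negPf ne) mulr0 mul0r.
Qed.
Lemma y_neq0 k b : k \in F -> (b <= k)%N -> cf yv (k, b, b) != 0.
Proof.
move=> Fk leb; rewrite cf_y ?mem_tidxs ?Fk ?leb // eqxx mulr1.
by rewrite mulf_neq0 ?signr_eq0 // w_anti_neq0.
Qed.
Lemma L1y_inj X : L1 X *m yv = 0 -> X = 0.
Proof.
rewrite /yv mulmxA => e; have uw := SL2_unit (SL2_wey C).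
have XE : X *m wey2 = wey2 *m (invmx wey2 *m X *m wey2) by rewrite -mulmxA mulKVmx.
rewrite (rhoT1_L1 _ uF XE) -(mulmxA (rho1 wey2)) in e.
have /L1w_inj X0 : L1 (invmx wey2 *m X *m wey2) *m w = 0.
  by rewrite -[LHS](mulKmx (rhoT1_unit succn uF (SL2_wey C))) e mulmx0.
by rewrite -[X](mulmxK uw) XE X0 mulmx0 mul0mx.
Qed.

(* The Lie algebra of the stabilizer of the orbit of w. *)
Definition lieG N := forall g, SL2 g ->
  exists2 X, \tr X = 0 & N *m (rho1 g *m w) = L1 X *m (rho1 g *m w).

Lemma lieG0 : lieG 0.
Proof. by move=> g _; exists 0; rewrite ?mxtrace0 // L10 // !mul0mx. Qed.
Lemma lieG_lin (c : C) N N' : lieG N -> lieG N' -> lieG (c *: N + N').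
Proof.
move=> GN GN' g Sg; have [X tX e] := GN g Sg; have [X' tX' e'] := GN' g Sg.
exists (c *: X + X'); first by rewrite mxtraceD mxtraceZ tX tX' mulr0 addr0.
by rewrite L1_lin // !mulmxDl -!scalemxAl e e'.
Qed.
Lemma lieG_L1 X : \tr X = 0 -> lieG (L1 X).
Proof. by move=> tX g _; exists X. Qed.
Lemma lieG_L2 X : \tr X = 0 -> lieG (L2 X).
Proof.
move=> tX g Sg; exists (- (g *m X *m invmx g)).
  by rewrite linearN /= conj_tr // tX oppr0.
have L2w : L2 X *m w = - (L1 X *m w).
  rewrite (tr0E tX) !(L1D, L2D) // !(L1Z, L2Z) // !mulmxDl -!scalemxAl L2e_w L2f_w L2h_w.
  by rewrite !scalerN !opprD.
rewrite L1N // mulNmx !mulmxA -rho_conj // -!mulmxA mulmxA -rho1_L2C // -mulmxA L2w.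
by rewrite mulmxN.
Qed.

Lemma lieG_conj1 g N : SL2 g -> lieG N -> lieG (rho1 g *m N *m rho1 (invmx g)).
Proof.
move=> Sg GN h Sh; have [X tX e] := GN _ (SL2_M (SL2_V Sg) Sh).
exists (g *m X *m invmx g); first by rewrite conj_tr.
rewrite rhoT1M // in e.
by rewrite -!mulmxA (mulmxA (rho1 (invmx g))) e !mulmxA rho_conj // -!mulmxA
   (mulmxA (rho1 g) (rho1 (invmx g))) rhoT1V // mul1mx.
Qed.
(** The second factor acts on the orbit by right translation, so the condition at [h] becomes the
    one at [h *m g]. *)
Lemma lieG_conj2 g N : SL2 g -> lieG N -> lieG (rho2 g *m N *m rho2 (invmx g)).
Proof.
move=> Sg GN h Sh; have [X tX e] := GN _ (SL2_M Sh Sg); exists X => //.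
have rw g' h' : SL2 g' -> rho2 g' *m (rho1 h' *m w) = rho1 (h' *m invmx g') *m w.
  by move=> Sg'; rewrite mulmxA -rho12C // -mulmxA rho2_w // mulmxA rhoT1M.
rewrite -!mulmxA rw; last exact: SL2_V.
by rewrite invmxK e mulmxA rho2_L1C // -mulmxA rw // mulmxK // SL2_unit.
Qed.

Lemma lieG_ad1e N : lieG N -> lieG (lie (L1 e2) N).
Proof.
move=> GN; have [N1 [d [d1 N0 NE1 NE]]] := unip_curve C succn uF.
have := @prod_curve C _ _ lieG N1 N (fun i => (-1) ^+ i *: N1 i) d d lieG0 lieG_lin d1 d1.
rewrite expr0 scale1r N0 NE1 expr1 scaleN1r mulmxN => H; apply: H => // t.
by rewrite -curve_opp -!NE -invmx_unip; apply/lieG_conj1/GN/SL2_unip.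
Qed.
Lemma lieG_ad1f N : lieG N -> lieG (lie (L1 f2) N).
Proof.
move=> GN; have [N1 [d [d1 N0 NE1 NE]]] := low_curve C succn uF.
have := @prod_curve C _ _ lieG N1 N (fun i => (-1) ^+ i *: N1 i) d d lieG0 lieG_lin d1 d1.
rewrite expr0 scale1r N0 NE1 expr1 scaleN1r mulmxN => H; apply: H => // t.
by rewrite -curve_opp -!NE -invmx_low; apply/lieG_conj1/GN/SL2_low.
Qed.
Lemma lieG_ad2e N : lieG N -> lieG (lie (L2 e2) N).
Proof.
move=> GN; have [N1 [d [d1 N0 NE1 NE]]] := unip_curve2 C uF.
have := @prod_curve C _ _ lieG N1 N (fun i => (-1) ^+ i *: N1 i) d d lieG0 lieG_lin d1 d1.
rewrite expr0 scale1r N0 NE1 expr1 scaleN1r mulmxN => H; apply: H => // t.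
by rewrite -curve_opp -!NE -invmx_unip; apply/lieG_conj2/GN/SL2_unip.
Qed.
Lemma lieG_ad2f N : lieG N -> lieG (lie (L2 f2) N).
Proof.
move=> GN; have [N1 [d [d1 N0 NE1 NE]]] := low_curve2 C uF.
have := @prod_curve C _ _ lieG N1 N (fun i => (-1) ^+ i *: N1 i) d d lieG0 lieG_lin d1 d1.
rewrite expr0 scale1r N0 NE1 expr1 scaleN1r mulmxN => H; apply: H => // t.
by rewrite -curve_opp -!NE -invmx_low; apply/lieG_conj2/GN/SL2_low.
Qed.

(** The curve of orbit points through [rho1 g *m w] is translated back to start at [w], where its
    tangent is known. *)
Lemma lieG_velocity A (N : nat -> 'M[C]_n) d : (1 < d)%N -> N 0%N = 1%:M ->
  A \in unitmx ->
  (forall t g, SL2 g -> orbitH w (A *m (\sum_(i < d) t ^+ i *: N i) *m invmx A *m (rho1 g *m w))) ->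
  lieG (A *m N 1%N *m invmx A).
Proof.
move=> d1 N0 uA No g Sg.
have [|t|X tX e] := @orbit_curve d
  (fun i => rho1 (invmx g) *m (A *m N i *m invmx A *m (rho1 g *m w))) d1.
- by rewrite N0 mulmx1 mulmxV // mul1mx mulmxA rhoT1K // mul1mx.
- have := proj1 (orbitH_rho uF w _ (SL2_V Sg)) (No t g Sg).
  rewrite mulmx_sumr !mulmx_suml mulmx_sumr; set S := \sum_(i < d) _.
  suff -> : \sum_(i < d) t ^+ i *: (rho1 (invmx g) *m (A *m N i *m invmx A *m (rho1 g *m w)))
    = S by [].
  by apply: eq_bigr => i _; rewrite -scalemxAr -!scalemxAl -scalemxAr.
exists (g *m X *m invmx g); first by rewrite conj_tr.
have := congr1 (mulmx (rho1 g)) e; rewrite mulmxA rhoT1V // mul1mx => ->.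
by rewrite !mulmxA rho_conj.
Qed.
End Vector.

(** * Weights and raising for the adjoint action *)

Section LieGen.
Variable C : numClosedFieldType.

(** The factors $T-b$ are applied one at a time; the last vector before 0 is an eigenvector and
    still satisfies [P]. *)
Lemma eig_exists (V : lmodType C) (P : V -> Prop) (T : V -> V) (bs : seq C) (x : V) :
  P x -> x != 0 -> (forall b y, P y -> P (T y - b *: y)) ->
  foldl (fun y b => T y - b *: y) x bs = 0 ->
  exists b y, [/\ P y, y != 0 & T y = b *: y].
Proof.
move=> Px x0 PT; elim: bs x Px x0 => [|b bs IHbs] x Px x0 /=.
  by move=> e; rewrite e eqxx in x0.
have [e _|ne] := eqVneq (T x - b *: x) 0; last by apply: IHbs => //; apply: PT.
by exists b, x; split=> //; apply/eqP; rewrite -subr_eq0 e.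
Qed.

Lemma lie_jacobi n (A B N : 'M[C]_n) :
  lie A (lie B N) = lie (lie A B) N + lie B (lie A N).
Proof.
rewrite /lie !(mulmxBr, mulmxBl, mulmxA).
move: (A *m B *m N) (A *m N *m B) (B *m N *m A) (N *m B *m A) (B *m A *m N)
  (N *m A *m B) => c1 c2 c3 c4 c5 c6.
by apply/matrixP => p q; rewrite !mxE; ring.
Qed.
Lemma lieDr n (A B N : 'M[C]_n) : lie A (B + N) = lie A B + lie A N.
Proof. by rewrite /lie mulmxDr mulmxDl opprD addrACA. Qed.
Lemma lieZr n (A : 'M[C]_n) c N : lie A (c *: N) = c *: lie A N.
Proof. by rewrite /lie -scalemxAr -scalemxAl scalerBr. Qed.
Lemma lieNr n (A N : 'M[C]_n) : lie A (- N) = - lie A N.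
Proof. by rewrite -!scaleN1r lieZr. Qed.
Lemma lieDl n (A B N : 'M[C]_n) : lie (A + B) N = lie A N + lie B N.
Proof. by rewrite /lie mulmxDr mulmxDl opprD addrACA. Qed.
Lemma lieZl n (A : 'M[C]_n) c N : lie (c *: A) N = c *: lie A N.
Proof. by rewrite /lie -scalemxAr -scalemxAl scalerBr. Qed.
Lemma lie0r n (A : 'M[C]_n) : lie A 0 = 0.
Proof. by rewrite /lie mulmx0 mul0mx subrr. Qed.
Lemma lieC n (A B : 'M[C]_n) : lie A B = - lie B A.
Proof. by rewrite /lie opprB. Qed.
Lemma lie_eq0 n (A B : 'M[C]_n) : A *m B = B *m A -> lie A B = 0.
Proof. by rewrite /lie => ->; rewrite subrr. Qed.
Lemma lie0_comm n (A B : 'M[C]_n) : lie A B = 0 -> A *m B = B *m A.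
Proof. by move/eqP; rewrite subr_eq0 => /eqP. Qed.
Lemma tr_lie n (A B : 'M[C]_n) : \tr (lie A B) = 0.
Proof. by rewrite /lie linearB /= mxtrace_mulC subrr. Qed.
Lemma tr_lieM n (E N Y : 'M[C]_n) : \tr (lie E N *m Y) = \tr (N *m lie Y E).
Proof.
rewrite /lie mulmxBl mulmxBr !linearB /= -!mulmxA [in LHS]mxtrace_mulC -!mulmxA.
by [].
Qed.

(** Each bracket with [E] raises the weight by 2. Only weights in [bs] occur on nonzero matrices, so
    the sequence reaches 0, and its last nonzero term is annihilated by [E]. *)
Lemma ad_raise n (P : 'M[C]_n -> Prop) (E H N : 'M[C]_n) (bs : seq C) al :
  lie H E = 2 *: E -> (forall M b, M != 0 -> lie H M = b *: M -> b \in bs) ->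
  (forall M, P M -> P (lie E M)) -> P N -> N != 0 -> lie H N = al *: N ->
  exists be M, [/\ P M, M != 0, lie H M = be *: M & lie E M = 0].
Proof.
move=> HE bsP PE PN N0 HN; pose f i := iter i (lie E) N.
have Pf i : P (f i) by elim: i => //= i; apply: PE.
have Hf i : lie H (f i) = (al + 2 * i%:R) *: f i.
  elim: i => [|i IHi]; first by rewrite mulr0 addr0.
  rewrite /= lie_jacobi HE lieZl IHi lieZr -scalerDl -natr1; congr (_ *: _); ring.
have ex0 : exists i, f i == 0.
  apply: contrapT => nex; have fn0 i : f i != 0 by apply/negP => fi; apply: nex; exists i.
  pose s := [seq al + 2 * i%:R | i <- iota 0 (size bs).+1].
  have us : uniq s.
    rewrite map_inj_uniq ?iota_uniq // => i j /addrI /mulfI e.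
    have n2 : (2 : C) != 0 by rewrite pnatr_eq0.
    by apply/eqP; rewrite -(eqr_nat C) (e n2).
  have sub : {subset s <= bs} by move=> _ /mapP [i _ ->]; apply: bsP (fn0 i) (Hf i).
  by have := uniq_leq_size us sub; rewrite size_map size_iota ltnn.
have [j fj0 jmin] := ex_minnP ex0.
case: j fj0 jmin => [|j] fj0 jmin; first by rewrite /f /= (negPf N0) in fj0.
exists (al + 2 * j%:R), (f j); split=> //; last exact/eqP.
by apply/negP => /jmin; rewrite ltnn.
Qed.
End LieGen.

Section Weights.
Variable C : numClosedFieldType.
Variables (F : seq nat) (m : nat -> nat).
Hypothesis uF : uniq F.
Local Notation n := (dimT F m).
Variables (H : 'M[C]_n) (om : nat * nat * nat -> C).
Hypothesis HE : forall N s t, s \in tidx F m -> t \in tidx F m ->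
  cm (lie H N) s t = (om s - om t) * cm N s t.

(** Bracketing with [H] is diagonal on matrix entries; these are all its eigenvalues. *)
Definition wt_diffs := [seq om s - om t | s <- tidx F m, t <- tidx F m].

Lemma wt_diffP N b : N != 0 -> lie H N = b *: N -> b \in wt_diffs.
Proof.
move=> N0 e; have [s [t [ss tt ne]]] : exists s t, [/\ s \in tidx F m,
    t \in tidx F m & cm N s t != 0].
  apply: contrapT => nex; case/eqP: N0; apply: cmP => // s t ss tt.
  rewrite cm0; apply/eqP; apply: contraT => ne; case: nex; by exists s, t.
have := HE N ss tt; rewrite e cmZ => /(mulIf ne) ->.
by apply/allpairsP; exists (s, t).
Qed.

Lemma wt_diffs_kill N : foldl (fun M b => lie H M - b *: M) N wt_diffs = 0.
Proof.
have E bs s t : s \in tidx F m -> t \in tidx F m ->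
    cm (foldl (fun M b => lie H M - b *: M) N bs) s t =
    \prod_(b <- bs) (om s - om t - b) * cm N s t.
  move=> ss tt; elim: bs N => [|b bs IHbs] N' /=; first by rewrite big_nil mul1r.
  by rewrite IHbs big_cons cmD cmN cmZ HE //; ring.
apply: cmP => // s t ss tt; rewrite E // cm0.
suff -> : \prod_(b <- wt_diffs) (om s - om t - b) = 0 by rewrite mul0r.
apply/eqP; rewrite prodf_seq_eq0; apply/hasP; exists (om s - om t).
  by apply/allpairsP; exists (s, t).
by rewrite /= subrr.
Qed.
End Weights.

Section HighestWeightVectors.
Variable C : numClosedFieldType.
Variable F : seq nat.
Hypothesis uF : uniq F.
Hypothesis F0 : F != [::].
Hypothesis Fpos : forall k, k \in F -> (0 < k)%N.
Local Notation n := (dimT F succn).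
Local Notation L1 := (@L1 C F succn).
Local Notation L2 := (@L2 C F).
Local Notation rho1 := (@rhoT1 C F succn).
Local Notation rho2 := (@rhoT2 C F succn).
Implicit Types (k a b : nat) (g h X Y : 'M[C]_2) (A B z N : 'M[C]_n) (v : 'cV[C]_n).

Definition om1 (s : nat * nat * nat) : C := wt C s.1.1 s.2.
Definition om2 (s : nat * nat * nat) : C := wt C s.1.1 s.1.2.

Lemma ad_h1 N s t : s \in tidx F succn -> t \in tidx F succn ->
  cm (lie (L1 h2) N) s t = (om1 s - om1 t) * cm N s t.
Proof.
case: s t => [[k b] a] [[k' b'] a'] ss tt; rewrite /lie cmD cmN cm_L1hl // cm_L1hr //.
by rewrite [RHS]mulrBl.
Qed.
Lemma ad_h2 N s t : s \in tidx F succn -> t \in tidx F succn ->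
  cm (lie (L2 h2) N) s t = (om2 s - om2 t) * cm N s t.
Proof.
case: s t => [[k b] a] [[k' b'] a'] ss tt; rewrite /lie cmD cmN cm_L2hl // cm_L2hr //.
by rewrite [RHS]mulrBl.
Qed.

Lemma lie_he : lie h2 e2 = 2 *: (e2 : 'M[C]_2).
Proof. by rewrite -lie_efe /lie lie_ef. Qed.
Lemma lie_hf : lie h2 f2 = (-2) *: (f2 : 'M[C]_2).
Proof. by rewrite -lie_eff /lie lie_ef. Qed.

Lemma lie_L1L2 X Y : lie (L1 X) (L2 Y) = 0.
Proof. by apply: lie_eq0; apply: L12C. Qed.

(** $\mathfrak{sl}_2$ is spanned by brackets, and invariance of the trace form moves such a bracket
    to a commuting pair. *)
Lemma tr_L12 X Y : \tr X = 0 -> \tr (L1 X *m L2 Y) = 0.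
Proof.
move=> tX; have B (U V : 'M[C]_2) : \tr (L1 (lie U V) *m L2 Y) = 0.
  by rewrite L1_lie // tr_lieM -[lie (L2 Y) _]opprK -lieC lie_L1L2 oppr0 mulmx0 mxtrace0.
have n2 : (2 : C) != 0 by rewrite pnatr_eq0.
have e0 : \tr (L1 e2 *m L2 Y) = 0.
  by apply: (mulfI n2); rewrite mulr0 -mxtraceZ scalemxAl -L1Z // -lie_he B.
have f0 : \tr (L1 f2 *m L2 Y) = 0.
  have n2' : (-2 : C) != 0 by rewrite oppr_eq0.
  by apply: (mulfI n2'); rewrite mulr0 -mxtraceZ scalemxAl -L1Z // -lie_hf B.
rewrite (tr0E tX) !(L1D, L1Z) // !mulmxDl -!scalemxAl !mxtraceD !mxtraceZ e0 f0.
by rewrite -lie_ef -/(lie e2 f2) B !mulr0 !addr0.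
Qed.

(** The diagonal entries are natural numbers, one of them positive. This makes the trace form
    nondegenerate on each copy of $\mathfrak{sl}_2$. *)
Lemma tr_L1ef_neq0 : \tr (L1 e2 *m L1 f2) != 0.
Proof.
have pE (p : 'I_n) : (L1 e2 *m L1 f2) p p =
    ((tix p).2.+1 * ((tix p).1.1 - (tix p).2))%:R.
  rewrite -(cm_tix uF); have := tix_mem p.
  case: (tix p) => [[k b] a] vd /=; rewrite cm_L1el // natrM; congr (_ * _).
  move: (vd); rewrite mem_tidxs => /and3P[Fk leb lea].
  have [lt|ge] := ltnP a k; last first.
    have -> : (k - a)%N = 0%N by apply/eqP.
    rewrite cm_outl //; by rewrite mem_tidxs [(a < k)%N]ltnNge ge !andbF.
  rewrite cm_lift1 ?mem_tidxs ?Fk ?leb ?lea //= !eqxx /= drhoE_f //.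
  by rewrite eqxx mulr1.
rewrite /mxtrace; under eq_bigr do rewrite pE.
rewrite -natr_sum pnatr_eq0 sum_nat_eq0 negb_forall.
have k0F := k0F F0; set k := head _ _ in k0F.
have [p pp] : exists p : 'I_n, tix p = (k, 0%N, 0%N).
  by apply: tix_surj; rewrite mem_tidxs k0F.
apply/existsP; exists p; rewrite pp /= mul1n subn0 -lt0n; exact: Fpos.
Qed.

Lemma tr_L1_form : [/\ \tr (L1 e2 *m L1 e2) = 0, \tr (L1 f2 *m L1 f2) = 0,
   \tr (L1 h2 *m L1 e2) = 0, \tr (L1 h2 *m L1 f2) = 0
   & \tr (L1 h2 *m L1 h2) = 2 * \tr (L1 e2 *m L1 f2)].
Proof.
have n2 : (2 : C) != 0 by rewrite pnatr_eq0.
have n2' : (-2 : C) != 0 by rewrite oppr_eq0.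
have trC A B : \tr (A *m lie B A) = 0.
  by rewrite -tr_lieM lie_eq0 // mul0mx mxtrace0.
have he : lie (L1 h2) (L1 e2) = 2 *: L1 e2 by rewrite -L1_lie // lie_he L1Z.
have hf : lie (L1 h2) (L1 f2) = (-2) *: L1 f2 by rewrite -L1_lie // lie_hf L1Z.
split.
- by apply: (mulfI n2); rewrite mulr0 -mxtraceZ scalemxAr -he trC.
- by apply: (mulfI n2'); rewrite mulr0 -mxtraceZ scalemxAr -hf trC.
- apply: (mulfI n2); rewrite mulr0 -mxtraceZ scalemxAr -he lieC mulmxN linearN /=.
  by rewrite trC oppr0.
- apply: (mulfI n2'); rewrite mulr0 -mxtraceZ scalemxAr -hf lieC mulmxN linearN /=.
  by rewrite trC oppr0.
- rewrite -{1}lie_ef -/(lie e2 f2) L1_lie // tr_lieM he -scalemxAr mxtraceZ.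
  by rewrite mxtrace_mulC.
Qed.

Lemma tr_L2M X Y : \tr (L2 X *m L2 Y) = \tr (L1 X *m L1 Y).
Proof. by rewrite !L2E // -conjPM // conjP_tr. Qed.
End HighestWeightVectors.

(** * Highest weight vectors in the Lie algebra of the stabilizer *)

Section LieStabilizer.
Variable C : numClosedFieldType.
Variable F : seq nat.
Hypothesis uF : uniq F.
Hypothesis F0 : F != [::].
Hypothesis Fpos : forall k, k \in F -> (0 < k)%N.
Local Notation n := (dimT F succn).
Local Notation L1 := (@L1 C F succn).
Local Notation L2 := (@L2 C F).
Local Notation rho1 := (@rhoT1 C F succn).
Local Notation rho2 := (@rhoT2 C F succn).
Implicit Types (k a b : nat) (g h X Y : 'M[C]_2) (A B z N : 'M[C]_n) (v : 'cV[C]_n).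

(** The projection to the eigenspace of [L1 h2] for the eigenvalue [c]. *)
Definition Pi (c : C) : 'M[C]_n :=
  lift1 F succn (fun k a a' => (a == a')%:R * (wt C k a == c)%:R).

Lemma cf_Pi c v k b a : (k, b, a) \in tidx F succn ->
  cf (Pi c *m v) (k, b, a) = (wt C k a == c)%:R * cf v (k, b, a).
Proof.
move=> vd; rewrite cf_lift1 //; move: vd; rewrite mem_tidxs // => /and3P[_ _ lea].
rewrite (sum_ord_nat (G := fun d => (a == d)%:R * (wt C k a == c)%:R * cf v (k, b, d)) lea).
  by rewrite eqxx mul1r.
by move=> d ne; rewrite eq_sym (negPf ne) !mul0r.
Qed.

Lemma comm_Pi N al c : lie (L1 h2) N = al *: N -> N *m Pi c = Pi (c + al) *m N.
Proof.
move=> e; apply: cmP => // -[[k b] a] [[k' b'] a'] s t.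
rewrite cm_lift1r // cm_lift1l //.
have := s; have := t; rewrite !mem_tidxs // => /and3P[Fk' leb' lea'] /and3P[Fk leb lea].
rewrite (sum_ord_nat (G := fun d => cm N (k, b, a) (k', b', d) *
   ((d == a')%:R * (wt C k' d == c)%:R)) lea'); last first.
  by move=> d /negPf ->; rewrite mul0r mulr0.
rewrite (sum_ord_nat (G := fun d => (a == d)%:R * (wt C k a == c + al)%:R *
   cm N (k, b, d) (k', b', a')) lea); last first.
  by move=> d ne; rewrite eq_sym (negPf ne) !mul0r.
rewrite !eqxx !mul1r mulrC.
have [->|ne] := eqVneq (cm N (k, b, a) (k', b', a')) 0; first by rewrite !mulr0.
have := ad_h1 uF N s t; rewrite e cmZ => /(mulIf ne) ->.
rewrite /om1 /=; move: (wt C k a) (wt C k' a') => x x'.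
suff -> : (x == c + (x - x')) = (x' == c) by [].
by rewrite -subr_eq0 -[RHS]subr_eq0; congr (_ == 0); ring.
Qed.

Lemma iterM N A v i : N *m A = A *m N ->
  iter i (mulmx A) (N *m v) = N *m iter i (mulmx A) v.
Proof. by move=> c; elim: i => //= i ->; rewrite !mulmxA c. Qed.

Lemma cf_iter1 v i k b a : (k, b, a) \in tidx F succn ->
  cf (iter i (mulmx (L1 e2)) v) (k, b, a) = ((a + i) ^_ i)%:R * cf v (k, b, (a + i)%N).
Proof.
elim: i k b a => [|i IHi] k b a vd; first by rewrite /= ffactn0 mul1r addn0.
rewrite /= cf_L1e // ffactnSr addnS subSn ?leq_addl // addnK natrM.
have [vd'|nvd] := boolP ((k, b, a.+1) \in tidx F succn).
  by rewrite IHi // addSn; ring.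
rewrite !cf_out ?mulr0 //; move: nvd vd; rewrite !mem_tidxs // => nvd /and3P[Fk leb lea].
by move: nvd; rewrite Fk leb /=; lia.
Qed.

Lemma cf_iter2 v i k b a : (k, b, a) \in tidx F succn ->
  cf (iter i (mulmx (L2 e2)) v) (k, b, a) = ((b + i) ^_ i)%:R * cf v (k, (b + i)%N, a).
Proof.
elim: i k b a => [|i IHi] k b a vd; first by rewrite /= ffactn0 mul1r addn0.
rewrite /= cf_L2e // ffactnSr addnS subSn ?leq_addl // addnK natrM.
have [vd'|nvd] := boolP ((k, b.+1, a) \in tidx F succn).
  by rewrite IHi // addSn; ring.
rewrite !cf_out ?mulr0 //; move: nvd vd; rewrite !mem_tidxs // => nvd /and3P[Fk leb lea].
by move: nvd; rewrite Fk lea !andbT /=; lia.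
Qed.

Let K := (\max_(l <- F) l)%N.
Lemma maxF_mem : K \in F.
Proof.
rewrite /K; elim: F F0 => // k [_ _|k' r IHr _]; first by rewrite big_seq1 mem_head.
rewrite big_cons inE; case: (leqP k (\max_(l <- k' :: r) l)) => [_|/ltnW/maxn_idPl e].
  by rewrite IHr ?orbT.
by rewrite eqxx.
Qed.
Lemma leK k : k \in F -> (k <= K)%N.
Proof. exact: leq_maxF. Qed.

Variable w : 'cV[C]_n.
Hypothesis wfix : forall g, SL2 g -> rhoDiag F g *m w = w.
Hypothesis wnz : forall k, k \in F -> exists b a, cf w (k, b, a) != 0.
Local Notation y := (yv w).
Local Notation yc c := (Pi c *m yv w).

Lemma wt_eq k a k' a' : (a <= k)%N -> (a' <= k')%N ->
  (wt C k a == wt C k' a') = (k + 2 * a' == k' + 2 * a)%N.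
Proof.
move=> lea lea'; rewrite /wt -subr_eq0 -(eqr_nat C) -[RHS]subr_eq0.
by rewrite !natrD; congr (_ == 0); ring.
Qed.

(** Descending induction on the degree. The part of [y] of weight $-k$ is a nonzero multiple of the
    lowest vector of $R_k\otimes\bar R_k$ plus terms of larger degree, so [N] kills that vector;
    commuting with both raising operators, it kills all of $R_k\otimes\bar R_k$. *)
Lemma lie_hwv_eq0 N al : lie (L1 h2) N = al *: N -> N *m L1 e2 = L1 e2 *m N ->
  N *m L2 e2 = L2 e2 *m N -> N *m y = 0 -> N = 0.
Proof.
move=> eN e1N e2N Ny.
suff N0 d k : k \in F -> (K - k < d)%N -> forall s b a, s \in tidx F succn ->
    (b <= k)%N -> (a <= k)%N -> cm N s (k, b, a) = 0.
  apply: cmP => // s [[k b] a] ss; rewrite mem_tidxs // => /and3P[Fk leb lea].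
  by rewrite cm0 (N0 (K - k).+1).
elim: d k => // d IHd k Fk ltd.
have vd a b : (b <= k)%N -> (a <= k)%N -> (k, b, a) \in tidx F succn.
  by move=> leb lea; rewrite mem_tidxs // Fk leb.
have low s : s \in tidx F succn -> cm N s (k, k, k) = 0.
  move=> ss; have e : N *m yc (wt C k k) = 0.
    by rewrite mulmxA (comm_Pi _ eN) -mulmxA Ny mulmx0.
  have := congr1 (fun u => cf u s) e; rewrite cf0 cf_mul //.
  rewrite (bigD1_seq (k, k, k)) ?tidx_uniq ?vd //= big1_seq ?addr0.
    rewrite cf_Pi ?vd // eqxx mul1r => /eqP.
    by rewrite mulf_eq0 (negPf (y_neq0 uF F0 wfix wnz Fk (leqnn k))) orbF => /eqP.
  move=> [[k' b] a] /andP[ne]; rewrite mem_tidxs // => /and3P[Fk' leb lea].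
  have vd' : (k', b, a) \in tidx F succn by rewrite mem_tidxs // Fk' leb.
  rewrite cf_Pi // wt_eq //; case: eqP => [ek|]; last by rewrite mul0r mulr0.
  have [eb|nb] := eqVneq a b; last by rewrite (y_off uF F0 wfix) // !mulr0.
  have [lt|ge] := ltnP k k'; last first.
    case/negP: ne; rewrite -eb; have -> : k' = k by lia.
    have -> : a = k by lia.
    exact: eqxx.
  by rewrite IHd ?mul0r //; have := leK Fk'; lia.
have rowa s b a : s \in tidx F succn -> (b <= k)%N -> (a < k)%N ->
    (forall s', s' \in tidx F succn -> cm N s' (k, b, a.+1) = 0) -> cm N s (k, b, a) = 0.
  case: s => [[k' b'] a'] ss leb lta N1.
  have n0 : (a.+1%:R : C) != 0 by rewrite pnatr_eq0.
  apply: (mulfI n0); rewrite mulr0 -(cm_L1er uF N ss (vd a.+1 b leb lta)) e1N cm_L1el ?vd //.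
  have [v1|v1] := boolP ((k', b', a'.+1) \in tidx F succn); first by rewrite N1 // mulr0.
  by rewrite cm_outl // mulr0.
have rowb s b a : s \in tidx F succn -> (b < k)%N -> (a <= k)%N ->
    (forall s', s' \in tidx F succn -> cm N s' (k, b.+1, a) = 0) -> cm N s (k, b, a) = 0.
  case: s => [[k' b'] a'] ss ltb lea N1.
  have n0 : (b.+1%:R : C) != 0 by rewrite pnatr_eq0.
  apply: (mulfI n0); rewrite mulr0 -(cm_L2er uF N ss (vd a b.+1 ltb lea)) e2N cm_L2el ?vd //.
  have [v1|v1] := boolP ((k', b'.+1, a') \in tidx F succn); first by rewrite N1 // mulr0.
  by rewrite cm_outl // mulr0.
have col i s : s \in tidx F succn -> (i <= k)%N -> cm N s (k, (k - i)%N, k) = 0.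
  elim: i s => [|i IHi] s ss lti; first by rewrite subn0 low.
  apply: rowb => //; first by lia.
  by move=> s' ss'; rewrite subnSK // IHi // ltnW.
move=> s b a ss leb lea.
suff H i : (i <= k)%N -> forall s, s \in tidx F succn -> cm N s (k, b, (k - i)%N) = 0.
  by rewrite -(subKn lea) H // leq_subr.
elim: i => [|i IHi] lti s' ss'.
  by rewrite subn0 -(subKn leb) col // leq_subr.
apply: rowa => //; first by lia.
by move=> s2 ss2; rewrite subnSK // IHi // ltnW.
Qed.

Lemma yK_entry k b a : (k, b, a) \in tidx F succn ->
  cf (yc (wt C K K)) (k, b, a) != 0 -> [/\ k = K, b = K & a = K].
Proof.
move=> vd; rewrite cf_Pi //; move: (vd); rewrite mem_tidxs // => /and3P[Fk leb lea].
rewrite wt_eq //; have lekK := leK Fk.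
have [e|_] := eqVneq (k + 2 * K)%N (K + 2 * a)%N; last by rewrite mul0r eqxx.
have [eb|nb] := eqVneq a b; last by rewrite (y_off uF F0 wfix) // mulr0 eqxx.
by move=> _; split; lia.
Qed.

Lemma yK_neq0 : cf (yc (wt C K K)) (K, K, K) != 0.
Proof.
rewrite cf_Pi ?mem_tidxs ?maxF_mem ?leqnn // eqxx mul1r.
by rewrite (y_neq0 uF F0 wfix wnz) // maxF_mem.
Qed.

(** Only the lowest weight vectors in the largest degree $K$ survive $K$ raisings, and their weight
    is $-K$. *)
Lemma iter1_yc c : c != wt C K K -> iter K (mulmx (L1 e2)) (yc c) = 0.
Proof.
move=> ne; apply: cfP => // -[[k b] a] vd; rewrite cf_iter1 // cf0.
have [vd'|?] := boolP ((k, b, (a + K)%N) \in tidx F succn); last by rewrite cf_out ?mulr0.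
rewrite cf_Pi //; move: (vd'); rewrite mem_tidxs // => /and3P[Fk _ le].
have lekK := leK Fk; have -> : k = K by lia.
have -> : (a + K)%N = K by lia.
by rewrite eq_sym (negPf ne) mul0r mulr0.
Qed.
Lemma iter2_yc c : c != wt C K K -> iter K (mulmx (L2 e2)) (yc c) = 0.
Proof.
move=> ne; apply: cfP => // -[[k b] a] vd; rewrite cf_iter2 // cf0.
have [vd'|?] := boolP ((k, (b + K)%N, a) \in tidx F succn); last by rewrite cf_out ?mulr0.
have [eb|nb] := eqVneq a (b + K)%N; last by rewrite cf_Pi // (y_off uF F0 wfix) // !mulr0.
rewrite cf_Pi //; move: (vd'); rewrite mem_tidxs // => /and3P[Fk le _].
have lekK := leK Fk; have -> : k = K by lia.
have -> : a = K by lia.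
by rewrite eq_sym (negPf ne) mul0r mulr0.
Qed.

Lemma N_yc N al c X : lie (L1 h2) N = al *: N -> N *m y = L1 X *m y ->
  N *m yc c = Pi (c + al) *m (L1 X *m y).
Proof. by move=> e eX; rewrite mulmxA (comm_Pi _ e) -mulmxA eX. Qed.

Lemma lie1_he : lie (L1 h2) (L1 e2) = 2 *: L1 e2.
Proof. by rewrite -L1_lie // lie_he L1Z. Qed.
Lemma lie2_he : lie (L2 h2) (L2 e2) = 2 *: L2 e2.
Proof. by rewrite -L2_lie // lie_he L2Z. Qed.

Lemma lie_app A N al (u : 'cV[C]_n) : lie A N = al *: N ->
  A *m (N *m u) = al *: (N *m u) + N *m (A *m u).
Proof. by move=> e; rewrite scalemxAl -e /lie mulmxBl !mulmxA subrK. Qed.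

Lemma ffK_neq0 a : ((a + K) ^_ K)%:R != 0 :> C.
Proof. by rewrite pnatr_eq0 -lt0n ffact_gt0 leq_addl. Qed.
Lemma K0 : (0 < K)%N. Proof. exact/Fpos/maxF_mem. Qed.

(** With $Ny=Xy$, the matrix [X] has weight $\alpha-\beta$ and is a multiple of $e$, $f$ or $h$.
    Restriction to single weight spaces and raising $K$ times force $\beta=0$ for $e$ and $\alpha=0$
    for $f$; the expected multiple then agrees with [N] on [y], hence everywhere. A nonzero multiple
    of $h$ is contradictory. *)
Lemma hwv_lieG N al be : lieG w N ->
  lie (L1 h2) N = al *: N -> lie (L2 h2) N = be *: N ->
  lie (L1 e2) N = 0 -> lie (L2 e2) N = 0 ->
  exists c : C, N = c *: L1 e2 \/ N = c *: L2 e2.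
Proof.
move=> GN h1N h2N e1N e2N.
have ce1 : N *m L1 e2 = L1 e2 *m N by rewrite (lie0_comm e1N).
have ce2 : N *m L2 e2 = L2 e2 *m N by rewrite (lie0_comm e2N).
have n2 : (2 : C) != 0 by rewrite pnatr_eq0.
have [X tX NyX] : exists2 X, \tr X = 0 & N *m y = L1 X *m y := GN _ (SL2_wey C).
have X11 : X i1 i1 = - X i0 i0 by apply/eqP; rewrite -addr_eq0 addrC -tr2E tX.
(* [L1 h2 - L2 h2] kills [y]. Applied to $Ny=Xy$ it gives $[h,X]y=(\alpha-\beta)Xy$, and [X] is
   determined by its value on [y]. *)
have Xeq : lie h2 X = (al - be) *: X.
  apply/eqP; rewrite -subr_eq0; apply/eqP.
  apply: (L1y_inj uF F0 Fpos wfix wnz); rewrite L1B // L1Z // L1_lie // mulmxBl.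
  rewrite -scalemxAl -NyX.
  have h1y : L1 h2 *m (N *m y) = al *: (N *m y) + N *m (L1 h2 *m y).
    exact: lie_app.
  have h2y : L2 h2 *m (N *m y) = be *: (N *m y) + N *m (L2 h2 *m y).
    exact: lie_app.
  rewrite /lie mulmxBl -!mulmxA -NyX h1y {1}(L1h_y uF wfix).
  rewrite (L1h_y uF wfix) [L1 X *m (L2 h2 *m y)]mulmxA (L12C uF) -mulmxA -NyX h2y.
  by rewrite scalerBl; apply/matrixP => p q; rewrite !mxE; ring.
have X01 : 2 * X i0 i1 = (al - be) * X i0 i1.
  have := congr1 (fun M : 'M_2 => M i0 i1) Xeq; rewrite /lie !mxE !sum2 !mk2E => <-; ring.
have X10 : (-2) * X i1 i0 = (al - be) * X i1 i0.
  have := congr1 (fun M : 'M_2 => M i1 i0) Xeq; rewrite /lie !mxE !sum2 !mk2E => <-; ring.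
have X00 : (al - be) * X i0 i0 = 0.
  have := congr1 (fun M : 'M_2 => M i0 i0) Xeq; rewrite /lie !mxE !sum2 !mk2E => <-; ring.
have vK b a : (b <= K)%N -> (a <= K)%N -> (K, b, a) \in tidx F succn.
  by move=> leb lea; rewrite mem_tidxs // maxF_mem leb.
have [x0|xn0] := eqVneq (X i0 i1) 0; last first.
  have ab : al - be = 2 by apply: (mulIf xn0).
  have X000 : X i0 i0 = 0 by move/eqP: X00; rewrite ab mulf_eq0 (negPf n2) => /eqP.
  have X100 : X i1 i0 = 0.
    have n4 : (4 : C) != 0 by rewrite pnatr_eq0.
    apply: (mulfI n4); rewrite mulr0; rewrite ab in X10.
    transitivity (2 * X i1 i0 - (-2) * X i1 i0); first by ring.
    by rewrite X10 subrr.
  have XE : X = X i0 i1 *: e2.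
    by apply: mx2P; rewrite ?X11 !mxE /= ?X000 ?X100 ?mulr0 ?mulr1 ?oppr0.
  set x := X i0 i1 in xn0 XE.
  have Nyc c : N *m yc c = x *: (L1 e2 *m yc (c + be)).
    rewrite (N_yc _ h1N NyX) XE L1Z // -scalemxAl -scalemxAr; congr (_ *: _).
    rewrite [RHS]mulmxA (comm_Pi _ lie1_he) -mulmxA; congr (Pi _ *m _).
    by rewrite -addrA -ab; ring.
  (* Take $c=-K-\beta$. If $\beta\ne0$, then [L2 e2] applied $K$ times kills the left side, while on
     the right it leaves a nonzero vector that [L1 e2] does not kill. *)
  have be0 : be = 0.
    apply/eqP; apply: contraT => ben0.
    have := Nyc (wt C K K - be); rewrite subrK => /(congr1 (iter K (mulmx (L2 e2)))).
    rewrite iterM // iter2_yc; last by rewrite -subr_eq0 addrAC subrr sub0r oppr_eq0.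
    rewrite mulmx0 scalemxAl iterM; last by rewrite -scalemxAl -scalemxAr (L12C uF).
    move/(congr1 (fun u => cf u (K, 0%N, K.-1))); have leK1 := leq_pred K.
    rewrite cf0 -scalemxAl cfZ cf_L1e ?vK // prednK ?K0 // cf_iter2 ?vK //.
    move/esym/eqP; rewrite !mulf_eq0 (negPf xn0) (negPf (ffK_neq0 0)) pnatr_eq0.
    by rewrite -leqn0 leqNgt K0 /= add0n (negPf yK_neq0).
  exists x; left; apply/eqP; rewrite -subr_eq0; apply/eqP.
  apply: (@lie_hwv_eq0 _ al).
  - rewrite lieDr lieNr lieZr h1N lie1_he scalerBr !scalerA; congr (_ - _ *: _).
    by rewrite -ab be0 subr0 mulrC.
  - by rewrite mulmxBl mulmxBr ce1 -scalemxAl -scalemxAr.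
  - by rewrite mulmxBl mulmxBr ce2 -scalemxAl -scalemxAr (L12C uF).
  - by rewrite mulmxBl NyX XE L1Z // subrr.
have [z0|zn0] := eqVneq (X i1 i0) 0; last first.
  have ab : al - be = -2 by apply/esym/(mulIf zn0).
  have X000 : X i0 i0 = 0.
    by move/eqP: X00; rewrite ab mulf_eq0 oppr_eq0 (negPf n2) => /eqP.
  have XE : X = X i1 i0 *: f2.
    by apply: mx2P; rewrite ?X11 !mxE /= ?X000 ?x0 ?mulr0 ?mulr1 ?oppr0.
  set z := X i1 i0 in zn0 XE.
  have NyE : N *m y = z *: (L2 e2 *m y).
    by rewrite NyX XE L1Z // -scalemxAl (L1f_y uF wfix).
  have Nyc c : N *m yc c = z *: (L2 e2 *m yc (c + al)).
    rewrite mulmxA (comm_Pi _ h1N) -mulmxA NyE -scalemxAr; congr (_ *: _).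
    by rewrite [LHS]mulmxA [RHS]mulmxA /Pi lift12C.
  have al0 : al = 0.
    apply/eqP; apply: contraT => aln0.
    have := Nyc (wt C K K - al); rewrite subrK => /(congr1 (iter K (mulmx (L1 e2)))).
    rewrite iterM // iter1_yc; last by rewrite -subr_eq0 addrAC subrr sub0r oppr_eq0.
    rewrite mulmx0 scalemxAl iterM; last by rewrite -scalemxAl -scalemxAr (L12C uF).
    move/(congr1 (fun u => cf u (K, K.-1, 0%N))); have leK1 := leq_pred K.
    rewrite cf0 -scalemxAl cfZ cf_L2e ?vK // prednK ?K0 // cf_iter1 ?vK //.
    move/esym/eqP; rewrite !mulf_eq0 (negPf zn0) (negPf (ffK_neq0 0)) pnatr_eq0.
    by rewrite -leqn0 leqNgt K0 /= add0n (negPf yK_neq0).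
  exists z; right; apply/eqP; rewrite -subr_eq0; apply/eqP.
  apply: (@lie_hwv_eq0 _ al).
  - rewrite lieDr lieNr lieZr h1N lie_eq0; last by rewrite (L12C uF).
    by rewrite al0 scaler0 !scale0r subrr.
  - by rewrite mulmxBl mulmxBr ce1 -scalemxAl -scalemxAr (L12C uF).
  - by rewrite mulmxBl mulmxBr ce2 -scalemxAl -scalemxAr.
  - by rewrite mulmxBl NyE scalemxAl subrr.
have [s0|sn0] := eqVneq (X i0 i0) 0.
  exists 0; left; rewrite scale0r; apply: (@lie_hwv_eq0 _ al) => //.
  rewrite NyX (_ : X = 0) ?L10 ?mul0mx //.
  by apply: mx2P; rewrite ?X11 ?s0 ?x0 ?z0 mxE ?oppr0.
exfalso; set s := X i0 i0 in sn0.
have XE : X = s *: h2.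
  by apply: mx2P; rewrite ?X11 !mxE /= ?x0 ?z0 ?mulr0 ?mulr1 ?mulrN1.
have lie_hh : lie (L1 h2) (L1 h2) = 0 *: L1 h2 by rewrite lie_eq0 // scale0r.
have hyc c : L1 h2 *m yc c = c *: yc c.
  apply: cfP => // -[[k b] a] vd; rewrite cf_L1h // cfZ cf_Pi //.
  by case: (eqVneq (wt C k a) c) => [->|_]; rewrite ?mul0r ?mulr0.
have Nyc c : N *m yc c = (s * (c + al)) *: yc (c + al).
  rewrite (N_yc _ h1N NyX) XE L1Z // -scalemxAl -scalemxAr -scalerA; congr (_ *: _).
  rewrite -hyc [RHS]mulmxA (comm_Pi _ lie_hh) addr0 -mulmxA //.
have KE : wt C K K = - K%:R by rewrite /wt; ring.
have Kn0 : (K%:R : C) != 0 by rewrite pnatr_eq0 -lt0n K0.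
have sK : s * - K%:R != 0 by rewrite mulf_neq0 // oppr_eq0.
have al0 : al = 0.
  apply/eqP; apply: contraT => aln0.
  have := Nyc (wt C K K - al); rewrite subrK => /(congr1 (iter K (mulmx (L2 e2)))).
  rewrite iterM // iter2_yc; last by rewrite -subr_eq0 addrAC subrr sub0r oppr_eq0.
  rewrite mulmx0 -mul_scalar_mx iterM; last by rewrite scalar_mxC.
  move/(congr1 (fun u => cf u (K, 0%N, K))).
  rewrite cf0 mul_scalar_mx cfZ cf_iter2 ?vK // KE.
  move/esym/eqP; rewrite !mulf_eq0 (negPf (ffK_neq0 0)) add0n -KE (negPf yK_neq0) KE.
  by rewrite -mulf_eq0 (negPf sK).
(* Raising the lowest part of [y] in both factors gives a multiple of its highest part. [N] commutes
   with raising and so multiplies [u] by $-sK$, but it multiplies the highest part of [y] by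
   $sK$. *)
pose u := iter K (mulmx (L1 e2)) (iter K (mulmx (L2 e2)) (yc (wt C K K))).
have Nu : N *m u = (s * - K%:R) *: u.
  have := Nyc (wt C K K); rewrite al0 addr0 {2}KE => E.
  rewrite /u -iterM // -iterM // E -mul_scalar_mx iterM; last by rewrite scalar_mxC.
  rewrite iterM; last by rewrite scalar_mxC.
  by rewrite mul_scalar_mx.
have uE k b a : (k, b, a) \in tidx F succn -> cf u (k, b, a) =
    ((a + K) ^_ K)%:R * (((b + K) ^_ K)%:R * cf (yc (wt C K K)) (k, (b + K)%N, (a + K)%N)).
  move=> vd; rewrite /u cf_iter1 //; congr (_ * _).
  have [vd'|nv] := boolP ((k, b, (a + K)%N) \in tidx F succn); first by rewrite cf_iter2.
  rewrite !cf_out ?mulr0 //; apply: contra nv; rewrite !mem_tidxs //.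
  by case/and3P=> -> leb ->; rewrite (leq_trans (leq_addr K b)).
have u00 : cf u (K, 0%N, 0%N) != 0.
  by rewrite uE ?vK // !mulf_neq0 ?ffK_neq0 // add0n yK_neq0.
have u_off k b a : (k, b, a) \in tidx F succn -> (k, b, a) != (K, 0%N, 0%N) ->
    cf u (k, b, a) = 0.
  move=> vd; rewrite uE // => ne.
  have [vd'|nv] := boolP ((k, (b + K)%N, (a + K)%N) \in tidx F succn); last first.
    by rewrite cf_out // !mulr0.
  have [->|/(yK_entry vd') [ek eb ea]] := eqVneq (cf (yc (wt C K K)) (k, (b + K)%N, (a + K)%N)) 0.
    by rewrite !mulr0.
  by case/eqP: ne; clear -ek eb ea; congr (_, _, _); lia.
have KE0 : wt C K 0%N = K%:R by rewrite /wt mul0rn subr0.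
have yc0_off k b a : (k, b, a) \in tidx F succn -> (k, b, a) != (K, 0%N, 0%N) ->
    cf (yc (wt C K 0%N)) (k, b, a) = 0.
  move=> vd ne; rewrite cf_Pi //; move: (vd); rewrite mem_tidxs // => /and3P[Fk leb lea].
  rewrite wt_eq //; have lekK := leK Fk; case: eqP => [e|_]; last by rewrite mul0r.
  have [eb|nb] := eqVneq a b; last by rewrite (y_off uF F0 wfix) // mulr0.
  by case/eqP: ne; clear -e eb leb lea lekK; congr (_, _, _); lia.
have yc0_n0 : cf (yc (wt C K 0%N)) (K, 0%N, 0%N) != 0.
  by rewrite cf_Pi ?vK // eqxx mul1r (y_neq0 uF F0 wfix wnz) // maxF_mem.
have uy : u = (cf u (K, 0%N, 0%N) / cf (yc (wt C K 0%N)) (K, 0%N, 0%N)) *: yc (wt C K 0%N).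
  apply: cfP => // -[[k b] a] vd; rewrite cfZ.
  have [[-> -> ->]|ne] := eqVneq (k, b, a) (K, 0%N, 0%N); first by rewrite divfK.
  rewrite (u_off _ _ _ vd ne). rewrite (yc0_off _ _ _ vd ne). by rewrite mulr0.
have Nu' : N *m u = (s * K%:R) *: u.
  move: uy; set r := _ / _ => uy; rewrite {1 2}uy -scalemxAr Nyc al0 addr0.
  by rewrite -KE0 !scalerA mulrC.
have /eqP : (s * K%:R + s * K%:R) *: u = 0.
  by rewrite scalerDl -{1}Nu' Nu -scalerDl -mulrDr addNr mulr0 scale0r.
move/eqP/(congr1 (fun v => cf v (K, 0%N, 0%N)))/eqP; rewrite cf0 cfZ mulf_eq0 (negPf u00) orbF.
by rewrite -mulr2n mulrn_eq0 mulf_eq0 (negPf sn0) (negPf Kn0).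
Qed.

End LieStabilizer.

Section LieStabilizer2.
Variable C : numClosedFieldType.
Variable F : seq nat.
Hypothesis uF : uniq F.
Hypothesis F0 : F != [::].
Hypothesis Fpos : forall k, k \in F -> (0 < k)%N.
Local Notation n := (dimT F succn).
Local Notation L1 := (@L1 C F succn).
Local Notation L2 := (@L2 C F).
Local Notation rho1 := (@rhoT1 C F succn).
Local Notation rho2 := (@rhoT2 C F succn).
Implicit Types (k a b : nat) (g h X Y : 'M[C]_2) (A B z N : 'M[C]_n) (v : 'cV[C]_n).
Variable w : 'cV[C]_n.
Hypothesis wfix : forall g, SL2 g -> rhoDiag F g *m w = w.
Hypothesis wnz : forall k, k \in F -> exists b a, cf w (k, b, a) != 0.

Definition orthQ N := [/\ lieG w N, forall X, \tr X = 0 -> \tr (N *m L1 X) = 0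
  & forall X, \tr X = 0 -> \tr (N *m L2 X) = 0].

Lemma orthQ_lin (c : C) N N' : orthQ N -> orthQ N' -> orthQ (c *: N + N').
Proof.
move=> [G1 P1 Q1] [G2 P2 Q2]; split=> [|X tX|X tX]; first exact: lieG_lin.
  by rewrite mulmxDl -scalemxAl mxtraceD mxtraceZ P1 // P2 // mulr0 addr0.
by rewrite mulmxDl -scalemxAl mxtraceD mxtraceZ Q1 // Q2 // mulr0 addr0.
Qed.
Lemma orthQB (c : C) N N' : orthQ N -> orthQ N' -> orthQ (N - c *: N').
Proof. by move=> Q Q'; rewrite addrC -scaleNr; apply: orthQ_lin. Qed.

Lemma orthQ_L1 X N : lieG w (lie (L1 X) N) -> orthQ N -> orthQ (lie (L1 X) N).
Proof.
move=> G [_ P Q]; split=> // Y tY; rewrite tr_lieM.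
  by rewrite -L1_lie // P // tr_lie.
by rewrite lieC lie_L1L2 // oppr0 mulmx0 mxtrace0.
Qed.
Lemma orthQ_L2 X N : lieG w (lie (L2 X) N) -> orthQ N -> orthQ (lie (L2 X) N).
Proof.
move=> G [_ P Q]; split=> // Y tY; rewrite tr_lieM.
  by rewrite lie_L1L2 // mulmx0 mxtrace0.
by rewrite -L2_lie // Q // tr_lie.
Qed.
Lemma orthQ_e1 N : orthQ N -> orthQ (lie (L1 e2) N).
Proof. by move=> QN; apply: (orthQ_L1 _ QN); case: QN => GN _ _; apply: lieG_ad1e. Qed.
Lemma orthQ_f1 N : orthQ N -> orthQ (lie (L1 f2) N).
Proof. by move=> QN; apply: (orthQ_L1 _ QN); case: QN => GN _ _; apply: lieG_ad1f. Qed.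
Lemma orthQ_e2 N : orthQ N -> orthQ (lie (L2 e2) N).
Proof. by move=> QN; apply: (orthQ_L2 _ QN); case: QN => GN _ _; apply: lieG_ad2e. Qed.
Lemma orthQ_f2 N : orthQ N -> orthQ (lie (L2 f2) N).
Proof. by move=> QN; apply: (orthQ_L2 _ QN); case: QN => GN _ _; apply: lieG_ad2f. Qed.

(** $\operatorname{ad}h=[\operatorname{ad}e,\operatorname{ad}f]$, so stability under $e$ and $f$ is
    enough. *)
Lemma orthQ_h1 N : orthQ N -> orthQ (lie (L1 h2) N).
Proof.
move=> QN; have -> : lie (L1 h2) N =
    lie (L1 e2) (lie (L1 f2) N) - 1 *: lie (L1 f2) (lie (L1 e2) N).
  by rewrite lie_jacobi -L1_lie // /lie lie_ef scale1r addrK.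
by apply: orthQB; [apply/orthQ_e1/orthQ_f1|apply/orthQ_f1/orthQ_e1].
Qed.
Lemma orthQ_h2 N : orthQ N -> orthQ (lie (L2 h2) N).
Proof.
move=> QN; have -> : lie (L2 h2) N =
    lie (L2 e2) (lie (L2 f2) N) - 1 *: lie (L2 f2) (lie (L2 e2) N).
  by rewrite lie_jacobi -L2_lie // /lie lie_ef scale1r addrK.
by apply: orthQB; [apply/orthQ_e2/orthQ_f2|apply/orthQ_f2/orthQ_e2].
Qed.

Lemma lie_L12C X Y N : lie (L1 X) (lie (L2 Y) N) = lie (L2 Y) (lie (L1 X) N).
Proof. by rewrite lie_jacobi lie_L1L2 // /lie mul0mx mulmx0 subr0 add0r. Qed.

(** From a nonzero [N], eigenvectors for the two [h2] are chosen and then raised by each [e2]. The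
    two actions commute, so earlier conditions persist up to a shift of weight. The result is a
    multiple of one copy of [e2] and orthogonal to the matching [f2], hence 0. *)
Lemma orthQ_eq0 N : orthQ N -> N = 0.
Proof.
move=> QN; apply/eqP; apply: contraT => N0.
have [c [N1 [Q1 N10 h1]]] := eig_exists QN N0
  (fun (c : C) y Qy => orthQB c (orthQ_h1 Qy) Qy) (wt_diffs_kill uF (ad_h1 uF) N).
have [|c' [N2 [[Q2 h2'] N20 h22]]] := @eig_exists C _
  (fun M => orthQ M /\ lie (L1 h2) M = c *: M) (lie (L2 h2)) _ N1 (conj Q1 h1) N10 _
  (wt_diffs_kill uF (ad_h2 uF) N1).
  move=> d y [Qy hy]; split; first exact: orthQB (orthQ_h2 Qy) Qy.
  by rewrite lieDr lieNr lieZr lie_L12C hy lieZr scalerBr !scalerA mulrC.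
have [|be [N3 [[Q3 h3'] N30 h3 e3]]] := @ad_raise C _
  (fun M => orthQ M /\ lie (L2 h2) M = c' *: M) (L1 e2) (L1 h2) N2 _ c (lie1_he _ uF)
  (wt_diffP uF (ad_h1 uF)) _ (conj Q2 h22) N20 h2'.
  by move=> M [QM hM]; split; [exact: orthQ_e1|rewrite -lie_L12C hM lieZr].
have [|be' [N4 [[Q4 h4 e4] N40 h4' e4']]] := @ad_raise C _
  (fun M => [/\ orthQ M, lie (L1 h2) M = be *: M & lie (L1 e2) M = 0])
  (L2 e2) (L2 h2) N3 _ c' (lie2_he _ uF)
  (wt_diffP uF (ad_h2 uF)) _ (And3 Q3 h3 e3) N30 h3'.
  move=> M [QM hM eM]; split; first exact: orthQ_e2.
    by rewrite lie_L12C hM lieZr.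
  by rewrite lie_L12C eM lie0r.
case: Q4 => G4 P4 P4'.
have [d [E|E]] := hwv_lieG uF F0 Fpos wfix wnz G4 h4 h4' e4 e4'.
  have := P4 _ (tr_f2 C); rewrite E -scalemxAl mxtraceZ => /eqP.
  rewrite mulf_eq0 (negPf (tr_L1ef_neq0 C uF F0 Fpos)) orbF => /eqP d0.
  by rewrite E d0 scale0r eqxx in N40.
have := P4' _ (tr_f2 C); rewrite E -scalemxAl mxtraceZ tr_L2M // => /eqP.
rewrite mulf_eq0 (negPf (tr_L1ef_neq0 C uF F0 Fpos)) orbF => /eqP d0.
by rewrite E d0 scale0r eqxx in N40.
Qed.

Lemma tr_L1_sl2 X Z : \tr X = 0 -> \tr Z = 0 -> \tr (L1 X *m L1 Z) =
  \tr (L1 e2 *m L1 f2) * (X i0 i1 * Z i1 i0 + X i1 i0 * Z i0 i1 + 2 * X i0 i0 * Z i0 i0).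
Proof.
move=> tX tZ; have [ee ff he hf hh] := tr_L1_form C uF.
have fe := mxtrace_mulC (L1 f2) (L1 e2).
have eh : \tr (L1 e2 *m L1 h2) = 0 by rewrite mxtrace_mulC.
have fh : \tr (L1 f2 *m L1 h2) = 0 by rewrite mxtrace_mulC.
rewrite {1}(tr0E tX) {1}(tr0E tZ) !(L1D, L1Z) //.
move: ee ff he hf hh fe eh fh; move: (L1 e2) (L1 f2) (L1 h2) => E F' H.
move: (X i0 i1) (X i1 i0) (X i0 i0) (Z i0 i1) (Z i1 i0) (Z i0 i0) => x1 x2 x3 z1 z2 z3.
move=> ee ff he hf hh fe eh fh.
rewrite !(mulmxDl, mulmxDr) -!(scalemxAl, scalemxAr) !(mxtraceD, mxtraceZ).
rewrite ee ff he hf hh fe eh fh; ring.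
Qed.

(** [P L] is the orthogonal projection to one copy, written in the dual basis:
    $\operatorname{tr}(ef)=\tau$ and $\operatorname{tr}(h^2)=2\tau$. The remainder is orthogonal to
    both copies, hence 0. *)
Lemma L1L2_split N : lieG w N -> exists X Y, [/\ \tr X = 0, \tr Y = 0 & N = L1 X + L2 Y].
Proof.
move=> GN; set tau := \tr (L1 e2 *m L1 f2).
have t0 : tau != 0 := tr_L1ef_neq0 C uF F0 Fpos.
have trh : \tr (h2 : 'M[C]_2) = 0 by rewrite tr2E !mk2E subrr.
have trZ (x y z : C) : \tr (x *: e2 + y *: f2 + z *: h2 : 'M[C]_2) = 0.
  by rewrite !mxtraceD !mxtraceZ tr_e2 tr_f2 trh !mulr0 !addr0.
pose P (L : 'M[C]_2 -> 'M[C]_n) := (\tr (N *m L f2) / tau) *: e2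
  + (\tr (N *m L e2) / tau) *: f2 + (\tr (N *m L h2) / (2 * tau)) *: (h2 : 'M[C]_2).
have PE L Z : \tr Z = 0 -> (forall X Y, L (X + Y) = L X + L Y) ->
    (forall (c : C) X, L (c *: X) = c *: L X) ->
    \tr (N *m L Z) = \tr (L1 (P L) *m L1 Z).
  move=> tZ LD LZ; rewrite tr_L1_sl2 ?trZ // -/tau {1}(tr0E tZ) !(LD, LZ).
  rewrite !mulmxDr -!scalemxAr !mxtraceD !mxtraceZ /P.
  move: (\tr (N *m L e2)) (\tr (N *m L f2)) (\tr (N *m L h2)) => x y z.
  by rewrite !mxE /=; field.
exists (P L1), (P L2); rewrite !trZ; split=> //.
apply/eqP; rewrite -subr_eq0; apply/eqP/orthQ_eq0; split.
- rewrite -[X in N - X]scale1r -scaleNr addrC; apply: lieG_lin => //.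
  rewrite -[L1 _]scale1r; apply: lieG_lin => //; first exact/lieG_L1/trZ.
  exact/lieG_L2/trZ.
- move=> Z tZ; rewrite mulmxBl mulmxDl linearB /= mxtraceD [\tr (L2 _ *m _)]mxtrace_mulC.
  rewrite tr_L12 // addr0 -PE ?subrr //; first by move=> *; apply: L1D.
  by move=> *; apply: L1Z.
- move=> Z tZ; rewrite mulmxBl mulmxDl linearB /= mxtraceD tr_L12 ?trZ // add0r tr_L2M //.
  rewrite -PE ?subrr // => *; by [apply: L2D|apply: L2Z].
Qed.

End LieStabilizer2.

(** * The stabilizer in case (1) *)

Section TwoTypes.
Variable C : numClosedFieldType.
Variable F : seq nat.
Hypothesis uF : uniq F.
Hypothesis F0 : F != [::].
Hypothesis Fpos : forall k, k \in F -> (0 < k)%N.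
Local Notation n := (dimT F succn).
Local Notation L1 := (@L1 C F succn).
Local Notation L2 := (@L2 C F).
Local Notation rho1 := (@rhoT1 C F succn).
Local Notation rho2 := (@rhoT2 C F succn).
Implicit Types (k a b : nat) (g h X Y : 'M[C]_2) (A B z N : 'M[C]_n) (v : 'cV[C]_n).
Variable w : 'cV[C]_n.
Hypothesis wfix : forall g, SL2 g -> rhoDiag F g *m w = w.
Hypothesis wnz : forall k, k \in F -> exists b a, cf w (k, b, a) != 0.

Lemma stabOrb_rho2 g : SL2 g -> stabOrb w (rho2 g).
Proof.
have r2 h u : SL2 h -> orbitH w u -> orbitH w (rho2 h *m u).
  move=> Sh [g' [Sg' ->]]; exists (g' *m invmx h); split; first exact/SL2_M/SL2_V.
  by rewrite mulmxA -rho12C // -mulmxA (rho2_w uF wfix) // mulmxA rhoT1M.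
move=> Sg; split=> [|u]; first exact: rhoT2_unit.
split; first exact: r2.
by move/(r2 _ _ (SL2_V Sg)); rewrite mulmxA rhoT2K // mul1mx.
Qed.

Lemma stabOrb_conj A B u : stabOrb w A -> stabOrb w B -> orbitH w u ->
  orbitH w (A *m B *m invmx A *m u).
Proof.
move=> sA sB ou; have [_ sM sV] := stabOrb_group w.
by have [_ /(_ u)[H _]] := sM _ _ (sM _ _ sA sB) (sV _ sA); apply: H.
Qed.

Lemma orbitH_w g : SL2 g -> orbitH w (rho1 g *m w).
Proof. by exists g. Qed.

(** Conjugating a unipotent curve by [A] gives a curve preserving the orbit, whose velocity lies in
    [lieG w]. *)
Lemma stab_L1L2 A (L : 'M[C]_2 -> 'M[C]_n) X : L = L1 \/ L = L2 -> X = e2 \/ X = f2 ->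
  stabOrb w A ->
  exists X1 X2, [/\ \tr X1 = 0, \tr X2 = 0 & A *m L X *m invmx A = L1 X1 + L2 X2].
Proof.
move=> LE XE sA; have uA := proj1 sA.
suff G : lieG w (A *m L X *m invmx A) by apply: L1L2_split G.
suff [N [d [d1 N0 <- NE]]] : exists (N : nat -> 'M[C]_n) d, [/\ (1 < d)%N, N 0%N = 1%:M,
    N 1%N = L X & forall t, stabOrb w (\sum_(i < d) t ^+ i *: N i)].
  apply: lieG_velocity d1 N0 uA _ => // t g Sg.
  by apply: stabOrb_conj (orbitH_w Sg).
have [su sl] := (@SL2_unip C, @SL2_low C).
have s1 g : SL2 g -> stabOrb w (rho1 g) by apply: stabOrb_rho.
case: LE XE => -> [] ->.
- have [N [d [d1 N0 N1 NE]]] := unip_curve C succn uF.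
  by exists N, d; split=> // t; rewrite -NE; apply/s1/su.
- have [N [d [d1 N0 N1 NE]]] := low_curve C succn uF.
  by exists N, d; split=> // t; rewrite -NE; apply/s1/sl.
- have [N [d [d1 N0 N1 NE]]] := unip_curve2 C uF.
  by exists N, d; split=> // t; rewrite -NE; apply/stabOrb_rho2/su.
- have [N [d [d1 N0 N1 NE]]] := low_curve2 C uF.
  by exists N, d; split=> // t; rewrite -NE; apply/stabOrb_rho2/sl.
Qed.

(** A homomorphism from $\mathfrak{sl}_2$ to itself is zero or conjugation by an element of
    $\mathrm{SL}_2$. *)
Lemma sl2_triple_cases X Y : \tr X = 0 -> \tr Y = 0 ->
  lie (lie X Y) X = 2 *: X -> lie (lie X Y) Y = (-2) *: Y ->
  (X = 0 /\ Y = 0) \/ exists2 h, SL2 h & X = h *m e2 *m invmx h /\ Y = h *m f2 *m invmx h.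
Proof.
move=> tX tY eX eY; have [X0|X0] := eqVneq X 0; last first.
  have [h Sh [Xh Yh]] := sl2_pair tX tY X0 eX eY; right; exists h => //.
  by rewrite -Xh -Yh !mulmxK // SL2_unit.
left; split=> //; apply/eqP; move/esym/eqP: eY.
by rewrite X0 /lie !(mul0mx, mulmx0, subrr) scaler_eq0 oppr_eq0 pnatr_eq0.
Qed.

Lemma commutant_triple h Z : SL2 h -> \tr Z = 0 -> lie (h *m e2 *m invmx h) Z = 0 ->
  lie (h *m f2 *m invmx h) Z = 0 -> Z = 0.
Proof.
move=> Sh tZ eZ fZ; have uh := SL2_unit Sh.
have cZ X : lie (h *m X *m invmx h) Z = 0 ->
    invmx h *m Z *m h *m X = X *m (invmx h *m Z *m h).
  move E: (h *m X *m invmx h) => Y /lie0_comm e.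
  have hX : h *m X = Y *m h by rewrite -E mulmxKV.
  rewrite -!mulmxA hX !mulmxA -(mulmxA (invmx h) Z Y) -e -E !mulmxA mulVmx // mul1mx.
  by [].
have Z0 : invmx h *m Z *m h = 0.
  by apply: comm_ef0; [rewrite mxtrace_mulC mulmxA mulmxV ?mul1mx|exact: cZ|exact: cZ].
by rewrite -[Z](mulKVmx uh) -[invmx h *m Z](mulmxK uh) Z0 mul0mx mulmx0.
Qed.

Lemma lie_L1L2D X X' Y Y' :
  lie (L1 X + L2 Y) (L1 X' + L2 Y') = L1 (lie X X') + L2 (lie Y Y').
Proof.
rewrite lieDl !lieDr lie_L1L2 // [lie (L2 Y) (L1 _)]lieC lie_L1L2 // L1_lie // L2_lie //.
by rewrite oppr0 addr0 add0r.
Qed.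

(** An element common to both copies commutes with each of them, and $\mathfrak{sl}_2$ has trivial
    centre. *)
Lemma L1L2_inj X X' Y Y' : \tr X = \tr X' -> \tr Y = \tr Y' ->
  L1 X + L2 Y = L1 X' + L2 Y' -> X = X' /\ Y = Y'.
Proof.
have H0 Z W : \tr Z = 0 -> L1 Z + L2 W = 0 -> Z = 0.
  move=> tZ e; have cZ V : lie Z V = 0.
    apply/eqP; rewrite -(L1_eq0 uF F0 Fpos (m := succn)) // L1_lie //.
    have -> : L1 Z = - L2 W by apply/eqP; rewrite -addr_eq0 e.
    by rewrite -scaleN1r lieZl lieC lie_L1L2 // !oppr0 scaler0.
  by apply: comm_ef0 => //; apply: lie0_comm; rewrite cZ.
have H Z W : \tr Z = 0 -> \tr W = 0 -> L1 Z + L2 W = 0 -> Z = 0 /\ W = 0.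
  move=> tZ tW e; split; first exact: H0 e.
  apply: (@H0 W Z tW); apply: (can_inj (@conjPK _ _ uF)).
  by rewrite conjPD -L2E // conjP_L2 // addrC e /conjP mulmx0 mul0mx.
move=> tX tY e; have [] := H (X - X') (Y - Y').
- by rewrite linearB /= tX subrr.
- by rewrite linearB /= tY subrr.
- rewrite L1D // L1N // L2D // L2N // addrACA e -opprD subrr //.
by move=> /eqP; rewrite subr_eq0 => /eqP -> /eqP; rewrite subr_eq0 => /eqP ->.
Qed.

Lemma conj_lie A U V : A \in unitmx ->
  lie (A *m U *m invmx A) (A *m V *m invmx A) = A *m lie U V *m invmx A.
Proof.
by move=> uA; rewrite /lie mulmxBr mulmxBl !mulmxA !mulmxKV.
Qed.

(* Used for L = L1 and L = L2. *)
Definition carries A (L : 'M[C]_2 -> 'M[C]_n) h :=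
  forall X, \tr X = 0 -> A *m L2 X = L (h *m X *m invmx h) *m A.

Lemma carries_ef A (L : 'M[C]_2 -> 'M[C]_n) h : A \in unitmx -> SL2 h ->
  (forall (c : C) X Y, L (c *: X + Y) = c *: L X + L Y) ->
  (forall X Y, L (lie X Y) = lie (L X) (L Y)) ->
  A *m L2 e2 *m invmx A = L (h *m e2 *m invmx h) ->
  A *m L2 f2 *m invmx A = L (h *m f2 *m invmx h) -> carries A L h.
Proof.
move=> uA Sh Llin Llie Ae Af X tX; have uh := SL2_unit Sh.
have Ah : A *m L2 h2 *m invmx A = L (h *m h2 *m invmx h).
  rewrite -lie_ef -/(lie e2 f2) L2_lie // -conj_lie // Ae Af -Llie; congr L.
  by rewrite /lie mulmxBr mulmxBl !mulmxA !mulmxKV.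
suff <- : A *m L2 X *m invmx A = L (h *m X *m invmx h) by rewrite mulmxKV.
rewrite (tr0E tX) -addrA !(L2_lin uF) L2Z // !(mulmxDr, mulmxDl) -!(scalemxAr, scalemxAl).
rewrite Llin Llin Ae Af Ah; congr (_ + (_ + _)).
have L0 : L 0 = 0 
  by apply: (@addrI _ (L 0)); have := Llin 1 0 0; rewrite !scale1r !addr0.
by have := Llin (X i0 i0) (h *m h2 *m invmx h) 0; rewrite L0 !addr0.
Qed.

(** Each projection of the conjugated second copy to an ideal is zero or an isomorphism. Both cannot
    be isomorphisms: the conjugate of [L1 e2] commutes with that copy, so both its projections would
    vanish. *)
Lemma stab_cases A : stabOrb w A -> exists2 h, SL2 h & carries A L1 h \/ carries A L2 h.
Proof.
move=> sA; have uA := proj1 sA.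
have [P1 [Q1 [tP1 tQ1 E1]]] := stab_L1L2 (or_introl erefl) (or_introl erefl) sA.
have [X1 [Y1 [tX1 tY1 Ee]]] := stab_L1L2 (or_intror erefl) (or_introl erefl) sA.
have [X2 [Y2 [tX2 tY2 Ef]]] := stab_L1L2 (or_intror erefl) (or_intror erefl) sA.
have inj0 U : A *m U *m invmx A = 0 -> U = 0.
  by move=> e; rewrite -[U](mulKmx uA) -[A *m U](mulmxKV uA) e mul0mx mulmx0.
have L1e0 : L1 e2 != 0 by rewrite (L1_eq0 uF F0 Fpos) // e2_neq0.
have L2e0 : L2 e2 != 0.
  by apply: contra L1e0 => /eqP e; rewrite -conjP_L2 // e /conjP mulmx0 mul0mx.
have D2 c U V : c *: (L1 U + L2 V) = L1 (c *: U) + L2 (c *: V).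
  by rewrite scalerDr L1Z // L2Z.
have [eX eY] : lie (lie X1 X2) X1 = 2 *: X1 /\ lie (lie Y1 Y2) Y1 = 2 *: Y1.
  apply: L1L2_inj; rewrite ?tr_lie ?mxtraceZ ?tX1 ?tY1 ?mulr0 //.
  transitivity (lie (lie (L1 X1 + L2 Y1) (L1 X2 + L2 Y2)) (L1 X1 + L2 Y1)).
    by rewrite !lie_L1L2D.
  rewrite -(D2 2 X1) -Ee -Ef !conj_lie // -!L2_lie // lie_efe L2Z //.
  by rewrite -scalemxAr -scalemxAl.
have [fX fY] : lie (lie X1 X2) X2 = (-2) *: X2 /\ lie (lie Y1 Y2) Y2 = (-2) *: Y2.
  apply: L1L2_inj; rewrite ?tr_lie ?mxtraceZ ?tX2 ?tY2 ?mulr0 //.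
  transitivity (lie (lie (L1 X1 + L2 Y1) (L1 X2 + L2 Y2)) (L1 X2 + L2 Y2)).
    by rewrite !lie_L1L2D.
  rewrite -(D2 (-2) X2) -Ee -Ef !conj_lie // -!L2_lie // lie_eff L2Z //.
  by rewrite -scalemxAr -scalemxAl.
have [[x1 x2]|[h Sh [x1 x2]]] := sl2_triple_cases tX1 tX2 eX fX;
  have [[y1 y2]|[h' Sh' [y1 y2]]] := sl2_triple_cases tY1 tY2 eY fY.
- by case/eqP: L2e0; apply: inj0; rewrite Ee x1 y1 L10 L20 // addr0.
- exists h' => //; right; apply: carries_ef => //.
  + by move=> *; apply: L2_lin.
  + by move=> *; apply: L2_lie.
  + by rewrite Ee x1 L10 add0r y1.
  + by rewrite Ef x2 L10 add0r y2.
- exists h => //; left; apply: carries_ef => //.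
  + by move=> *; apply: L1_lin.
  + by move=> *; apply: L1_lie.
  + by rewrite Ee y1 L20 // addr0 x1.
  + by rewrite Ef y2 L20 // addr0 x2.
have c0 U : lie (L1 e2) (L2 U) = 0 by apply: lie_L1L2.
have [e1 e1'] : lie X1 P1 = 0 /\ lie Y1 Q1 = 0.
  apply: L1L2_inj; rewrite ?tr_lie ?mxtrace0 // -lie_L1L2D -E1 -Ee conj_lie //.
  by rewrite lieC c0 oppr0 mulmx0 mul0mx L10 L20 // addr0.
have [e3 e3'] : lie X2 P1 = 0 /\ lie Y2 Q1 = 0.
  apply: L1L2_inj; rewrite ?tr_lie ?mxtrace0 // -lie_L1L2D -E1 -Ef conj_lie //.
  by rewrite lieC c0 oppr0 mulmx0 mul0mx L10 L20 // addr0.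
have P0 : P1 = 0 by apply: (commutant_triple Sh tP1); rewrite -?x1 -?x2.
have Q0 : Q1 = 0 by apply: (commutant_triple Sh' tQ1); rewrite -?y1 -?y2.
by case/eqP: L1e0; apply: inj0; rewrite E1 P0 Q0 L10 L20 // addr0.
Qed.

Definition KHH A := exists g1 g2, [/\ SL2 g1, SL2 g2 & A = rho1 g1 *m rho2 g2].

(** Corrected by [rho2], the matrix commutes with the second copy and so acts through the first
    factor alone. It sends [w] to some [rho1 g *m w], and such operators are determined by their
    value on [w]. *)
Lemma carries2_KHH A h : stabOrb w A -> SL2 h -> carries A L2 h -> KHH A.
Proof.
move=> sA Sh cA; set z := rho2 (invmx h) *m A.
have cz X : \tr X = 0 -> z *m L2 X = L2 X *m z.
  move=> tX; rewrite /z -mulmxA cA // !mulmxA; congr (_ *m A).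
  rewrite (rhoT2_L2 uF (_ : X *m invmx h = invmx h *m (h *m X *m invmx h))) //.
  by rewrite !mulmxA mulVmx ?mul1mx // SL2_unit.
have [mu zE] := L2_schur uF (cz _ (tr_e2 C)) (cz _ (tr_f2 C)).
have [_ sM _] := stabOrb_group w.
have [_ /(_ w)[sz _]] : stabOrb w z by apply: sM => //; apply/stabOrb_rho2/SL2_V.
have [|g [Sg e]] := sz; first by exists 1%:M; rewrite rhoT1_1 // mul1mx; split=> //; apply: SL2_1.
have {}zE : z = rho1 g.
  rewrite zE -(recov_lift1 uF F0 wfix wnz) -zE e {1}rhoT1E (recov_lift1 uF F0 wfix wnz).
  by rewrite -rhoT1E.
exists g, h; split=> //.
by rewrite rho12C // -zE /z mulmxA rhoT2V // mul1mx.
Qed.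

(** Elements carrying the second copy to the same ideal differ by one that preserves it, which makes
    the ideal a label for cosets. *)
Lemma carries_inv A B L h h' : A \in unitmx -> SL2 h -> SL2 h' ->
  carries A L h -> carries B L h' -> carries (invmx A *m B) L2 (invmx h *m h').
Proof.
move=> uA Sh Sh' cA cB X tX; have uh := SL2_unit Sh; have uh' := SL2_unit Sh'.
have Sq : SL2 (invmx h *m h') by apply/SL2_M/Sh'/SL2_V.
have := mulKVmx uh h'; move: (invmx h *m h') Sq => q Sq hq.
have Vh' : invmx h' = invmx q *m invmx h.
  have uq := SL2_unit Sq.
  rewrite -[RHS](mulKmx uh') -{3}hq -(mulmxA h) (mulmxA q) mulmxV // mul1mx mulmxV //.
  by rewrite mulmx1.
have tq : \tr (q *m X *m invmx q) = 0 by rewrite conj_tr.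
have := cA _ tq; rewrite !mulmxA hq -(mulmxA _ (invmx q)) -Vh' => e.
rewrite -(mulmxA (invmx A)) cB //; apply: (canLR (mulKmx uA)).
by rewrite !mulmxA e mulmxK.
Qed.

End TwoTypes.

(** * The image of $H\times\bar H$ is closed *)

Section ProductImage.
Variable C : numClosedFieldType.
Variable F : seq nat.
Hypothesis uF : uniq F.
Hypothesis F0 : F != [::].
Hypothesis Fpos : forall k, k \in F -> (0 < k)%N.
Local Notation n := (dimT F succn).
Local Notation L1 := (@L1 C F succn).
Local Notation L2 := (@L2 C F).
Local Notation rho1 := (@rhoT1 C F succn).
Local Notation rho2 := (@rhoT2 C F succn).
Local Notation KHH := (@KHH C F).
Local Notation k0 := (head 0%N F).
Local Notation rd := (@readX C F succn k0 (k0, 0%N, 0%N) (k0, 0%N, 1%N)).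
Local Notation conjP := (@conjP C F).
Implicit Types (k a b : nat) (g h X Y : 'M[C]_2) (A B z N : 'M[C]_n) (v : 'cV[C]_n).

Lemma KHH_subgroup : mxsubgroup KHH.
Proof.
split.
- by exists 1%:M, 1%:M; rewrite rhoT1_1 // rhoT2_1 // mul1mx; split=> //; apply: SL2_1.
- move=> _ _ [g1 [g2 [S1 S2 ->]]] [h1 [h2 [T1 T2 ->]]]; exists (g1 *m h1), (g2 *m h2).
  split; [exact: SL2_M|exact: SL2_M|].
  rewrite rhoT1M // rhoT2M // -!mulmxA; congr (_ *m _).
  by rewrite !mulmxA -rho12C.
- move=> _ [g1 [g2 [S1 S2 ->]]]; exists (invmx g1), (invmx g2).
  split; [exact: SL2_V|exact: SL2_V|].
  set x := rho1 g1 *m rho2 g2; set y := rho1 _ *m rho2 _.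
  have e : x *m y = 1%:M.
    rewrite /x /y (rho12C uF g1) -!mulmxA (mulmxA (rho1 g1)) rhoT1V // mul1mx.
    exact: rhoT2V.
  by rewrite -[y]mul1mx -(mulVmx (proj1 (mulmx1_unit e))) -mulmxA e mulmx1.
Qed.

Lemma KHH_unit A : KHH A -> A \in unitmx.
Proof.
by case=> g1 [g2 [S1 S2 ->]]; rewrite unitmx_mul rhoT1_unit // rhoT2_unit.
Qed.

Lemma KHH_conjP A : KHH A -> KHH (conjP A).
Proof.
case=> g1 [g2 [S1 S2 ->]]; exists g2, g1; split=> //.
by rewrite conjPM // -rho2E // (rho2E uF g2) conjPK // rho12C.
Qed.

Lemma polymx_conjP : polymx (fun B => conjP B).
Proof.
apply: polymxM; last exact: polymx_const.
by apply: polymxM; [exact: polymx_const|exact: polymx_id].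
Qed.

Lemma inclosure_conjP A : inclosure KHH A -> inclosure KHH (conjP A).
Proof.
move=> KA f pf f0; apply: (KA (fun B => f (conjP B))).
  exact: polyfun_comp polymx_conjP pf.
by move=> B /KHH_conjP; apply: f0.
Qed.

Lemma conjP_unit A : (conjP A \in unitmx) = (A \in unitmx).
Proof.
have /mulmx1_unit [uP _] : Psw C F *m Psw C F = 1%:M by apply: PswK.
by rewrite /conjP !unitmx_mul uP andbT.
Qed.
Lemma conjP_det A : \det (conjP A) = \det A.
Proof.
rewrite /conjP !det_mulmx mulrAC -det_mulmx PswK // det1 mul1r //.
Qed.

Lemma KHH_L1 X : \tr X = 0 -> forall A, KHH A ->
  exists2 Y, \tr Y = 0 & A *m L1 X = L1 Y *m A.
Proof.
move=> tX _ [g1 [g2 [S1 S2 ->]]]; exists (g1 *m X *m invmx g1); first by rewrite conj_tr.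
by rewrite -(mulmxA (rho1 g1)) rho2_L1C // mulmxA rho_conj // mulmxA.
Qed.

Lemma cm_KHH g1 g2 k : k \in F ->
  cm (rho1 g1 *m rho2 g2) (k, 0%N, 0%N) (k, 0%N, 0%N) = (g1 i0 i0 * g2 i0 i0) ^+ k.
Proof.
move=> Fk; have vd a : (a <= k)%N -> (k, 0%N, a) \in tidx F succn.
  by move=> lea; rewrite mem_tidxs // Fk leq0n.
rewrite rhoT1E cm_lift1l ?vd //.
rewrite (sum_ord_nat (G := fun d => rhoE k g1 0 d *
  cm (rho2 g2) (k, 0%N, d) (k, 0%N, 0%N)) (leq0n k)).
  by rewrite rhoE_00 rhoT2E cm_lift2 ?vd // !eqxx /= rhoE_00 exprMn.
move=> d d0; have [le|lt] := leqP d k.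
  by rewrite rhoT2E cm_lift2 ?vd // (negPf d0) andbF mulr0.
by rewrite cm_outl ?mulr0 // mem_tidxs // [(d <= k)%N]leqNgt lt !andbF.
Qed.

(** A limit point corrected by one element of each factor commutes with both copies of
    $\mathfrak{sl}_2$, so it is a scalar on each $R_k\otimes\bar R_k$. These scalars are
    $\varepsilon^k$ for a sign $\varepsilon$, which the first factor absorbs. *)
Lemma KHH_closed : zclosedGL KHH.
Proof.
apply: zclosed_closure => [A|A uA KA]; first exact: KHH_unit.
have [h1 Sh1 z1L] := L1_tr0_split uF F0 Fpos (fun k _ => ltn0Sn k) uA
  (inclosure_L1 uF F0 Fpos (fun k _ => ltn0Sn k) (@KHH_L1 _ (tr_e2 C)) uA KA)
  (inclosure_L1 uF F0 Fpos (fun k _ => ltn0Sn k) (@KHH_L1 _ (tr_f2 C)) uA KA).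
have uA' : conjP A \in unitmx by rewrite conjP_unit.
have KA' := inclosure_conjP KA.
have [h2 Sh2 z2L] := L1_tr0_split uF F0 Fpos (fun k _ => ltn0Sn k) uA'
  (inclosure_L1 uF F0 Fpos (fun k _ => ltn0Sn k) (@KHH_L1 _ (tr_e2 C)) uA' KA')
  (inclosure_L1 uF F0 Fpos (fun k _ => ltn0Sn k) (@KHH_L1 _ (tr_f2 C)) uA' KA').
set z := rho1 (invmx h1) *m (rho2 (invmx h2) *m A).
have Sv1 := SL2_V Sh1; have Sv2 := SL2_V Sh2.
have c1 X : \tr X = 0 -> z *m L1 X = L1 X *m z.
  move=> tX; rewrite /z [rho1 _ *m (rho2 _ *m _)]mulmxA rho12C // -(mulmxA (rho2 _)).
  by rewrite -[LHS]mulmxA z1L // !mulmxA rho2_L1C.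
have c2 X : \tr X = 0 -> z *m L2 X = L2 X *m z.
  have : conjP (conjP A) = A by apply: conjPK.
  move: (conjP A) z2L => A' z2L A'E tX; have := congr1 conjP (z2L _ tX).
  rewrite !conjPM // A'E -!rho2E // -!L2E // => e.
  by rewrite /z -[LHS]mulmxA e !mulmxA rho1_L2C.
have Kz : inclosure KHH z.
  have KM U B : KHH U -> KHH B -> KHH (U *m B) by case: KHH_subgroup => _ KM _; apply: KM.
  apply: inclosure_mull => [B|].
    by apply: KM; exists (invmx h1), 1%:M; rewrite rhoT2_1 // mulmx1; split=> //; apply: SL2_1.
  apply: inclosure_mull KA => B.
  by apply: KM; exists 1%:M, (invmx h2); rewrite rhoT1_1 // mul1mx; split=> //; apply: SL2_1.
have uz : z \in unitmx.
  by rewrite !unitmx_mul rhoT1_unit // rhoT2_unit.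
suff [eps eps2 zE] : exists2 eps, eps ^+ 2 = 1 & z = rho1 (eps%:M).
  have -> : A = rho1 h1 *m rho2 h2 *m z.
    rewrite /z (rho12C uF h1) -!mulmxA (mulmxA (rho1 h1)) rhoT1V // mul1mx.
    by rewrite mulmxA rhoT2V // mul1mx.
  rewrite zE -mulmxA -rho12C // mulmxA -rhoT1M //.
  by exists (h1 *m eps%:M), h2; split=> //; apply: SL2_M => //; apply: SL2_scal.
have dz : \det z != 0 by rewrite -unitfE -unitmxE.
have vd k j : k \in F -> (j <= k)%N -> (k, j, 0%N) \in tidx F succn.
  by move=> Fk lej; rewrite mem_tidxs // Fk lej.
have zS := L1_schur uF (c1 _ (tr_e2 C)) (c1 _ (tr_f2 C)).
have [mu zmu] := L2_schur uF (c2 _ (tr_e2 C)) (c2 _ (tr_f2 C)).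
pose c k := top_entry k z.
have entry k i j : k \in F -> (i < k.+1)%N -> (j < k.+1)%N ->
    cm z (k, i, 0%N) (k, j, 0%N) = c k * (i == j)%:R.
  move=> Fk lei lej; rewrite /c /top_entry (gtn_eqF (Fpos Fk)) zmu !cm_lift1 ?vd //.
  by rewrite !eqxx /=; case: eqP; rewrite ?mulr1 ?mulr0.
have c0 : c 0%N = 1 by rewrite /c /top_entry eqxx.
suff cM : forall k l, k \in 0%N :: F -> l \in 0%N :: F -> ~~ odd (k + l) -> c k * c l = 1.
  have [eps eps2 topE] := sign_powers c0 cM.
  exists eps => //; rewrite zS; apply: lift2_scal_rho => // k i j Fk lti ltj.
  by rewrite entry // topE.
move=> k l Fk Fl ev; set d := (k + l)./2; have dE : (k + l = d * 2)%N.
    by rewrite muln2 -[LHS]odd_double_half (negPf ev).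
  (* On [rho1 g1 *m rho2 g2] the values of [r0] before and after the exchange are the determinant
     times the squares of [g1 i0 i0] and [g2 i0 i0]. Only their product can be compared with the top
     entry, which contains both. *)
  pose r0 B := rd (cadj e2 B) i0 i1.
  have pr0 : polyfun r0 by apply: polymx_rd; apply: polymx_cadj.
  have ptop k' : polyfun (fun B => top_entry k' B).
    rewrite /top_entry; case: (_ == 0%N); first exact: polyfun_const.
    exact: (polyfun_cm _ _ (@polymx_id _ _)).
  have pdet : polyfun (fun B : 'M[C]_n => \det B) by apply/polyfun_det/polymx_id.
  have r0E B X : B *m L1 e2 = L1 X *m B -> r0 B = \det B * X i0 i1.
    by move=> e; rewrite /r0 (cadjE e) readL1 // mxE.
  have e0 : c k * c l * (\det z * \det z) ^+ d - (r0 z * r0 (conjP z)) ^+ d = 0.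
    apply: (Kz (fun B => top_entry k B * top_entry l B * (\det B * \det B) ^+ d
      - (r0 B * r0 (conjP B)) ^+ d)).
      apply: polyfunB.
        by apply: polyfunM; [exact: polyfunM|by apply: polyfunX; exact: polyfunM].
      apply: polyfunX; apply: polyfunM => //.
      exact: polyfun_comp polymx_conjP pr0.
    move=> _ [g1 [g2 [S1 S2 ->]]]; set B := rho1 g1 *m rho2 g2.
    have tE k' : k' \in 0%N :: F -> top_entry k' B = (g1 i0 i0 * g2 i0 i0) ^+ k'.
      by rewrite inE /top_entry; case: eqP => [->//|_ /= Fk']; rewrite cm_KHH.
    have r1 g g' : SL2 g -> r0 (rho1 g *m rho2 g') =
        \det (rho1 g *m rho2 g') * g i0 i0 ^+ 2.
      move=> Sg; rewrite (r0E _ (g *m e2 *m invmx g)) ?conj_e2_01 //.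
      by rewrite -(mulmxA (rho1 g)) rho2_L1C // mulmxA rho_conj // mulmxA.
    have conjB : conjP B = rho1 g2 *m rho2 g1.
      by rewrite conjPM // -rho2E // (rho2E uF g2) conjPK // rho12C.
    rewrite !tE // {1}/B r1 // conjB r1 // -conjB conjP_det -/B.
    rewrite -exprD dE mulnC exprM -exprMn; apply/eqP; rewrite subr_eq0; apply/eqP.
    by congr (_ ^+ _); ring.
  have cz : conjP z *m L1 e2 = L1 e2 *m conjP z.
    by have := congr1 conjP (c2 _ (tr_e2 C)); rewrite !conjPM // conjP_L2.
  move: e0; rewrite (r0E _ _ (c1 _ (tr_e2 C))) (r0E _ _ cz) conjP_det mk2E !mulr1.
  rewrite -{2}[_ ^+ d]mul1r -mulrBl => /eqP; rewrite mulf_eq0 expf_eq0 mulf_eq0 orbb.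
  by rewrite (negPf dz) andbF orbF subr_eq0 => /eqP.
Qed.
End ProductImage.

(** * Transport of identity components along an isomorphism *)

Section IdentityComponentTransport.
Variable C : numClosedFieldType.
Variables (n n' : nat) (phi : 'M[C]_(n', n)) (psi : 'M[C]_(n, n')).
Hypotheses (psiK : psi *m phi = 1%:M) (phiK : phi *m psi = 1%:M).
Local Notation Phi A := (phi *m A *m psi).
Local Notation Psi B := (psi *m B *m phi).

Lemma conjphiM (A B : 'M[C]_n) : Phi (A *m B) = Phi A *m Phi B.
Proof. by rewrite !mulmxA -(mulmxA (phi *m A) psi) psiK mulmx1. Qed.
Lemma conjphiK (B : 'M[C]_n') : Phi (Psi B) = B.
Proof. by rewrite !mulmxA phiK mul1mx -mulmxA phiK mulmx1. Qed.
Lemma conjpsiK (A : 'M[C]_n) : Psi (Phi A) = A.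
Proof. by rewrite !mulmxA psiK mul1mx -mulmxA psiK mulmx1. Qed.
Lemma conjphi_unit (A : 'M[C]_n) : A \in unitmx -> Phi A \in unitmx.
Proof.
move=> uA; have e : Phi A *m Phi (invmx A) = 1%:M.
  by rewrite -conjphiM mulmxV // mulmx1 phiK.
by case: (mulmx1_unit e).
Qed.
Lemma conjphiV (A : 'M[C]_n) : A \in unitmx -> Phi (invmx A) = invmx (Phi A).
Proof.
move=> uA; rewrite -[LHS](mulKmx (conjphi_unit uA)) -conjphiM mulmxV //.
by rewrite mulmx1 phiK mulmx1.
Qed.

(** Conjugation by the mutually inverse [phi] and [psi] is polynomial, so closed subgroups of finite
    index can be pulled back. *)
Lemma idcomp_conjphi (G : 'M[C]_n -> Prop) (G' : 'M[C]_n' -> Prop) A :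
  (forall B, G B -> B \in unitmx) ->
  (forall B, G B <-> G' (Phi B)) -> idcomp G A -> idcomp G' (Phi A).
Proof.
move=> Gu GG' [GA IA]; split; first exact/GG'.
move=> K cK [K1 KM KV] KG [s sP].
have uK B : K B -> Psi B \in unitmx by move=> /KG; rewrite -{1}[B]conjphiK => /GG'/Gu.
have KPu B : K (Phi B) -> B \in unitmx by rewrite -{2}[B]conjpsiK; apply: uK.
apply: (IA (fun B => K (Phi B))).
- apply: zclosed_closure => // B uB KB; case: cK => S SP; apply/SP.
  split=> [|p Sp]; first exact: conjphi_unit.
  apply: (KB (fun B => evalpf p (Phi B))); last by move=> B' /SP[_]; apply.
  apply: (polyfun_comp (M := fun B => Phi B)); last by exists p.
  by apply: polymxM; [apply: polymxM; [exact: polymx_const|exact: polymx_id]|exact: polymx_const].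
- split=> [|B B' KB KB'|B KB]; rewrite ?mulmx1 ?phiK //.
    by rewrite conjphiM; apply: KM.
  by rewrite conjphiV ?KPu //; apply: KV.
- by move=> B /KG/GG'.
exists [seq Psi t | t <- s] => B /GG' /sP [t ts [Gt Kt]]; exists (Psi t).
  exact: map_f.
have Gt' : G (Psi t) by apply/GG'; rewrite conjphiK.
by split=> //; rewrite conjphiM conjphiV ?conjphiK // Gu.
Qed.
End IdentityComponentTransport.

Section StabilizerCase1.
Variable C : numClosedFieldType.
Variable F : seq nat.
Hypothesis uF : uniq F.
Hypothesis F0 : F != [::].
Hypothesis Fpos : forall k, k \in F -> (0 < k)%N.
Local Notation rho1 := (@rhoT1 C F succn).
Local Notation rho2 := (@rhoT2 C F succn).

Lemma Ggrp_KHH (w : 'cV[C]_(dimT F succn)) :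
  (forall g, SL2 g -> rhoDiag F g *m w = w) ->
  (forall k, k \in F -> exists b a, cf w (k, b, a) != 0) ->
  forall A, Ggrp w A <-> KHH A.
Proof.
move=> wfix wnz A; have sG := stabOrb_group w; have [_ sM sV] := sG.
have s1 g : SL2 g -> stabOrb w (rho1 g) by apply: stabOrb_rho.
have s2 g : SL2 g -> stabOrb w (rho2 g) by apply: stabOrb_rho2.
split=> [[_ H]|[g1 [g2 [S1 S2 ->]]]]; last first.
  have [_ IM _] := idcomp_group sG; apply: IM; first exact: Himg_idcomp s1 _ S1.
  apply: SL2_idcomp s2 _ S2; first exact: rhoT2_1.
  by move=> *; apply: rhoT2M.
apply: H; [exact: KHH_closed|exact: KHH_subgroup| |].
  by move=> _ [g1 [g2 [S1 S2 ->]]]; apply: sM; [exact: s1|exact: s2].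
(* The label of a stabilizer element is the ideal to which it carries the second copy of
   $\mathfrak{sl}_2$. *)
pose Q B (i : bool) := exists2 h, SL2 h &
  carries B (if i then @L1 C F succn else @L2 C F) h.
apply: (@finite_index_inv _ _ bool [:: true; false] Q).
  move=> B /(stab_cases uF F0 Fpos wfix wnz) [h Sh [c|c]].
    by exists true => //; exists h.
  by exists false => //; exists h.
move=> B B' i sB sB' [h Sh cB] [h' Sh' cB'].
apply: (carries2_KHH uF F0 wfix wnz) (carries_inv (proj1 sB) Sh Sh' cB cB').
  by apply: sM => //; apply: sV.
exact/SL2_M/Sh'/SL2_V.
Qed.

Lemma blk_sum (w : 'cV[C]_(dimT F succn)) : w = \sum_(k <- F) blk k w.
Proof.
apply/matrixP => p j; rewrite (ord1 j) summxE; have [Fk _ _] := tixP p.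
rewrite (bigD1_seq _ Fk uF) /= mxE eqxx big1 ?addr0 // => k ne.
by rewrite mxE eq_sym (negPf ne).
Qed.

Lemma blk_neq0 (w : 'cV[C]_(dimT F succn)) k : blk k w != 0 ->
  exists b a, cf w (k, b, a) != 0.
Proof.
move=> w0; have [p] : exists p, blk k w p ord0 != 0.
  apply: contrapT => nex; case/eqP: w0; apply/matrixP => p j; rewrite (ord1 j) [RHS]mxE.
  by apply/eqP; apply: contraT => ne; case: nex; exists p.
rewrite mxE; have [e|_] := eqVneq (tix p).1.1 k; last by rewrite eqxx.
move=> ne; exists (tix p).1.2, (tix p).2; rewrite -e.
by rewrite (_ : (_, _, _) = tix p) ?cf_tix //; case: (tix p) => [[]].
Qed.

(** The isomorphism [phi] carries the orbit of [v] to that of [phi *m v], hence conjugates one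
    stabilizer to the other. *)
Lemma Ggrp_case1 (m : nat -> nat) (v : 'cV[C]_(dimT F m)) phi psi : case1 v phi psi ->
  forall A, Ggrp v A <-> imgHHbar phi psi A.
Proof.
case=> psiK phiK phiH blkP A.
set w := phi *m v.
have wfix g : SL2 g -> rhoDiag F g *m w = w.
  move=> Sg; rewrite {1}(blk_sum w) mulmx_sumr [RHS]blk_sum; apply: eq_big_seq => k Fk.
  by case: (blkP k Fk) => _; apply.
have wnz k : k \in F -> exists b a, cf w (k, b, a) != 0.
  by move=> Fk; apply: blk_neq0; case: (blkP k Fk).
have orb u : orbitH v u <-> orbitH w (phi *m u).
  split=> [[g [Sg ->]]|[g [Sg e]]]; exists g; split=> //.
    by rewrite mulmxA phiH // -mulmxA.
  by rewrite -[u]mul1mx -psiK -mulmxA e /w (mulmxA _ phi) -phiH // !mulmxA psiK mul1mx.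
have stab B : stabOrb v B <-> stabOrb w (phi *m B *m psi).
  have E u : phi *m B *m psi *m (phi *m u) = phi *m (B *m u).
    by rewrite !mulmxA -(mulmxA _ psi) psiK mulmx1.
  split=> [[uB sB]|[uB sB]]; split.
  - exact: conjphi_unit.
  - move=> u; rewrite -[u]mul1mx -phiK -(mulmxA phi) E -!orb; exact: sB.
  - by rewrite -[B](conjpsiK psiK); apply: (conjphi_unit phiK).
  - by move=> u; rewrite !orb -E; apply: sB.
have sU B : stabOrb v B -> B \in unitmx by case.
have sU' B : stabOrb w B -> B \in unitmx by case.
have -> : Ggrp v A <-> Ggrp w (phi *m A *m psi).
  split; first exact: idcomp_conjphi.
  move=> H; rewrite -[A](conjpsiK psiK); move: H.
  apply: (idcomp_conjphi phiK psiK) => // B.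
  by rewrite stab (conjphiK phiK).
rewrite (Ggrp_KHH wfix wnz); split=> [[g1 [g2 [S1 S2 e]]]|[g1 [g2 [S1 S2 ->]]]].
  by exists g1, g2; split=> //; rewrite -e (conjpsiK psiK).
by exists g1, g2; rewrite (conjphiK phiK).
Qed.
End StabilizerCase1.

Unset Implicit Arguments. Set Strict Implicit. Set Printing Implicit Defensive.

Theorem theorem7p4 (R : realType) (F : seq nat) (m : nat -> nat)
    (v : 'cV[R[i]]_(dimT F m)) :
  uniq F -> F != [::] -> (forall k, k \in F -> (0 < k)%N) ->
  (forall k, k \in F -> (0 < m k)%N) ->
  generic v ->
  (~ (forall A, connNormGH v A <-> @HimgV _ F m A) ->
     exists (s : 'M[R[i]]_(dimT F m)) (h : 'M[R[i]]_2),
       [/\ centH s, SL2 h &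
           let w := s *m (rhoT1 F m h *m v) in
           (exists phi psi, case1 w phi psi) \/ case2 w \/ case3 w])
  /\ (forall phi psi, case1 v phi psi ->
        forall A, Ggrp v A <-> imgHHbar phi psi A).
Proof.
move=> uF F0 Fpos mpos gv; split=> [nH|phi psi c1].
  have [s [h [cs Sh c23]]] := generic_case2_case3 uF F0 Fpos mpos gv nH.
  by exists s, h; split=> //; right.
exact: Ggrp_case1.
Qed.
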